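(* Let $P(\lambda)=\sum_{i=0}^dP_i\lambda^i$ with $P_i\in\mathbb{C}^{k\times k}$ be a matrix polynomial, and assume that the block companion pencil used satisfies $$\sqrt{\|[M_0,\ldots,M_{d-1}]\|^2+\|[N_1,\ldots,N_d]\|^2}\approx\sqrt{\sum_{i=0}^d\|P_i\|^2}.$$ Suppose the eigenvalues of $P(\lambda)$ are computed in floating point arithmetic by the structured product eigenvalue algorithm (described in the context), including a scaling of the order $\sqrt{\sum_{i=0}^d\|P_i\|^2}$, i.e. applied to $\alpha^{-1}P(\lambda)$ with $\alpha\approx\sqrt{\sum_{i=0}^d\|P_i\|^2}$. Then the computed eigenvalues are the exact eigenvalues of a nearby polynomial $$P(\lambda)+\delta P(\lambda)=\sum_{i=0}^d(P_i+\delta P_i)\lambda^i,$$ where $$\sqrt{\sum_{i=0}^d\|\delta P_i\|^2}\lesssim u\,\sqrt{\sum_{i=0}^d\|P_i\|^2}$$ and $u$ is the unit round-off.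
   Context: Block companion pencil. With $n=dk$, the pencil $S-\lambda T\in\mathbb{C}^{n\times n}[\lambda]$ of $P(\lambda)$ is formed with $S$ having identity blocks $I_k$ on the block subdiagonal, last block column $-M_0,-M_1,\dots,-M_{d-1}$ and zeros elsewhere, and $T$ having the first $d-1$ block columns of the identity and last block column $N_1,\dots,N_d$, where $M_0=P_0$, $N_d=P_d$, and $M_i+N_i=P_i$ for the other $i$. It has the same eigenvalues as $P(\lambda)$. In a preprocessing step, a unitary equivalence $P_i\mapsto U_0^*P_iV_0$ (computed by a backward stable generalized Schur decomposition) makes $P_d=N_d$ upper triangular, and $P_0=M_0$ lower triangular (Frobenius factorization) or upper triangular (Gaussian factorization). Factorizations. Let $\mathcal{Q}\in\mathbb{C}^{n\times n}$ be the cyclic downshift matrix (ones on the subdiagonal and in position $(1,n)$). One writes $T=T_1\cdots T_k$ with each $T_i$ upper triangular and identity-plus-spike (identity plus a matrix with a single nonzero column), the spike in column $n+1-i$, and either $S=\mathcal{Q}R_1\mathcal{Q}R_2\cdots\mathcal{Q}R_k$ (Frobenius factorization; each $\mathcal{Q}R_i$ is a scalar companion matrix and the spike of $R_i$ is in column $n$) or $S=\mathcal{Q}^kR_1\cdots R_k$ (Gaussian factorization; the spike of $R_i$ is in column $n+1-i$), each $R_i$ upper triangular identity-plus-spike. No arithmetic is involved in forming these factors. Storage and operations. A core transformation is an identity matrix except for a unitary $2\times2$ diagonal block in rows and columns $i,i+1$. $\mathcal{Q}$ is a product of $n-1$ core transformations. Each upper triangular factor $R$ is stored as $R=\Pi^T\mathcal{C}^*(\mathcal{B}+e_1\underline{y}^T)\Pi$,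 with $\Pi\in\mathbb{C}^{(n+1)\times n}$ the identity with an extra zero bottom row and $\mathcal{C}=C_1\cdots C_n$, $\mathcal{B}=B_1\cdots B_n$ products of core transformations; only $\mathcal{C},\mathcal{B}$ are stored, and $\underline{y}^T=-(e_{n+1}^T\mathcal{C}^*e_1)^{-1}e_{n+1}^T\mathcal{C}^*\mathcal{B}$ is recovered from them. The operations are: fusion (multiplying two core transformations acting on the same rows), turnover (refactoring a product $F_iG_{i+1}H_i$ of core transformations as $F'_{i+1}G'_iH'_{i+1}$ or vice versa), and pass-through (moving a core transformation $G$ from one side of an upper triangular factor to the other, $RG=\tilde G\tilde R$, executed by two turnovers on $\mathcal{C}^*\mathcal{B}$ only). Fusions and turnovers are backward stable: they introduce only errors of order $u$ and keep the factors unitary. Algorithm. Using only these operations, one performs a unitary equivalence that chases away all core transformations not belonging to the first factor of $S$, reaching Hessenberg-triangular form with all factors except the first factor of $S$ upper triangular (core transformations reaching the outer left are moved to the outer right by similarity on $ST^{-1}$, and passing through $T_i^{-1}$ is done by passing the conjugate transpose through $T_i$). Then implicitly shifted (Francis) QR steps are applied to the product $ST^{-1}$ in factored form by core chasing; zero eigenvalues are deflated beforehand, and deflations occur when a core transformation in the leading Hessenberg factor is numerically diagonal. This continues until $U^*SV$ and $U^*TV$ are upper triangular ($U,V$ unitary); the eigenvalues are the ratios of the diagonal entries, each formed from the diagonal entries of the factors. Conventions. $\|\cdot\|$ is the Frobenius norm; $\approx$ means equal up to modest factors; $\lesssim$ means less than or equal up to multiplication by a polynomial in $d$ and $k$ of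 modest degree; the error analysis is to first order in $u$ (higher-order terms are dropped).
   Formalization: The formal theorem additionally assumes that the algorithm stops after a number of elementary operations bounded by a polynomial in d and k (otherwise rounding errors can accumulate without such a bound), and that no computed eigenvalue is a quotient 0/0. *)

(* Defs.v *)
From HB Require Import structures.
From Stdlib Require List.
From mathcomp Require Import all_boot all_order all_algebra.
From mathcomp Require Import spectral.
From mathcomp Require Import reals complex.

Set Implicit Arguments.
Unset Strict Implicit.
Unset Printing Implicit Defensive.

Import Order.TTheory GRing.Theory Num.Theory ComplexField.Normc.

Local Open Scope ring_scope.
Local Open Scope complex_scope.
Local Open Scope sesquilinear_scope.

(* [nsteps r m s s'] : s' is reached from s by exactly m steps of r. *)
Inductive nsteps (T : Type) (r : T -> T -> Prop) : nat -> T -> T -> Prop :=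
| NSteps0 s : nsteps r 0 s s
| NStepsS m s s' s'' : r s s' -> nsteps r m s' s'' -> nsteps r m.+1 s s''.

Section Defs.
Variable R : realType.
Local Notation C := R[i].

Definition adj m n (A : 'M[C]_(m, n)) : 'M[C]_(n, m) := A^t*.

Definition fnorm2 m n (A : 'M[C]_(m, n)) : R :=
  \sum_i \sum_j normc (A i j) ^+ 2.

Definition fnorm m n (A : 'M[C]_(m, n)) : R := Num.sqrt (fnorm2 A).

(* Equality up to the factor c. *)
Definition approx (c x y : R) : Prop := x <= c * y /\ y <= c * x.

(* Polynomial in d and k of size K, q.  Since d, k >= 1, every polynomial in d
   and k is dominated by one of these. *)
Definition modest (K : R) (q d k : nat) : R := K * ((d * k) ^ q)%:R.

(* A polynomial matrix of grade d is given by its coefficients P 0, ..., P d;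
   the values of P beyond d are irrelevant. *)
Definition polymx d k (P : nat -> 'M[C]_k) : 'M[{poly C}]_k :=
  \sum_(i < d.+1) 'X^i *: map_mx polyC (P i).

Definition polynorm d k (P : nat -> 'M[C]_k) : R :=
  Num.sqrt (\sum_(i < d.+1) fnorm2 (P i)).

(* evs lists the eigenvalues of the regular matrix polynomial P, with their
   algebraic multiplicities; None is the infinite eigenvalue, i.e. the
   eigenvalue 0 of the reversed polynomial. *)
Definition eigenvalues_of d k (P : nat -> 'M[C]_k) (evs : seq (option C)) :=
  [/\ \det (polymx d P) != 0,
      forall z : C, count_mem (Some z) evs = mup z (\det (polymx d P)) &
      count_mem None evs = mup 0 (\det (polymx d (fun i => P (d - i)%N)))].

(* The splitting P_0 = M_0, P_d = N_d, P_i = M_i + N_i that defines a block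
   companion pencil; only M 0, ..., M (d-1) and N 1, ..., N d are relevant. *)
Definition splitting d k (P M N : nat -> 'M[C]_k) : Prop :=
  [/\ M 0%N = P 0%N, N d = P d &
      forall i, (0 < i < d)%N -> M i + N i = P i].

Definition splitnorm d k (M N : nat -> 'M[C]_k) : R :=
  Num.sqrt (\sum_(0 <= i < d) fnorm2 (M i) + \sum_(1 <= i < d.+1) fnorm2 (N i)).

Lemma inner_subproof d k (a : 'I_(d * k)) : (a %% k < k)%N.
Proof.
by rewrite ltn_mod; case: k a => // -[m]; rewrite muln0.
Qed.

(* Row (or column) a of a dk x dk matrix lies in block a %/ k, at position
   inner a inside that block. *)
Definition inner d k (a : 'I_(d * k)) : 'I_k := Ordinal (inner_subproof a).

Definition pencilS d k (M : nat -> 'M[C]_k) : 'M[C]_(d * k) :=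
  \matrix_(a, b) if (b < d.-1 * k)%N then (a == b + k :> nat)%N%:R
                 else - M (a %/ k)%N (inner a) (inner b).

Definition pencilT d k (N : nat -> 'M[C]_k) : 'M[C]_(d * k) :=
  \matrix_(a, b) if (b < d.-1 * k)%N then (a == b)%:R
                 else N (a %/ k).+1 (inner a) (inner b).

Definition downshift n : 'M[C]_n := \matrix_(a, b) (a == b.+1 %% n :> nat)%N%:R.

Definition spikemx n (l : nat) (v : 'cV[C]_n) : 'M[C]_n :=
  \matrix_(a, b) if b == l :> nat then v a 0 else (a == b)%:R.

(* The core transformation of size m acting on rows i and i+1 (numbered from
   0) through the 2 x 2 matrix G. *)
Definition core m (i : nat) (G : 'M[C]_2) : 'M[C]_m :=
  \matrix_(a, b) if (i <= a <= i.+1)%N && (i <= b <= i.+1)%N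
                 then G (inord (a - i)) (inord (b - i)) else (a == b)%:R.

Definition flip : 'M[C]_2 := \matrix_(a, b) (a != b)%:R.

(* A stored upper triangular factor of size n: the active parts of the core
   transformations C_i and B_i, i < n; other indices are irrelevant. *)
Record factor := Factor { coreC : nat -> 'M[C]_2; coreB : nat -> 'M[C]_2 }.

Definition prodC n (F : factor) : 'M[C]_n.+1 :=
  \prod_(i < n) core n.+1 i (coreC F i).

Definition prodB n (F : factor) : 'M[C]_n.+1 :=
  \prod_(i < n) core n.+1 i (coreB F i).

Definition factor_y n (F : factor) : 'rV[C]_n.+1 :=
  - (adj (prodC n F) ord_max ord0)^-1 *: row ord_max (adj (prodC n F) *m prodB n F).

Definition Pimx n : 'M[C]_(n.+1, n) := pid_mx n.

(* The matrix represented by a stored factor,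
   Pi^T C^* (B + e_1 y^T) Pi. *)
Definition factor_mx n (F : factor) : 'M[C]_n :=
  (Pimx n)^T *m (adj (prodC n F) *m
    (prodB n F + delta_mx ord0 ord0 *m factor_y n F)) *m Pimx n.

Definition unitary_factor n (F : factor) : Prop :=
  forall i, (i < n)%N -> coreC F i \is unitarymx /\ coreB F i \is unitarymx.

(* Exact storage of the spike factor with column v in position l: the cores C_i
   roll up the vector [v; -1] onto a multiple of e_1. *)
Definition stores n (lv : nat * 'cV[C]_n) (F : factor) : Prop :=
  [/\ unitary_factor n F,
      exists beta : C,
        prodC n F *m (Pimx n *m lv.2 - delta_mx ord_max ord0)
          = beta *: delta_mx ord0 ord0 &
      factor_mx n F = spikemx lv.1 lv.2].

(* Storage in floating point arithmetic: the cores are computed up to e. *)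
Definition fl_stores n (e : R) (lv : nat * 'cV[C]_n) (F : factor) : Prop :=
  unitary_factor n F /\
  exists2 F0, stores lv F0 &
    forall i, (i < n)%N -> fnorm (coreC F i - coreC F0 i) <= e /\
                           fnorm (coreB F i - coreB F0 i) <= e.

(* The columns of the last block column, in increasing order. *)
Definition lastcols d k : seq 'I_(d * k) :=
  [seq c : 'I_(d * k) <- enum 'I_(d * k) | (d.-1 * k <= c)%N].

(* T = T_1 ... T_k, the spike of T_i in column n+1-i. *)
Definition spikesT d k (T : 'M[C]_(d * k)) : seq (nat * 'cV[C]_(d * k)) :=
  [seq (nat_of_ord c, col c T) | c : 'I_(d * k) <- rev (lastcols d k)].

(* S = Q R_1 ... Q R_k, the spike of R_i in column n.  When M_0 is lower
   triangular, the spike of R_i is column n-k+i of S rotated upwards i times. *)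
Definition spikesF d k (S : 'M[C]_(d * k)) : seq (nat * 'cV[C]_(d * k)) :=
  [seq ((d * k).-1,
        col c (((downshift (d * k))^T ^+ (c - d.-1 * k).+1) *m S))
  | c : 'I_(d * k) <- lastcols d k].

(* S = Q^k R_1 ... R_k, the spike of R_i in column n+1-i; Q^{-k} S is upper
   triangular when M_0 is. *)
Definition spikesG d k (S : 'M[C]_(d * k)) : seq (nat * 'cV[C]_(d * k)) :=
  spikesT (((downshift (d * k))^T ^+ k) *m S).

(* S is kept as a word of core transformations and stored triangular factors,
   T as the list of stored factors T_1, ..., T_k. *)
Inductive letter := Core of nat & 'M[C]_2 | Tri of factor.

Definition state : Type := (seq letter * seq factor)%type.

Definition downshift_word n : seq letter :=
  [seq Core i flip | i <- iota 0 n.-1].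

Definition initial_state d k (e : R) (M N : nat -> 'M[C]_k) (s : state) : Prop :=
  let S := pencilS d M in let T := pencilT d N in
  let Q := downshift_word (d * k) in
  List.Forall2 (fl_stores e) (spikesT T) s.2 /\
  ((is_trig_mx (M 0%N) /\
    exists2 Rs, List.Forall2 (fl_stores e) (spikesF S) Rs &
      s.1 = flatten [seq rcons Q (Tri F) | F <- Rs])
   \/
   (is_trig_mx (M 0%N)^T /\
    exists2 Rs, List.Forall2 (fl_stores e) (spikesG S) Rs &
      s.1 = flatten (nseq k Q) ++ [seq Tri F | F <- Rs])).

(* y is x computed with relative error at most e. *)
Definition fl (e : R) (x y : C) : Prop :=
  exists2 delta : C, normc delta <= e & y = x * (1 + delta).

Section Operations.
Variables (n : nat) (e : R).

(* F_i G_{i+1} H_i = F'_{i+1} G'_i H'_{i+1} up to e, with unitary results. *)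
Definition turnover_down (F G H F' G' H' : 'M[C]_2) : Prop :=
  [/\ F' \is unitarymx, G' \is unitarymx, H' \is unitarymx &
      fnorm (core 3 1 F' *m core 3 0 G' *m core 3 1 H'
             - core 3 0 F *m core 3 1 G *m core 3 0 H) <= e].

(* F_{i+1} G_i H_{i+1} = F'_i G'_{i+1} H'_i up to e, with unitary results. *)
Definition turnover_up (F G H F' G' H' : 'M[C]_2) : Prop :=
  [/\ F' \is unitarymx, G' \is unitarymx, H' \is unitarymx &
      fnorm (core 3 0 F' *m core 3 1 G' *m core 3 0 H'
             - core 3 1 F *m core 3 0 G *m core 3 1 H) <= e].

Definition same_but i (A A' : factor) : Prop :=
  forall j, j != i -> j != i.+1 ->
    coreC A' j = coreC A j /\ coreB A' j = coreB A j.

(* A G_i = G'_i A', by one turnover on B and one on C^*. *)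
Definition pass_left i (A : factor) (G G' : 'M[C]_2) (A' : factor) : Prop :=
  same_but i A A' /\
  exists2 X : 'M[C]_2,
    turnover_down (coreB A i) (coreB A i.+1) G X (coreB A' i) (coreB A' i.+1) &
    turnover_up (adj (coreC A i.+1)) (adj (coreC A i)) X
                G' (adj (coreC A' i.+1)) (adj (coreC A' i)).

(* G_i A = A' G'_i, by one turnover on C^* and one on B. *)
Definition pass_right i (G : 'M[C]_2) (A A' : factor) (G' : 'M[C]_2) : Prop :=
  same_but i A A' /\
  exists2 X : 'M[C]_2,
    turnover_down G (adj (coreC A i.+1)) (adj (coreC A i))
                  (adj (coreC A' i.+1)) (adj (coreC A' i)) X &
    turnover_up X (coreB A i) (coreB A i.+1) (coreB A' i) (coreB A' i.+1) G'.

(* G_i T_1 ... T_k = T'_1 ... T'_k G'_i.  Taking conjugate transposes of the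
   cores, this passes G_i^* through T^{-1} = T_k^{-1} ... T_1^{-1}, the core
   coming out on the other side being G'_i^*. *)
Fixpoint pass_all i (G : 'M[C]_2) (Ts Ts' : seq factor) (G' : 'M[C]_2) : Prop :=
  match Ts, Ts' with
  | [::], [::] => G' = G
  | A :: Us, A' :: Us' =>
      exists2 X, pass_right i G A A' X & pass_all i X Us Us' G'
  | _, _ => False
  end.

(* Elementary operations.  Commuting disjoint cores and inserting or deleting
   an identity core are exact bookkeeping. *)
Inductive op : state -> state -> Prop :=
| OpSwap x y i j F G Ts of (i.+1 < j)%N || (j.+1 < i)%N :
    op (x ++ [:: Core i F; Core j G] ++ y, Ts)
       (x ++ [:: Core j G; Core i F] ++ y, Ts)
| OpInsertId x y i Ts of (i.+1 < n)%N :
    op (x ++ y, Ts) (x ++ Core i 1%:M :: y, Ts)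
| OpDeleteId x y i Ts :
    op (x ++ Core i 1%:M :: y, Ts) (x ++ y, Ts)
| OpFusion x y i F G H Ts of H \is unitarymx & fnorm (H - F *m G) <= e :
    op (x ++ [:: Core i F; Core i G] ++ y, Ts) (x ++ Core i H :: y, Ts)
| OpTurnoverDown x y i F G H F' G' H' Ts of turnover_down F G H F' G' H' :
    op (x ++ [:: Core i F; Core i.+1 G; Core i H] ++ y, Ts)
       (x ++ [:: Core i.+1 F'; Core i G'; Core i.+1 H'] ++ y, Ts)
| OpTurnoverUp x y i F G H F' G' H' Ts of turnover_up F G H F' G' H' :
    op (x ++ [:: Core i.+1 F; Core i G; Core i.+1 H] ++ y, Ts)
       (x ++ [:: Core i F'; Core i.+1 G'; Core i H'] ++ y, Ts)
| OpPassLeft x y i A G G' A' Ts of pass_left i A G G' A' :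
    op (x ++ [:: Tri A; Core i G] ++ y, Ts)
       (x ++ [:: Core i G'; Tri A'] ++ y, Ts)
| OpPassRight x y i G A A' G' Ts of pass_right i G A A' G' :
    op (x ++ [:: Core i G; Tri A] ++ y, Ts)
       (x ++ [:: Tri A'; Core i G'] ++ y, Ts)
(* Similarity on S T^{-1} moving an outer left core to the outer right. *)
| OpSimilarity w i G G' Ts Ts' of pass_all i (adj G) Ts Ts' G' :
    op (Core i G :: w, Ts) (rcons w (Core i (adj G')), Ts').

(* Similarity by a core F: S T^{-1} becomes F^* S T^{-1} F, and F is passed
   through T^{-1}. *)
Inductive start_chase : state -> state -> Prop :=
| StartChase w i F G' Ts Ts' of (i.+1 < n)%N & F \is unitarymx &
    pass_all i (adj F) Ts Ts' G' :
    start_chase (w, Ts) (Core i (adj F) :: rcons w (Core i (adj G')), Ts').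

Definition hess_word (g : nat -> 'M[C]_2) (Rs : seq factor) : seq letter :=
  [seq Core i (g i) | i <- iota 0 n.-1] ++ [seq Tri A | A <- Rs].

(* Hessenberg-triangular form: every factor is upper triangular, except the
   leading one, which is upper Hessenberg. *)
Definition hessenberg_triangular (s : state) : Prop :=
  exists g Rs, s.1 = hess_word g Rs.

Definition triangular (s : state) : Prop :=
  exists g Rs, s.1 = hess_word g Rs /\
    forall i, (i < n.-1)%N -> is_diag_mx (g i).

(* A core of the leading Hessenberg factor that is diagonal up to e is replaced
   by a diagonal one. *)
Inductive deflation : state -> state -> Prop :=
| Deflation g g' Rs Ts i of (i < n.-1)%N & g' i \is unitarymx
    & is_diag_mx (g' i) & fnorm (g' i - g i) <= e
    & (forall j, j != i -> g' j = g j) :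
    deflation (hess_word g Rs, Ts) (hess_word g' Rs, Ts).

(* A Francis step introduces the initial transformation of the bulge chase, a
   product of j cores, then restores the Hessenberg-triangular form by core
   chasing.  The shifts enter only through these cores, which may be arbitrary;
   with j = 0 or identity cores one gets the zero-shift steps that deflate zero
   eigenvalues.  The index counts elementary operations. *)
Inductive qr_iteration : nat -> state -> state -> Prop :=
| QRDone s : qr_iteration 0 s s
| QRFrancis j m m' s s1 s2 s' of nsteps start_chase j s s1
    & nsteps op m s1 s2 & hessenberg_triangular s2 & qr_iteration m' s2 s' :
    qr_iteration (j + m + m') s s'
| QRDeflation m s s1 s' of deflation s s1 & qr_iteration m s1 s' :
    qr_iteration m.+1 s s'.

(* Computed j-th diagonal entry of a letter.  For a triangular factor it is the
   quotient of the subdiagonal entries of B_j and C_j, by comparison of the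
   entries (j+1, j) in C R = B + e_1 y^T. *)
Definition fl_diag (j : nat) (l : letter) (x : C) : Prop :=
  match l with
  | Core i G => x = if (j == i) || (j == i.+1)
                    then G (inord (j - i)) (inord (j - i)) else 1
  | Tri A => fl e (coreB A j ord_max ord0 / coreC A j ord_max ord0) x
  end.

Fixpoint fl_diag_prod (j : nat) (w : seq letter) (y : C) : Prop :=
  match w with
  | [::] => y = 1
  | l :: w' => exists x z, [/\ fl_diag j l x, fl_diag_prod j w' z & fl e (x * z) y]
  end.

(* The j-th computed eigenvalue; None is infinity, and 0/0 yields none. *)
Definition fl_eigenvalue (j : nat) (s : state) (ev : option C) : Prop :=
  exists sj tj : C,
    [/\ fl_diag_prod j s.1 sj,
        fl_diag_prod j [seq Tri A | A <- s.2] tj &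
        match ev with
        | Some z => tj != 0 /\ fl e (sj / tj) z
        | None => tj = 0 /\ sj != 0
        end].

End Operations.

Definition fl_scaling d k (e alpha : R) (M N M' N' : nat -> 'M[C]_k) : Prop :=
  (forall i a b, (i < d)%N -> fl e ((alpha^-1)%:C * M i a b) (M' i a b)) /\
  (forall i a b, (0 < i <= d)%N -> fl e ((alpha^-1)%:C * N i a b) (N' i a b)).

(* Backward stable unitary equivalence making N_d upper triangular; the
   triangularity of M_0, lower or upper, is part of [initial_state]. *)
Definition fl_preprocessing d k (e : R) (M N M' N' : nat -> 'M[C]_k) : Prop :=
  exists U V : 'M[C]_k,
    [/\ U \is unitarymx /\ V \is unitarymx,
        forall i, (i < d)%N ->
          fnorm (M' i - adj U *m M i *m V) <= e * fnorm (M i),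
        forall i, (0 < i <= d)%N ->
          fnorm (N' i - adj U *m N i *m V) <= e * fnorm (N i) &
        is_trig_mx (N' d)^T].

(* evs are the eigenvalues computed, with unit roundoff u, from the block
   companion pencil of alpha^{-1} P given by M and N.  Single operations have
   errors K u; preprocessing and the storage of the factors have errors
   modest K q d k * u; at most modest K q d k operations are executed. *)
Definition computed_eigenvalues (K : R) (q d k : nat) (u alpha : R)
    (M N : nat -> 'M[C]_k) (evs : seq (option C)) : Prop :=
  let n := (d * k)%N in
  let e := K * u in
  let e' := modest K q d k * u in
  exists M1 N1 M2 N2 m m' s0 s1 s2,
    [/\ fl_scaling d e alpha M N M1 N1,
        fl_preprocessing d e' M1 N1 M2 N2,
        initial_state d e' M2 N2 s0 &
    [/\ nsteps (op n e) m s0 s1 /\ hessenberg_triangular n s1,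
        qr_iteration n e m' s1 s2 /\ triangular n s2,
        (m + m')%:R <= modest K q d k,
        size evs = n &
        forall j, (j < n)%N -> fl_eigenvalue e j s2 (nth None evs j)]].

End Defs.

(* Main.v *)
(* Every operation replaces a short product of unitary matrices by a nearby one,
   or commutes a unitary matrix past a stored triangular factor up to a small
   error.  Cutting the words before each triangular factor, the factors of the
   final pencil are therefore those of the initial one up to unitary matrices
   inserted between them and small errors, which add up over the operations;
   the errors in the products only involve the norms of products of consecutive
   initial factors, which are explicit submatrices of shifted block companion
   matrices.  For this the spikes must not blow up: the modulus of the number
   rho = e_{n+1}^T C^* e_1 that recovers y is bounded below initially and decreases
   by at most the error at each pass-through.

   The computed eigenvalues are thus the exact ones of a pencil (S + dS) - z (T + dT)
   with small dS and dT, in general not block companion.  With N the block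
   downshift and D the projection onto the first d - 1 block columns, block
   companion pencils are those with S D = N and T D = D.  This form is restored by
   an equivalence close to the identity, built from the observability matrix of
   Z = (T + dT)^{-1} (S + dS) on the first block columns, and the last block
   columns of the restored pencil give the perturbed polynomial. *)
From HB Require Import structures.
Require Import Defs.
From mathcomp Require Import all_boot all_order all_algebra.
From mathcomp Require Import spectral.
From mathcomp Require Import reals complex ring lra zify.

Set Implicit Arguments.
Unset Strict Implicit.
Unset Printing Implicit Defensive.

Import Order.TTheory GRing.Theory Num.Theory ComplexField.Normc.

Local Open Scope ring_scope.
Local Open Scope complex_scope.
Local Open Scope sesquilinear_scope.

(** * The Frobenius norm *)

(** The obstacle is to keep the bounds polynomial in [k]: [S] and [T] are products of about [k]
    factors whose spikes may be large, so estimating one perturbed factor by the product of the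
    norms of all the others would grow exponentially. Only norms of consecutive products of the
    initial factors enter. A later factor is bounded at most singly; in products it is compared with
    its initial counterpart through unitary gauges, which leave the Frobenius norm unchanged, so
    that the errors of successive operations add instead of multiplying. First-order analysis
    becomes a genuine inequality by taking [u] below a threshold that depends on [d] and [k]: every
    perturbation is then small enough for a Neumann series, and products of perturbations are
    absorbed by the constants. The constants are generous; the norms of shifts, projections and
    unitary matrices are all estimated by [n] or [n + 1], and the remaining constants end up in
    powers of one parameter [y]. *)

Lemma addmxE (V : nmodType) m n (A B : 'M[V]_(m, n)) i j : (A + B) i j = A i j + B i j.
Proof. by rewrite mxE. Qed.

Lemma oppmxE (V : zmodType) m n (A : 'M[V]_(m, n)) i j : (- A) i j = - A i j.
Proof. by rewrite mxE. Qed.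

(* Matrix products are generalized when possible, so that ring does not compare
   them. *)
Ltac mxabel_atoms := apply/matrixP => ? ?; rewrite !(addmxE, oppmxE); ring.
Ltac mxabel := first
  [ solve [repeat match goal with
      | |- context [@mulmx ?R ?m ?n ?p ?A ?B] =>
          generalize (@mulmx R m n p A B); intro
      end; mxabel_atoms]
  | mxabel_atoms ].

Section FrobeniusNorm.
Variable R : realType.
Local Notation C := R[i].

Lemma conj_normc (x : C) : x * Num.conj x = ((normc x) ^+ 2)%:C.
Proof. by rewrite -normCK rmorphXn. Qed.

Lemma normc_ge0 (x : C) : 0 <= normc x.
Proof. by case: x => a b; rewrite sqrtr_ge0. Qed.

Lemma normcB (x y : C) : normc (x - y) = normc (y - x).
Proof. by rewrite -opprB normcN. Qed.

Lemma normc_real (x : R) : normc x%:C = `|x|.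
Proof. by rewrite /normc /= expr0n addr0 sqrtr_sqr. Qed.

Lemma adjE m n (A : 'M[C]_(m, n)) i j : adj A i j = Num.conj (A j i).
Proof. by rewrite !mxE. Qed.

Lemma adjK m n (A : 'M[C]_(m, n)) : adj (adj A) = A.
Proof. by apply/matrixP => i j; rewrite !adjE conjCK. Qed.

Lemma adjM m n p (A : 'M[C]_(m, n)) (B : 'M[C]_(n, p)) :
  adj (A *m B) = adj B *m adj A.
Proof. by rewrite /adj trmx_mul map_mxM. Qed.

Lemma adjD m n (A B : 'M[C]_(m, n)) : adj (A + B) = adj A + adj B.
Proof. by rewrite /adj linearD /= map_mxD. Qed.

Lemma adjN m n (A : 'M[C]_(m, n)) : adj (- A) = - adj A.
Proof. by rewrite /adj linearN /= map_mxN. Qed.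

Lemma adjB m n (A B : 'M[C]_(m, n)) : adj (A - B) = adj A - adj B.
Proof. by rewrite adjD adjN. Qed.

Lemma adj1 n : adj 1%:M = 1%:M :> 'M[C]_n.
Proof. by rewrite /adj trmx1 map_mx1. Qed.

Lemma unitary_mul_adj m n (U : 'M[C]_(m, n)) : U \is unitarymx -> U *m adj U = 1%:M.
Proof. by move/unitarymxP. Qed.

Lemma unitary_adj_mul n (U : 'M[C]_n) : U \is unitarymx -> adj U *m U = 1%:M.
Proof. by move/unitarymxP/mulmx1C. Qed.

Lemma adj_unitary n (U : 'M[C]_n) : (adj U \is unitarymx) = (U \is unitarymx).
Proof. exact: trmxC_unitary. Qed.

Lemma unitary1 n : 1%:M \is @unitarymx C n n.
Proof. by apply/unitarymxP; rewrite -/(adj _) adj1 mulmx1. Qed.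

Lemma fnorm2_tr m n (A : 'M[C]_(m, n)) : (fnorm2 A)%:C = \tr (A *m adj A).
Proof.
rewrite /mxtrace /fnorm2 rmorph_sum /=; apply: eq_bigr => i _.
rewrite !mxE rmorph_sum /=; apply: eq_bigr => j _.
by rewrite adjE conj_normc.
Qed.

Lemma fnorm2_ge0 m n (A : 'M[C]_(m, n)) : 0 <= fnorm2 A.
Proof. by apply: sumr_ge0 => i _; apply: sumr_ge0 => j _; rewrite sqr_ge0. Qed.

Lemma fnorm_ge0 m n (A : 'M[C]_(m, n)) : 0 <= fnorm A.
Proof. exact: sqrtr_ge0. Qed.

Lemma fnorm_sqr m n (A : 'M[C]_(m, n)) : fnorm A ^+ 2 = fnorm2 A.
Proof. by rewrite sqr_sqrtr // fnorm2_ge0. Qed.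

Lemma fnorm_le m n (A : 'M[C]_(m, n)) x : 0 <= x -> fnorm2 A <= x ^+ 2 -> fnorm A <= x.
Proof.
by move=> x0 h; rewrite -(ler_pXn2r (n := 2)) ?nnegrE ?fnorm_ge0 // fnorm_sqr.
Qed.

Lemma fnorm_leE m n p q (A : 'M[C]_(m, n)) (B : 'M[C]_(p, q)) :
  (fnorm A <= fnorm B) = (fnorm2 A <= fnorm2 B).
Proof. by rewrite -(ler_pXn2r (n := 2)) ?nnegrE ?fnorm_ge0 // !fnorm_sqr. Qed.

Lemma fnorm2_adj m n (A : 'M[C]_(m, n)) : fnorm2 (adj A) = fnorm2 A.
Proof. by apply: complexI; rewrite !fnorm2_tr adjK mxtrace_mulC. Qed.

Lemma fnorm_adj m n (A : 'M[C]_(m, n)) : fnorm (adj A) = fnorm A.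
Proof. by rewrite /fnorm fnorm2_adj. Qed.

Lemma fnorm2_isometryl m n p (U : 'M[C]_(m, n)) (A : 'M[C]_(n, p)) :
  adj U *m U = 1%:M -> fnorm2 (U *m A) = fnorm2 A.
Proof.
move=> hU; apply: complexI; rewrite !fnorm2_tr adjM mxtrace_mulC mulmxA.
by rewrite -[_ *m U]mulmxA hU mulmx1 mxtrace_mulC.
Qed.

Lemma fnorm_isometryl m n p (U : 'M[C]_(m, n)) (A : 'M[C]_(n, p)) :
  adj U *m U = 1%:M -> fnorm (U *m A) = fnorm A.
Proof. by move=> hU; rewrite /fnorm fnorm2_isometryl. Qed.

Lemma fnorm_unitaryl n p (U : 'M[C]_n) (A : 'M[C]_(n, p)) :
  U \is unitarymx -> fnorm (U *m A) = fnorm A.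
Proof. by move=> hU; rewrite fnorm_isometryl // unitary_adj_mul. Qed.

Lemma fnorm_unitaryr m n p (U : 'M[C]_(n, p)) (A : 'M[C]_(m, n)) :
  U \is unitarymx -> fnorm (A *m U) = fnorm A.
Proof.
move=> hU; rewrite -fnorm_adj adjM fnorm_isometryl ?fnorm_adj //.
by rewrite adjK unitary_mul_adj.
Qed.

Lemma fnorm_gauge n p (U : 'M[C]_n) (A B : 'M[C]_(n, p)) :
  U \is unitarymx -> fnorm (U *m A - B) = fnorm (A - adj U *m B).
Proof.
move=> hU; rewrite -(fnorm_unitaryl (A - _) hU) mulmxBr mulmxA.
by rewrite unitary_mul_adj // mul1mx.
Qed.

(** Cauchy-Schwarz by Lagrange's identity: the double sum of the squares of [x i * y j - x j * y i]
    is twice the difference of the two sides. *)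
Lemma sqr_sum_le (I : finType) (x y : I -> R) :
  (\sum_i x i * y i) ^+ 2 <= (\sum_i x i ^+ 2) * (\sum_i y i ^+ 2).
Proof.
have : 0 <= \sum_i \sum_j (x i * y j - x j * y i) ^+ 2.
  by apply: sumr_ge0 => i _; apply: sumr_ge0 => j _; rewrite sqr_ge0.
have -> : \sum_i \sum_j (x i * y j - x j * y i) ^+ 2 =
   \sum_i \sum_j (x i ^+ 2 * y j ^+ 2) + \sum_i \sum_j (y i ^+ 2 * x j ^+ 2)
   - (\sum_i \sum_j (x i * y i) * (x j * y j)) *+ 2.
  rewrite -big_split -sumrMnl -sumrB /=; apply: eq_bigr => i _.
  rewrite -big_split -sumrMnl -sumrB /=; apply: eq_bigr => j _.
  ring.
rewrite -!big_distrlr /=; lra.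
Qed.

Lemma normc_sum (I : Type) (r : seq I) (P : pred I) (F : I -> C) :
  normc (\sum_(i <- r | P i) F i) <= \sum_(i <- r | P i) normc (F i).
Proof.
elim/big_rec2: _ => [|i x y _ h]; first by rewrite normc0.
by rewrite (le_trans (le_normcD _ _)) // lerD2l.
Qed.

Lemma fnorm2M m n p (A : 'M[C]_(m, n)) (B : 'M[C]_(n, p)) :
  fnorm2 (A *m B) <= fnorm2 A * fnorm2 B.
Proof.
rewrite /fnorm2 big_distrl /=; apply: ler_sum => i _.
rewrite exchange_big /= big_distrr /=; apply: ler_sum => j _.
apply: le_trans (sqr_sum_le _ _).
rewrite ler_pXn2r ?nnegrE ?normc_ge0 //; last first.
  by apply: sumr_ge0 => l _; rewrite mulr_ge0 ?normc_ge0.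
rewrite mxE (le_trans (normc_sum _ _ _)) //.
by apply: ler_sum => l _; rewrite normcM.
Qed.

Lemma fnormM m n p (A : 'M[C]_(m, n)) (B : 'M[C]_(n, p)) :
  fnorm (A *m B) <= fnorm A * fnorm B.
Proof.
apply: fnorm_le; first by rewrite mulr_ge0 ?fnorm_ge0.
by rewrite exprMn !fnorm_sqr fnorm2M.
Qed.

Lemma fnormD m n (A B : 'M[C]_(m, n)) : fnorm (A + B) <= fnorm A + fnorm B.
Proof.
apply: fnorm_le; first by rewrite addr_ge0 ?fnorm_ge0.
have pairE (F : 'M[C]_(m, n)) : fnorm2 F = \sum_p normc (F p.1 p.2) ^+ 2.
  by rewrite /fnorm2 pair_bigA.
have h : \sum_p normc (A p.1 p.2) * normc (B p.1 p.2) <= fnorm A * fnorm B.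
  rewrite -(ler_pXn2r (n := 2)) ?nnegrE ?mulr_ge0 ?fnorm_ge0 //; last first.
    by apply: sumr_ge0 => p _; rewrite mulr_ge0 ?normc_ge0.
  by rewrite exprMn !fnorm_sqr !pairE sqr_sum_le.
rewrite sqrrD !fnorm_sqr.
apply: (@le_trans _ _ (fnorm2 A +
  (\sum_p normc (A p.1 p.2) * normc (B p.1 p.2)) *+ 2 + fnorm2 B)); last first.
  by rewrite lerD2r lerD2l ler_pMn2r.
rewrite !pairE -sumrMnl -!big_split /=; apply: ler_sum => p _.
rewrite -sqrrD ler_pXn2r ?nnegrE ?addr_ge0 ?normc_ge0 //.
by rewrite mxE le_normcD.
Qed.

Lemma fnormN m n (A : 'M[C]_(m, n)) : fnorm (- A) = fnorm A.
Proof.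
by rewrite /fnorm /fnorm2; congr Num.sqrt; do 2!apply: eq_bigr => ? _; rewrite mxE normcN.
Qed.

Lemma fnormBC m n (A B : 'M[C]_(m, n)) : fnorm (A - B) = fnorm (B - A).
Proof. by rewrite -fnormN opprB. Qed.

Lemma fnormB m n (A B : 'M[C]_(m, n)) : fnorm (A - B) <= fnorm A + fnorm B.
Proof. by rewrite -(fnormN B) fnormD. Qed.

Lemma fnormB_trans m n (B A D : 'M[C]_(m, n)) :
  fnorm (A - D) <= fnorm (A - B) + fnorm (B - D).
Proof. by rewrite -{1}(subrK B A) -addrA fnormD. Qed.

Lemma fnorm0 m n : fnorm (0 : 'M[C]_(m, n)) = 0.
Proof.
rewrite /fnorm /fnorm2 big1 ?sqrtr0 // => i _; rewrite big1 // => j _.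
by rewrite mxE normc0 expr0n.
Qed.

Lemma fnormZ m n (a : C) (A : 'M[C]_(m, n)) : fnorm (a *: A) = normc a * fnorm A.
Proof.
rewrite -[normc a]ger0_norm ?normc_ge0 // -sqrtr_sqr -sqrtrM ?sqr_ge0 //.
congr Num.sqrt; rewrite /fnorm2 big_distrr /=; apply: eq_bigr => i _.
rewrite big_distrr /=; apply: eq_bigr => j _.
by rewrite mxE normcM exprMn.
Qed.

Lemma fnorm_sum m n (I : Type) (r : seq I) (P : pred I) (F : I -> 'M[C]_(m, n)) :
  fnorm (\sum_(i <- r | P i) F i) <= \sum_(i <- r | P i) fnorm (F i).
Proof.
elim/big_rec2: _ => [|i x y _ h]; first by rewrite fnorm0.
by rewrite (le_trans (fnormD _ _)) // lerD2l.
Qed.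

Lemma entry_fnorm m n (A : 'M[C]_(m, n)) i j : normc (A i j) <= fnorm A.
Proof.
rewrite -(ler_pXn2r (n := 2)) ?nnegrE ?fnorm_ge0 ?normc_ge0 // fnorm_sqr.
rewrite /fnorm2 (bigD1 i) //= (bigD1 j) //= -addrA lerDl addr_ge0 //.
  by apply: sumr_ge0 => ? _; rewrite sqr_ge0.
by apply: sumr_ge0 => ? _; apply: sumr_ge0 => ? _; rewrite sqr_ge0.
Qed.

Lemma fnorm_eq0 m n (A : 'M[C]_(m, n)) : fnorm A <= 0 -> A = 0.
Proof.
move=> h; apply/matrixP => i j; rewrite mxE; apply: eq0_normc.
by apply/eqP; rewrite eq_le normc_ge0 (le_trans (entry_fnorm A i j)).
Qed.

Lemma fnorm2_1 n : fnorm2 (1%:M : 'M[C]_n) = n%:R.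
Proof.
by apply: complexI; rewrite fnorm2_tr adj1 mulmx1 mxtrace1 rmorph_nat.
Qed.

Lemma sqr_natr_ge n : n%:R <= (n%:R : R) ^+ 2.
Proof. by rewrite -natrX ler_nat; case: n => // n; rewrite expnS leq_pmulr ?expn1. Qed.

Lemma fnorm1 n : fnorm (1%:M : 'M[C]_n) <= n%:R.
Proof. by apply: fnorm_le; rewrite ?ler0n // fnorm2_1 sqr_natr_ge. Qed.

Lemma fnorm_unitary n (U : 'M[C]_n) : U \is unitarymx -> fnorm U <= n%:R.
Proof. by move=> hU; rewrite -[U]mulmx1 fnorm_unitaryl ?fnorm1. Qed.

Lemma fnorm_delta m n (i : 'I_m) (j : 'I_n) : fnorm (delta_mx i j : 'M[C]_(m, n)) = 1.
Proof.
rewrite /fnorm /fnorm2 (bigD1 i) //= (bigD1 j) //= mxE !eqxx normc1 expr1n.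
rewrite [X in 1 + X]big1 => [|k /negbTE nk]; last first.
  by rewrite mxE nk andbF normc0 expr0n.
rewrite addr0 big1 ?addr0 ?sqrtr1 // => k /negbTE nk.
by rewrite big1 // => l _; rewrite mxE nk normc0 expr0n.
Qed.

(** A row vector killed by [1 + E] satisfies [v = - v E], so its norm is at most half of itself. The
    inverse [Y] satisfies [Y - 1 = - E - E (Y - 1)], whose last term is absorbed on the left. *)
Lemma neumann n (E : 'M[C]_n) : fnorm E <= 1 / 2 ->
  1%:M + E \in unitmx /\ fnorm (invmx (1%:M + E) - 1%:M) <= 2 * fnorm E.
Proof.
move=> hE; have hu : 1%:M + E \in unitmx.
  rewrite -row_free_unit; apply/row_freeP; exists (invmx (1%:M + E)).
  apply: mulmxV; rewrite -row_free_unit -kermx_eq0 -submx0.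
  apply/rV_subP => v /sub_kermxP; rewrite mulmxDr mulmx1 => /eqP.
  rewrite addr_eq0 => /eqP hv.
  suff -> : v = 0 by rewrite sub0mx.
  apply: fnorm_eq0; have : fnorm v <= fnorm v * fnorm E.
    by rewrite {1}hv fnormN fnormM.
  have := ler_wpM2l (fnorm_ge0 v) hE; have := fnorm_ge0 v; lra.
split=> //; set Y := invmx _.
have hY : (1%:M + E) *m Y = 1%:M by rewrite mulmxV.
have hY1 : Y - 1%:M = - E - E *m (Y - 1%:M).
  by rewrite mulmxBr mulmx1 -[X in _ - X]hY mulmxDl mul1mx; mxabel.
have : fnorm (Y - 1%:M) <= fnorm E + fnorm E * fnorm (Y - 1%:M).
  rewrite {1}hY1 (le_trans (fnormB _ _)) // fnormN lerD2l fnormM //.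
have := ler_wpM2r (fnorm_ge0 (Y - 1%:M)) hE.
have := fnorm_ge0 E; lra.
Qed.

Definition lprod n (l : seq 'M[C]_n) : 'M[C]_n := foldr mulmx 1%:M l.

Lemma lprod_cat n (l1 l2 : seq 'M[C]_n) : lprod (l1 ++ l2) = lprod l1 *m lprod l2.
Proof. by elim: l1 => [|A l IH] /=; rewrite ?mul1mx // IH mulmxA. Qed.

(** Bounding consecutive products directly, rather than by the norms of their factors, avoids a
    power of the factor norm that would be exponential in the number of factors. *)
Definition subproducts_le n (b : R) (l : seq 'M[C]_n) :=
  forall l1 l2 l3, l = l1 ++ l2 ++ l3 -> fnorm (lprod l2) <= b.

Fixpoint near n (e : R) (l l' : seq 'M[C]_n) : Prop :=
  match l, l' with
  | [::], [::] => True
  | A :: r, A' :: r' => fnorm (A' - A) <= e /\ near e r r'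
  | _, _ => False
  end.

(* The difference is the sum over i of (exact prefix) * (error in factor i) *
   (perturbed suffix). *)
Lemma near_lprod n (b e : R) (l l' : seq 'M[C]_n) :
  0 <= e -> subproducts_le b l -> near e l l' -> 2 * (size l)%:R * b * e <= 1 ->
  fnorm (lprod l' - lprod l) <= 2 * (size l)%:R * b ^+ 2 * e.
Proof.
move=> e0 hb; have b0 : 0 <= b.
  by apply: le_trans (fnorm_ge0 _) (hb [::] [::] l _).
(* The induction carries the exact prefix [pre], so that only consecutive products of the original
   list are estimated. The smallness hypothesis keeps every perturbed suffix below [2 * b]. *)
suff H : forall pre, subproducts_le b (pre ++ l) -> near e l l' ->
   2 * (size l)%:R * b * e <= 1 ->
   fnorm (lprod pre *m (lprod l' - lprod l)) <= 2 * (size l)%:R * b ^+ 2 * e.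
  by move=> hn hs; have := H [::] hb hn hs; rewrite mul1mx.
elim: l l' {hb} => [|A l IH] [|A' l'] //= pre hb.
  by rewrite subrr mulmx0 fnorm0 mulr0 !mul0r.
case=> hA hl; rewrite -!natr1 => hs.
have be0 : 0 <= b * e by rewrite mulr_ge0.
have hs' : 2 * (size l)%:R * b * e <= 1 by nra.
have hl' : fnorm (lprod l') <= 2 * b.
  rewrite -(subrK (lprod l) (lprod l')) (le_trans (fnormD _ _)) //.
  have h1 : fnorm (lprod l) <= b.
    by apply: (hb (pre ++ [:: A]) l [::]); rewrite cats0 -catA.
  have h2 := IH l' [::] _ hl hs'; rewrite mul1mx in h2.
  have h3 : fnorm (lprod l' - lprod l) <= 2 * (size l)%:R * b ^+ 2 * e.
    by apply: h2 => l1 l2 l3 /= El; apply: (hb (pre ++ A :: l1) l2 l3); rewrite El -catA.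
  nra.
have hpre : fnorm (lprod pre) <= b by apply: (hb [::] pre (A :: l)).
have -> : lprod pre *m (A' *m lprod l' - A *m lprod l) =
   lprod pre *m (A' - A) *m lprod l' + lprod (pre ++ [:: A]) *m (lprod l' - lprod l).
  by rewrite lprod_cat /= mulmx1 !mulmxBr !mulmxBl !mulmxA; mxabel.
have h4 := IH l' (pre ++ [:: A]) _ hl hs'.
have {}h4 : fnorm (lprod (pre ++ [:: A]) *m (lprod l' - lprod l))
          <= 2 * (size l)%:R * b ^+ 2 * e by apply: h4; rewrite -catA.
apply: le_trans (fnormD _ _) _.
have h5 : fnorm (lprod pre *m (A' - A) *m lprod l') <= b * e * (2 * b).
  apply: le_trans (fnormM _ _) _; apply: ler_pM; rewrite ?fnorm_ge0 //.
  by apply: le_trans (fnormM _ _) _; apply: ler_pM; rewrite ?fnorm_ge0.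
nra.
Qed.

End FrobeniusNorm.

(* Norms are generalized first, so that lra does not compare matrices. *)
Ltac generalize_norms := repeat
  match goal with
  | |- context [@fnorm ?R ?m ?n ?A] => generalize (fnorm_ge0 A); generalize (@fnorm R m n A)
  | |- context [@normc ?R ?x] => generalize (normc_ge0 x); generalize (@normc R x)
  end.
Ltac nlra := generalize_norms; clear; intros; lra.


(** * Core transformations *)

(** The isometry onto the coordinates [i, ..., i + p - 1]. Writing a core as the identity plus
    [inj (G - 1) inj^T] reduces products, adjoints, nesting and commutation to identities between
    isometries. *)
Definition inj (R : realType) m p i : 'M[R[i]]_(m, p) :=
  \matrix_(a, b) (a == (i + b)%N :> nat)%:R.

(* Sealed: unification must not unfold it against matrix products. *)
HB.lock Definition emb (R : realType) m p i (X : 'M[R[i]]_p) : 'M[R[i]]_m :=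
  1%:M + inj R m p i *m (X - 1%:M) *m (inj R m p i)^T.
Canonical emb_unlockable := Unlockable emb.unlock.

Section Cores.
Variable R : realType.
Local Notation C := R[i].

Local Notation inj := (inj R).

Lemma injM_in m p q i (X : 'M[C]_(p, q)) (a : 'I_m) (c : 'I_p) b :
  a = (i + c)%N :> nat -> (inj m p i *m X) a b = X c b.
Proof.
move=> ha; rewrite mxE (bigD1 c) //= mxE ha eqxx mul1r big1 ?addr0 // => l hl.
by rewrite mxE ha eqn_add2l val_eqE eq_sym (negbTE hl) mul0r.
Qed.

Lemma injM_out m p q i (X : 'M[C]_(p, q)) (a : 'I_m) b :
  ~~ (i <= a < i + p)%N -> (inj m p i *m X) a b = 0.
Proof.
move=> ha; rewrite mxE big1 // => l _; rewrite mxE; case: eqP => [E|]; last by rewrite mul0r.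
by move: ha; rewrite E leq_addr ltn_add2l ltn_ord.
Qed.

Lemma injM_pred m p q i (X : 'M[C]_(p.+1, q)) (a : 'I_m) b :
  (inj m p.+1 i *m X) a b =
  if (i <= a < i + p.+1)%N then X (inord (a - i)) b else 0.
Proof.
case: ifP => [/andP[h1 h2]|/negbT/injM_out -> //].
by apply: injM_in; rewrite inordK ?subnKC // ltn_subLR.
Qed.

Lemma inj_tr_inj m p i : (i + p <= m)%N -> (inj m p i)^T *m inj m p i = 1%:M.
Proof.
move=> h; apply/matrixP => a b; rewrite !mxE.
have ha : (i + a < m)%N by rewrite (leq_trans _ h) // ltn_add2l.
rewrite (bigD1 (Ordinal ha)) //= !mxE eqxx mul1r big1 ?addr0 => [|l hl].
  by rewrite eqn_add2l.
by rewrite !mxE; case: eqP => [E|]; rewrite ?mul0r //; case/eqP: hl; apply: val_inj.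
Qed.

Lemma inj_tr_disjoint m p q i j : (i + p <= j)%N || (j + q <= i)%N ->
  (inj m p i)^T *m inj m q j = 0.
Proof.
move=> h; apply/matrixP => a b; rewrite !mxE big1 // => l _; rewrite !mxE.
case: eqP => [E|]; rewrite ?mul0r // mul1r E; case: eqP => // F.
by have := ltn_ord a; have := ltn_ord b; lia.
Qed.

Lemma inj_inj m p q i j : (j + q <= p)%N -> inj m p i *m inj p q j = inj m q (i + j).
Proof.
move=> h; apply/matrixP => a b; rewrite [RHS]mxE.
have hb : (j + b < p)%N by rewrite (leq_trans _ h) // ltn_add2l.
case: (boolP (i <= a < i + p)%N) => ha.
  have hc : (a - i < p)%N by lia.
  rewrite (@injM_in _ _ _ _ _ _ (Ordinal hc)) /=; last by lia.
  by rewrite mxE /=; congr (_%:R); apply/eqP/eqP; lia.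
by rewrite injM_out //; case: eqP => // E; lia.
Qed.

Lemma adj_inj m p i : adj (inj m p i) = (inj m p i)^T.
Proof. by apply/matrixP => a b; rewrite adjE !mxE conjC_nat. Qed.

Lemma embE m p i (X : 'M[C]_p) :
  emb m i X = 1%:M + inj m p i *m (X - 1%:M) *m (inj m p i)^T.
Proof. by rewrite unlock. Qed.

Lemma core_emb m i (G : 'M[C]_2) : (i.+1 < m)%N -> core m i G = emb m i G.
Proof.
move=> him; apply/matrixP => a b; rewrite !embE addmxE [LHS]mxE [1%:M a b]mxE.
have -> : (inj m 2 i *m (G - 1%:M) *m (inj m 2 i)^T) a b =
  (inj m 2 i *m (inj m 2 i *m (G - 1%:M)^T)^T) a b.
  by rewrite trmx_mul trmxK mulmxA.
rewrite injM_pred [_^T _ _]mxE injM_pred !addn2 !ltnS.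
case: (boolP (i <= a <= i.+1)%N) => [/andP[ha1 ha2]|_] /=; last by rewrite addr0.
case: (boolP (i <= b <= i.+1)%N) => [/andP[hb1 hb2]|_] /=; last by rewrite addr0.
rewrite !mxE; suff -> : (inord (a - i) == inord (b - i) :> 'I_2) = (a == b) by ring.
by rewrite -!val_eqE /= !inordK; try lia; apply/eqP/eqP; lia.
Qed.

Lemma emb1 m p i : emb m i (1%:M : 'M[C]_p) = 1%:M.
Proof. by rewrite !embE subrr mulmx0 mul0mx addr0. Qed.

Lemma embM m p i (X Y : 'M[C]_p) : (i + p <= m)%N ->
  emb m i X *m emb m i Y = emb m i (X *m Y).
Proof.
move=> h; rewrite !embE; set J := inj m p i.
have hJ : J^T *m J = 1%:M by apply: inj_tr_inj.
pose A := J *m (X - 1%:M) *m J^T; pose B := J *m (Y - 1%:M) *m J^T.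
have e : A *m B = J *m ((X - 1%:M) *m (Y - 1%:M)) *m J^T.
  by rewrite /A /B !mulmxA -[_ *m _ *m J^T *m J]mulmxA hJ mulmx1.
rewrite -/A -/B.
rewrite [LHS]mulmxDl mul1mx (mulmxDr A) mulmx1 e -!addrA; congr (_ + _).
have -> : X *m Y - 1%:M = (Y - 1%:M) + ((X - 1%:M) + (X - 1%:M) *m (Y - 1%:M)).
  by rewrite mulmxBl !mulmxBr !mul1mx mulmx1; mxabel.
rewrite /A /B; move: (X - 1%:M) (Y - 1%:M) => X1 Y1.
by rewrite !(mulmxDr J) !(mulmxDl _ _ J^T).
Qed.

Lemma adj_emb m p i (X : 'M[C]_p) : adj (emb m i X) = emb m i (adj X).
Proof.
by rewrite !embE adjD adj1 !adjM -adj_inj adjK adjB adj1 mulmxA.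
Qed.

Lemma emb_unitary m p i (X : 'M[C]_p) : (i + p <= m)%N ->
  X \is unitarymx -> emb m i X \is unitarymx.
Proof.
move=> h hX; apply/unitarymxP; rewrite -/(adj _) adj_emb embM //.
by rewrite unitary_mul_adj // emb1.
Qed.

Lemma fnorm_embB m p i (X Y : 'M[C]_p) : (i + p <= m)%N ->
  fnorm (emb m i X - emb m i Y) = fnorm (X - Y).
Proof.
move=> h; set J := inj m p i; have hJ : J^T *m J = 1%:M by apply: inj_tr_inj.
have -> : emb m i X - emb m i Y = J *m (X - Y) *m J^T.
  have -> : X - Y = (X - 1%:M) - (Y - 1%:M) by mxabel.
  by rewrite mulmxBr mulmxBl !embE; move: (_ *m _ *m _) (_ *m _ *m _) => A B; mxabel.
rewrite -mulmxA fnorm_isometryl ?adj_inj // -fnorm_adj adjM -adj_inj adjK.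
by rewrite fnorm_isometryl ?adj_inj // fnorm_adj.
Qed.

Lemma emb_emb m p q i j (X : 'M[C]_q) : (j + q <= p)%N ->
  emb m i (emb p j X) = emb m (i + j) X.
Proof.
move=> h; rewrite embE embE addrAC subrr add0r.
by rewrite embE !mulmxA inj_inj // -mulmxA -trmx_mul inj_inj.
Qed.

Lemma emb_comm m p q i j (X : 'M[C]_p) (Y : 'M[C]_q) :
  (i + p <= j)%N || (j + q <= i)%N -> emb m i X *m emb m j Y = emb m j Y *m emb m i X.
Proof.
move=> h; rewrite !embE; set A := _ *m _ *m _; set B := _ *m _ *m _.
rewrite mulmxDl mul1mx mulmxDr mulmx1 mulmxDl mul1mx mulmxDr mulmx1 -!addrA.
have h0 : (inj m p i)^T *m inj m q j = 0 by exact: inj_tr_disjoint.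
have h1 : (inj m q j)^T *m inj m p i = 0 by apply: inj_tr_disjoint; rewrite orbC.
have hAB : A *m B = 0 by rewrite /A /B !mulmxA -(mulmxA _ _^T) h0 mulmx0 !mul0mx.
have hBA : B *m A = 0 by rewrite /A /B !mulmxA -(mulmxA _ _^T) h1 mulmx0 !mul0mx.
by rewrite hAB hBA !addr0 [B + A]addrC.
Qed.

Lemma core1 m i : core m i 1%:M = 1%:M :> 'M[C]_m.
Proof.
apply/matrixP => a b; rewrite !mxE; case: ifP => // h; congr (_%:R).
by rewrite -!val_eqE /= !inordK; try lia; congr nat_of_bool; apply/eqP/eqP; lia.
Qed.

Lemma coreM m i (F G : 'M[C]_2) : (i.+1 < m)%N ->
  core m i F *m core m i G = core m i (F *m G).
Proof. by move=> h; rewrite !core_emb // embM // addn2. Qed.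

Lemma adj_core m i (G : 'M[C]_2) : (i.+1 < m)%N -> adj (core m i G) = core m i (adj G).
Proof. by move=> h; rewrite !core_emb // adj_emb. Qed.

Lemma core_unitary m i (G : 'M[C]_2) : (i.+1 < m)%N ->
  G \is unitarymx -> core m i G \is unitarymx.
Proof. by move=> h hG; rewrite core_emb // emb_unitary // addn2. Qed.

Lemma fnorm_coreB m i (F G : 'M[C]_2) : (i.+1 < m)%N ->
  fnorm (core m i F - core m i G) = fnorm (F - G).
Proof. by move=> h; rewrite !core_emb // fnorm_embB // addn2. Qed.

Lemma core_comm m i j (F G : 'M[C]_2) : (i.+1 < m)%N -> (j.+1 < m)%N ->
  (i.+1 < j)%N || (j.+1 < i)%N -> core m i F *m core m j G = core m j G *m core m i F.
Proof.
by move=> hi hj h; rewrite (core_emb F hi) (core_emb G hj) emb_comm // !addn2.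
Qed.

Lemma core_emb3 m i (G : 'M[C]_2) : (i.+2 < m)%N -> core m i G = emb m i (core 3 0 G).
Proof.
move=> h.
have E : core 3 0 G = emb 3 0 G by exact: core_emb.
have E2 : core m i G = emb m i G by exact: core_emb (ltnW h).
have := @emb_emb m 3 2 i 0 G isT.
by rewrite addn0 E E2 => ->.
Qed.

Lemma coreS_emb3 m i (G : 'M[C]_2) : (i.+2 < m)%N -> core m i.+1 G = emb m i (core 3 1 G).
Proof.
move=> h.
have E : core 3 1 G = emb 3 1 G by exact: core_emb.
have E2 : core m i.+1 G = emb m i.+1 G by exact: core_emb h.
have := @emb_emb m 3 2 i 1 G isT.
by rewrite addn1 E E2 => ->.
Qed.

Lemma emb_prod3_le m p i e (X1 X2 X3 Y1 Y2 Y3 : 'M[C]_p) : (i + p <= m)%N ->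
  fnorm (X1 *m X2 *m X3 - Y1 *m Y2 *m Y3) <= e ->
  fnorm (emb m i X1 *m emb m i X2 *m emb m i X3
         - emb m i Y1 *m emb m i Y2 *m emb m i Y3) <= e.
Proof. by move=> h; rewrite !embM // fnorm_embB. Qed.

(** A turnover is specified on 3 by 3 matrices. The embedding is multiplicative and preserves the
    norms of differences, so the same error bound holds in any size. *)
Lemma turnover_down_core m e i (F G H F' G' H' : 'M[C]_2) : (i.+2 < m)%N ->
  turnover_down e F G H F' G' H' ->
  fnorm (core m i.+1 F' *m core m i G' *m core m i.+1 H'
         - core m i F *m core m i.+1 G *m core m i H) <= e.
Proof.
move=> h [_ _ _ he]; have h3 : (i + 3 <= m)%N by rewrite addn3.
rewrite (coreS_emb3 F' h) (core_emb3 G' h) (coreS_emb3 H' h).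
rewrite (core_emb3 F h) (coreS_emb3 G h) (core_emb3 H h).
exact: emb_prod3_le h3 he.
Qed.

Lemma turnover_up_core m e i (F G H F' G' H' : 'M[C]_2) : (i.+2 < m)%N ->
  turnover_up e F G H F' G' H' ->
  fnorm (core m i F' *m core m i.+1 G' *m core m i H'
         - core m i.+1 F *m core m i G *m core m i.+1 H) <= e.
Proof.
move=> h [_ _ _ he]; have h3 : (i + 3 <= m)%N by rewrite addn3.
rewrite (core_emb3 F' h) (coreS_emb3 G' h) (core_emb3 H' h).
rewrite (coreS_emb3 F h) (core_emb3 G h) (coreS_emb3 H h).
exact: emb_prod3_le h3 he.
Qed.

Lemma Pimx_inj n : Pimx R n = inj n.+1 n 0.
Proof.
apply/matrixP => a b; rewrite !mxE add0n; congr (nat_of_bool _)%:R; apply/andP/eqP => [[/eqP //]|E].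
by rewrite E eqxx ltn_ord.
Qed.

Lemma core_Pimx n i (G : 'M[C]_2) : (i.+1 < n)%N ->
  core n.+1 i G *m Pimx R n = Pimx R n *m core n i G.
Proof.
move=> h; have h' : (i.+1 < n.+1)%N by rewrite ltnW.
rewrite !core_emb // Pimx_inj !embE mulmxDl mulmxDr mul1mx mulmx1; congr (_ + _).
rewrite !mulmxA inj_inj ?addn2 // add0n -!mulmxA; congr (_ *m (_ *m _)).
rewrite -[inj n.+1 2 i](@inj_inj _ n _ 0 i) ?addn2 // trmx_mul -mulmxA.
by rewrite inj_tr_inj ?mulmx1.
Qed.

Lemma Pimx_tr_core n i (G : 'M[C]_2) : (i.+1 < n)%N ->
  (Pimx R n)^T *m core n.+1 i G = core n i G *m (Pimx R n)^T.
Proof.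
move=> h; have h' : (i.+1 < n.+1)%N by rewrite ltnW.
have E : (Pimx R n)^T = adj (Pimx R n) by rewrite Pimx_inj adj_inj.
rewrite E -[core n.+1 i G]adjK -[core n i G]adjK -!adjM !adj_core //.
by rewrite -core_Pimx.
Qed.

Lemma compressE n (A : 'M[C]_n.+1) i j : ((Pimx R n)^T *m A *m Pimx R n) i j =
  A (widen_ord (leqnSn n) i) (widen_ord (leqnSn n) j).
Proof.
have Prow p (X : 'M[C]_(n.+1, p)) a b : ((Pimx R n)^T *m X) a b = X (widen_ord (leqnSn n) a) b.
  rewrite mxE (bigD1 (widen_ord (leqnSn n) a)) //= Pimx_inj !mxE /= eqxx mul1r.
  rewrite big1 ?addr0 // => l hl; rewrite !mxE add0n; case: eqP => [E|]; rewrite ?mul0r //.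
  by case/eqP: hl; apply: val_inj.
have Pcol p (X : 'M[C]_(p, n.+1)) a b : (X *m Pimx R n) a b = X a (widen_ord (leqnSn n) b).
  have -> : X *m Pimx R n = ((Pimx R n)^T *m X^T)^T by rewrite trmx_mul !trmxK.
  by rewrite mxE Prow mxE.
by rewrite Pcol Prow.
Qed.

Lemma fnorm_compress n (A : 'M[C]_n.+1) :
  fnorm ((Pimx R n)^T *m A *m Pimx R n) <= fnorm A.
Proof.
rewrite fnorm_leE /fnorm2 big_ord_recr /= -[leLHS]addr0; apply: lerD; last first.
  by apply: sumr_ge0 => ? _; rewrite sqr_ge0.
apply: ler_sum => i _; rewrite big_ord_recr /= -[leLHS]addr0; apply: lerD; last first.
  by rewrite sqr_ge0.
by apply: ler_sum => j _; rewrite compressE.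
Qed.

End Cores.

(** * Stored triangular factors *)

Section Factors.
Variable R : realType.
Local Notation C := R[i].

Lemma fnorm_row_unitary n (U : 'M[C]_n) i : U \is unitarymx -> fnorm (row i U) = 1.
Proof. by move=> hU; rewrite rowE fnorm_unitaryr // fnorm_delta. Qed.

(* C^*(B + e_1 y^T) in terms of c = C^* e_1 and H = C^* B. *)
Definition extfactor n (c : 'cV[C]_n.+1) (H : 'M[C]_n.+1) : 'M[C]_n.+1 :=
  H - (c ord_max 0)^-1 *: c *m row ord_max H.

Definition rho n (F : factor R) : C := adj (prodC n F) ord_max ord0.

Lemma mul_delta_col m n p (A : 'M[C]_(m, n)) j (k : 'I_p) i :
  (A *m delta_mx j k) i k = A i j.
Proof.
rewrite mxE (bigD1 j) //= mxE !eqxx mulr1 big1 ?addr0 // => l /negbTE nl.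
by rewrite mxE nl mulr0.
Qed.

Lemma factor_mx_ext n F : factor_mx n F =
  (Pimx R n)^T *m extfactor (adj (prodC n F) *m delta_mx ord0 ord0)
                         (adj (prodC n F) *m prodB n F) *m Pimx R n.
Proof.
rewrite /factor_mx /factor_y /extfactor mul_delta_col; congr (_ *m _ *m _).
by rewrite mulmxDr scaleNr !mulmxN mulmxA -scalemxAr scalemxAl.
Qed.

(** With [t = c / c_{n+1}], the difference is [(H' - H) - (t' - t) row H' - t row (H' - H)]. The
    three terms cost [e], [2 e / r^2] and [e / r], the square of [r] coming from the difference of
    two inverses; since [r <= 1], they sum to at most [4 e / r^2]. *)
Lemma extfactor_near n (c c' : 'cV[C]_n.+1) (H H' : 'M[C]_n.+1) (r e : R) :
  0 < r <= 1 -> r <= normc (c ord_max 0) -> r <= normc (c' ord_max 0) ->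
  fnorm c <= 1 -> fnorm (row ord_max H') <= 1 ->
  fnorm (c' - c) <= e -> fnorm (H' - H) <= e ->
  fnorm (extfactor c' H' - extfactor c H) <= 4 * e / r ^+ 2.
Proof.
move=> /andP[r0 r1] hr hr' hc hH' hcc hHH.
have e0 : 0 <= e by apply: le_trans hcc; rewrite fnorm_ge0.
have nz (x : C) : r <= normc x -> x != 0.
  by move=> hx; apply/eqP => E; move: hx; rewrite E normc0 leNgt r0.
have hi (x : C) : r <= normc x -> normc x^-1 <= r^-1.
  by move=> hx; rewrite normcV lef_pV2 // posrE (lt_le_trans r0).
have ri0 : 0 < r^-1 by rewrite invr_gt0.
have ri1 : 1 <= r^-1 by rewrite invf_ge1.
set a := c ord_max 0 in hr *; set a' := c' ord_max 0 in hr' *.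
pose t := a^-1 *: c; pose t' := a'^-1 *: c'.
have ht : fnorm t <= r^-1.
  rewrite fnormZ -[r^-1]mulr1; apply: ler_pM; rewrite ?normc_ge0 ?fnorm_ge0 //.
  exact: hi.
have hda : normc (a'^-1 - a^-1) <= e * (r^-1 * r^-1).
  have -> : a'^-1 - a^-1 = (a - a') * (a'^-1 * a^-1).
    rewrite mulrBl mulrCA divff ?nz // mulr1 mulrA divff ?nz // mul1r //.
  rewrite normcM normcM; apply: ler_pM; rewrite ?mulr_ge0 ?normc_ge0 //.
    rewrite normcB; have := entry_fnorm (c' - c) ord_max 0.
    rewrite addmxE oppmxE; move/le_trans; exact.
  by apply: ler_pM; rewrite ?normc_ge0 ?hi.
have htt : fnorm (t' - t) <= 2 * (e * (r^-1 * r^-1)).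
  have -> : t' - t = a'^-1 *: (c' - c) + (a'^-1 - a^-1) *: c.
    by rewrite scalerBr scalerBl -/t -/t'; move: t t' (_ *: _) {ht} => *; mxabel.
  apply: le_trans (fnormD _ _) _; rewrite !fnormZ.
  have h1 : normc a'^-1 * fnorm (c' - c) <= r^-1 * e.
    by apply: ler_pM; rewrite ?normc_ge0 ?fnorm_ge0 ?hi.
  have h2 : normc (a'^-1 - a^-1) * fnorm c <= e * (r^-1 * r^-1) * 1.
    by apply: ler_pM; rewrite ?normc_ge0 ?fnorm_ge0.
  have : r^-1 * e <= e * (r^-1 * r^-1) by rewrite mulrC ler_wpM2l // ler_peMl // ltW.
  by move: h1 h2; nlra.
have -> : extfactor c' H' - extfactor c H =
  (H' - H) - (t' - t) *m row ord_max H' - t *m row ord_max (H' - H).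
  have -> : row ord_max (H' - H) = row ord_max H' - row ord_max H by rewrite linearB.
  rewrite /extfactor -/a -/a' -/t -/t' mulmxBr mulmxBl.
  by move: (row _ _) (row _ _) t t' {ht htt} => *; mxabel.
have h3 : fnorm ((t' - t) *m row ord_max H') <= 2 * (e * (r^-1 * r^-1)) * 1.
  by apply: le_trans (fnormM _ _) _; apply: ler_pM; rewrite ?fnorm_ge0.
have h4 : fnorm (t *m row ord_max (H' - H)) <= r^-1 * e.
  apply: le_trans (fnormM _ _) _; apply: ler_pM; rewrite ?fnorm_ge0 //.
  rewrite rowE; apply: le_trans (fnormM _ _) _; by rewrite fnorm_delta mul1r.
have h5 : r^-1 * e <= e * (r^-1 * r^-1).
  by rewrite mulrC ler_wpM2l // ler_peMl // ltW.
have h6 : e <= r^-1 * e by rewrite ler_peMl.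
have -> : 4 * e / r ^+ 2 = 4 * (e * (r^-1 * r^-1)).
  by rewrite -mulrA expr2 invfM.
apply: le_trans (fnormB _ _) _; apply: le_trans (lerD (fnormB _ _) (lexx _)) _.
apply: le_trans (lerD (lerD hHH h3) h4) _.
by move: h5 h6; move: (r^-1 * e) (e * _); nlra.
Qed.

(** A matrix [U] whose last row is that of the identity changes neither the last entry of [c] nor
    the last row of [H], hence not the coefficients with which the rank-one correction is
    recovered. *)
Lemma extfactor_gauge n (c : 'cV[C]_n.+1) (H U V : 'M[C]_n.+1) :
  row ord_max U = row ord_max 1%:M ->
  extfactor (U *m c) (U *m H *m V) = U *m extfactor c H *m V.
Proof.
move=> hU; have hr p (A : 'M[C]_(n.+1, p)) : row ord_max (U *m A) = row ord_max A.
  by rewrite row_mul hU -row_mul mul1mx.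
have ha : (U *m c) ord_max 0 = c ord_max 0.
  by have /rowP/(_ 0) := hr _ c; rewrite !mxE.
rewrite /extfactor ha -mulmxA hr row_mul mulmxBr mulmxBl !mulmxA.
by rewrite -!scalemxAr -!scalemxAl ?mulmxA.
Qed.

Lemma extfactor_le n (c : 'cV[C]_n.+1) (H : 'M[C]_n.+1) (r : R) : 0 < r -> r <= normc (c ord_max 0) ->
  fnorm c <= 1 -> H \is unitarymx -> fnorm (extfactor c H) <= n.+1%:R + r^-1.
Proof.
move=> r0 hr hc hH; apply: le_trans (fnormB _ _) _; apply: lerD; first exact: fnorm_unitary.
apply: le_trans (fnormM _ _) _; rewrite fnorm_row_unitary // mulr1 fnormZ -[r^-1]mulr1.
apply: ler_pM; rewrite ?normc_ge0 ?fnorm_ge0 //.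
by rewrite normcV lef_pV2 // posrE (lt_le_trans r0).
Qed.

(** The row [y] takes no part in the pass-through. It follows nevertheless, because [X] fixes [e_1]
    and [G'] fixes the last row: up to errors the pair [(c, H)] becomes its exact transform under
    [adj G'] and [G], and recovery commutes with this. The errors of [c] and [H] are [e] and [2 e],
    whence [8 e / r^2]. The last entry of [c] moves by at most [e], so the margin in [r + e] keeps
    both values above [r]. *)
Lemma extfactor_pass n (Cs B Cs' B' G G' X : 'M[C]_n.+1) (r e : R) :
  let d0 := delta_mx ord0 ord0 : 'cV[C]_n.+1 in
  0 < r <= 1 -> Cs \is unitarymx -> B \is unitarymx ->
  Cs' \is unitarymx -> B' \is unitarymx -> G' \is unitarymx ->
  X *m d0 = d0 -> row ord_max (adj G') = row ord_max 1%:M ->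
  fnorm (X *m B' - B *m G) <= e -> fnorm (G' *m Cs' - Cs *m X) <= e ->
  r + e <= normc (Cs ord_max ord0) ->
  normc (Cs ord_max ord0) - e <= normc (Cs' ord_max ord0) /\
  fnorm (G' *m extfactor (Cs' *m d0) (Cs' *m B') - extfactor (Cs *m d0) (Cs *m B) *m G)
    <= 8 * e / r ^+ 2.
Proof.
move=> d0 hr uC uB uC' uB' uG' hX hG' hB hC hrho.
have e0 : 0 <= e by apply: le_trans hB; rewrite fnorm_ge0.
have hC' : fnorm (Cs' - adj G' *m Cs *m X) <= e.
  have -> : Cs' - adj G' *m Cs *m X = adj G' *m (G' *m Cs' - Cs *m X).
    by rewrite mulmxBr !mulmxA unitary_adj_mul // mul1mx.
  by rewrite fnorm_unitaryl ?adj_unitary.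
have hc : fnorm (Cs' *m d0 - adj G' *m (Cs *m d0)) <= e.
  have -> : Cs' *m d0 - adj G' *m (Cs *m d0) = (Cs' - adj G' *m Cs *m X) *m d0.
    by rewrite mulmxBl -!mulmxA hX.
  by apply: le_trans (fnormM _ _) _; rewrite fnorm_delta mulr1.
have hH : fnorm (Cs' *m B' - adj G' *m (Cs *m B) *m G) <= 2 * e.
  have -> : Cs' *m B' - adj G' *m (Cs *m B) *m G =
     (Cs' - adj G' *m Cs *m X) *m B' + adj G' *m Cs *m (X *m B' - B *m G).
    by rewrite mulmxBl mulmxBr !mulmxA; mxabel.
  have uGC : adj G' *m Cs \is unitarymx by apply: mul_unitarymx uC; rewrite adj_unitary.
  apply: le_trans (fnormD _ _) _; rewrite (fnorm_unitaryr _ uB') (fnorm_unitaryl _ uGC).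
  by apply: le_trans (lerD hC' hB) _; rewrite mulrDl mul1r.
have hrow p (A : 'M[C]_(n.+1, p)) : row ord_max (adj G' *m A) = row ord_max A.
  by rewrite row_mul hG' -row_mul mul1mx.
have ent : (adj G' *m (Cs *m d0)) ord_max 0 = Cs ord_max ord0.
  by have /rowP/(_ 0) := hrow _ (Cs *m d0); rewrite [LHS]mxE [RHS]mxE mul_delta_col.
have ent' : (Cs' *m d0) ord_max 0 = Cs' ord_max ord0 by rewrite mul_delta_col.
have hrho' : normc (Cs ord_max ord0) - e <= normc (Cs' ord_max ord0).
  have := entry_fnorm (adj G' *m (Cs *m d0) - Cs' *m d0) ord_max 0.
  rewrite addmxE oppmxE ent ent' => h.
  have := le_normcD (Cs ord_max ord0 - Cs' ord_max ord0) (Cs' ord_max ord0).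
  rewrite subrK => h2; rewrite lerBlDr addrC; apply: le_trans h2 _.
  rewrite lerD2r; apply: le_trans h _; rewrite fnormBC; exact: hc.
split=> //.
rewrite (fnorm_gauge _ _ uG') mulmxA -(extfactor_gauge _ _ _ hG').
have -> : 8 * e / r ^+ 2 = 4 * (2 * e) / r ^+ 2 by rewrite mulrA -natrM.
apply: extfactor_near => //.
- by rewrite ent; apply: le_trans hrho; rewrite lerDl.
- by rewrite ent'; apply: le_trans hrho'; rewrite lerBrDr.
- by rewrite fnorm_unitaryl ?adj_unitary // fnorm_unitaryl // fnorm_delta.
- by rewrite (fnorm_row_unitary _ (mul_unitarymx uC' uB')).
- by apply: le_trans hc _; rewrite ler_peMl // ler1n.
Qed.

Definition coreprod m t (g : nat -> 'M[C]_2) : 'M[C]_m.+1 :=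
  \prod_(i < t) core m.+1 i (g i).

Lemma coreprodS m t g : coreprod m t.+1 g = coreprod m t g *m core m.+1 t (g t).
Proof. by rewrite /coreprod big_ord_recr. Qed.

Lemma coreprod_unitary m t g : (t <= m)%N ->
  (forall i, (i < t)%N -> g i \is unitarymx) -> coreprod m t g \is unitarymx.
Proof.
elim: t => [|t IH] h hg; first by rewrite /coreprod big_ord0 unitary1.
rewrite coreprodS mul_unitarymx //; last by rewrite core_unitary ?hg.
by apply: IH => [|i hi]; [exact: ltnW|rewrite hg // ltnW].
Qed.

Lemma coreprod_near m t g g' e : (t <= m)%N ->
  (forall i, (i < t)%N -> [/\ g i \is unitarymx, g' i \is unitarymx &
     fnorm (g i - g' i) <= e]) ->
  fnorm (coreprod m t g - coreprod m t g') <= t%:R * e.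
Proof.
elim: t => [|t IH] h hg; first by rewrite /coreprod !big_ord0 subrr fnorm0 mul0r.
have [u u' he] := hg t (leqnn _).
have uP : coreprod m t g' \is unitarymx.
  by apply: coreprod_unitary (ltnW h) _ => i hi; have [] := hg i (ltnW hi).
have uK := core_unitary (h : (t.+1 < m.+1)%N) u.
have hP : fnorm (coreprod m t g - coreprod m t g') <= t%:R * e.
  by apply: IH (ltnW h) _ => i hi; apply: hg; rewrite ltnW.
have hK := @fnorm_coreB _ m.+1 t (g t) (g' t) h; rewrite -hK in he.
rewrite !coreprodS -natr1 mulrDl mul1r; move: hP he uP uK {hK}.
move: (core _ _ (g t)) (core _ _ (g' t)) (coreprod m t g) (coreprod m t g').
move=> K K' P P' hP hK uP' uK.
have -> : P *m K - P' *m K' = (P - P') *m K + P' *m (K - K').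
  by rewrite mulmxBl mulmxBr; mxabel.
apply: le_trans (fnormD _ _) _.
by rewrite (fnorm_unitaryr _ uK) (fnorm_unitaryl _ uP') lerD.
Qed.

Lemma coreprod_eq m t g g' : (forall i, (i < t)%N -> g i = g' i) ->
  coreprod m t g = coreprod m t g'.
Proof. by move=> h; apply: eq_bigr => i _; rewrite h. Qed.

Lemma coreprod_comm m t g i (G : 'M[C]_2) : (t < i)%N -> (i < m)%N ->
  coreprod m t g *m core m.+1 i G = core m.+1 i G *m coreprod m t g.
Proof.
elim: t => [|t IH] h1 h2; first by rewrite /coreprod big_ord0 mul1mx mulmx1.
have hc : core m.+1 t (g t) *m core m.+1 i G = core m.+1 i G *m core m.+1 t (g t).
  by rewrite core_comm ?ltnS ?h1 // (ltn_trans _ h2) // ltnW.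
by rewrite coreprodS -mulmxA hc mulmxA IH ?(ltnW h1) // mulmxA.
Qed.

(** [L] collects the cores before position [i] and [P] those after [i + 1]; each is disjoint from
    one of the two active cores. They depend only on the untouched cores, so they serve the factor
    before and after a turnover alike. *)
Lemma coreprod_split n g i : (i.+1 < n)%N -> (forall j, (j < n)%N -> g j \is unitarymx) ->
  exists L P : 'M[C]_n.+1, [/\ L \is unitarymx, P \is unitarymx,
    forall X, L *m core n.+1 i.+1 X = core n.+1 i.+1 X *m L,
    forall X, P *m core n.+1 i X = core n.+1 i X *m P &
    forall g', (forall j, j != i -> j != i.+1 -> g' j = g j) ->
      coreprod n n g' = L *m (core n.+1 i (g' i) *m core n.+1 i.+1 (g' i.+1)) *m P].
Proof.
move=> hi hg; have hi1 : (i < n)%N by exact: ltnW.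
suff H t : (t <= n)%N -> (i.+2 <= t)%N -> exists L P : 'M[C]_n.+1,
   [/\ L \is unitarymx, P \is unitarymx,
    forall X, L *m core n.+1 i.+1 X = core n.+1 i.+1 X *m L,
    forall X, P *m core n.+1 i X = core n.+1 i X *m P &
    forall g', (forall j, j != i -> j != i.+1 -> g' j = g j) ->
      coreprod n t g' = L *m (core n.+1 i (g' i) *m core n.+1 i.+1 (g' i.+1)) *m P].
  exact: H.
elim: t => // t IH htn; rewrite leq_eqVlt => /orP[/eqP[<-]|hit].
  exists (coreprod n i g), 1%:M; split=> [||X|X|g' hg'].
  - by rewrite coreprod_unitary ?(ltnW hi1) // => j hj; rewrite hg // (ltn_trans hj).
  - exact: unitary1.
  - by rewrite coreprod_comm.
  - by rewrite mul1mx mulmx1.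
  - rewrite mulmx1 !coreprodS mulmxA; congr (_ *m _ *m _); apply: coreprod_eq => j hj.
    by rewrite hg' //; lia.
have [L [P [uL uP hL hP hE]]] := IH (ltnW htn) hit.
exists L, (P *m core n.+1 t (g t)); split; [exact: uL| |exact: hL|move=> X|move=> g' hg'].
- by apply: mul_unitarymx uP (core_unitary _ (hg _ _)).
- have hc : core n.+1 t (g t) *m core n.+1 i X = core n.+1 i X *m core n.+1 t (g t).
    by apply: core_comm; [exact: htn|exact: ltnW|apply/orP; right; exact: hit].
  by rewrite -mulmxA hc mulmxA hP mulmxA.
- have -> : coreprod n t.+1 g' = coreprod n t g' *m core n.+1 t (g t).
    by rewrite coreprodS hg' //; apply/eqP => E; move: hit; rewrite E; lia.
  by rewrite (hE _ hg'); exact: esym (mulmxA _ _ _).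
Qed.

Lemma core_delta0 m i (G : 'M[C]_2) : (i.+1 < m)%N ->
  core m.+1 i.+1 G *m delta_mx ord0 ord0 = delta_mx ord0 ord0 :> 'cV[C]_m.+1.
Proof.
move=> h; apply/colP => a; rewrite (_ : 0 = ord0) // mul_delta_col !mxE.
by rewrite !andbF eqxx andbT.
Qed.

Lemma core_row_max m i (G : 'M[C]_2) : (i.+1 < m)%N ->
  row ord_max (core m.+1 i G) = row ord_max 1%:M.
Proof.
by move=> h; apply/rowP => b; rewrite !mxE /= (leqNgt m) h andbF.
Qed.

End Factors.

(** * Passing a core through a stored factor *)

Section StoredFactors.
Variable R : realType.
Local Notation C := R[i].
Variable n : nat.
Implicit Types (A F : factor R) (G X : 'M[C]_2) (r e : R).

Lemma fnorm_adj_gauge m (K K1 Y Z : 'M[C]_m) : K \is unitarymx -> K1 \is unitarymx ->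
  fnorm (adj K1 *m Y - Z *m adj K) = fnorm (Y *m K - K1 *m Z).
Proof.
move=> uK uK1; rewrite fnorm_gauge ?adj_unitary // adjK -(fnorm_unitaryr _ uK).
by rewrite mulmxBl -!mulmxA unitary_adj_mul // mulmx1.
Qed.

Lemma prodC_unitary F : unitary_factor n F -> prodC n F \is unitarymx.
Proof.
move=> hF; apply: (@coreprod_unitary R n n) (leqnn n) _ => i hi.
by have [hC hB] := hF i hi; exact: hC.
Qed.

Lemma prodB_unitary F : unitary_factor n F -> prodB n F \is unitarymx.
Proof.
move=> hF; apply: (@coreprod_unitary R n n) (leqnn n) _ => i hi.
by have [hC hB] := hF i hi; exact: hB.
Qed.

(** The cores surrounding the active ones commute with the travelling core on the respective side,
    so the error of the local turnover is the error in the whole product. *)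
Lemma sandwich_nearl m (L P K1 K2 Y1 Y2 Z1 Z2 : 'M[C]_m) e :
  L \is unitarymx -> P \is unitarymx -> L *m K1 = K1 *m L -> P *m K2 = K2 *m P ->
  fnorm (K1 *m Y1 *m Y2 - Z1 *m Z2 *m K2) <= e ->
  fnorm (K1 *m (L *m (Y1 *m Y2) *m P) - L *m (Z1 *m Z2) *m P *m K2) <= e.
Proof.
move=> uL uP hL hP he.
have -> : K1 *m (L *m (Y1 *m Y2) *m P) - L *m (Z1 *m Z2) *m P *m K2
   = L *m (K1 *m Y1 *m Y2 - Z1 *m Z2 *m K2) *m P.
  by rewrite mulmxBr mulmxBl !mulmxA hL -(mulmxA _ K2 P) -hP !mulmxA.
by rewrite (fnorm_unitaryr _ uP) (fnorm_unitaryl _ uL); exact: he.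
Qed.

Lemma sandwich_nearr m (L P K1 K2 Y1 Y2 Z1 Z2 : 'M[C]_m) e :
  L \is unitarymx -> P \is unitarymx -> L *m K1 = K1 *m L -> P *m K2 = K2 *m P ->
  fnorm (Y1 *m Y2 *m K2 - K1 *m Z1 *m Z2) <= e ->
  fnorm (L *m (Y1 *m Y2) *m P *m K2 - K1 *m (L *m (Z1 *m Z2) *m P)) <= e.
Proof.
move=> uL uP hL hP he.
rewrite fnormBC in he; rewrite fnormBC; exact: sandwich_nearl uL uP hL hP he.
Qed.

Lemma prodB_split A A' i : (i.+1 < n)%N -> unitary_factor n A -> same_but i A A' ->
  exists L P : 'M[C]_n.+1, [/\ L \is unitarymx, P \is unitarymx,
    forall X, L *m core n.+1 i.+1 X = core n.+1 i.+1 X *m L,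
    forall X, P *m core n.+1 i X = core n.+1 i X *m P &
    prodB n A = L *m (core n.+1 i (coreB A i) *m core n.+1 i.+1 (coreB A i.+1)) *m P
    /\ prodB n A' = L *m (core n.+1 i (coreB A' i) *m core n.+1 i.+1 (coreB A' i.+1)) *m P].
Proof.
move=> hi hA hs; have [|L [P [uL uP hL hP hE]]] := @coreprod_split R n (coreB A) i hi.
  by move=> j hj; have [hC hB] := hA j hj; exact: hB.
exists L, P; split; [exact: uL|exact: uP|exact: hL|exact: hP|split].
  exact: (hE (coreB A) (fun _ _ _ => erefl)).
by apply: (hE (coreB A')) => j h1 h2; have [_ ->] := hs j h1 h2.
Qed.

Lemma prodC_split A A' i : (i.+1 < n)%N -> unitary_factor n A -> same_but i A A' ->
  exists L P : 'M[C]_n.+1, [/\ L \is unitarymx, P \is unitarymx,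
    forall X, P *m core n.+1 i.+1 X = core n.+1 i.+1 X *m P,
    forall X, L *m core n.+1 i X = core n.+1 i X *m L &
    adj (prodC n A) = L *m (core n.+1 i.+1 (adj (coreC A i.+1)) *m core n.+1 i (adj (coreC A i))) *m P
    /\ adj (prodC n A') = L *m (core n.+1 i.+1 (adj (coreC A' i.+1)) *m core n.+1 i (adj (coreC A' i))) *m P].
Proof.
move=> hi hA hs; have [|L [P [uL uP hL hP hE]]] := @coreprod_split R n (coreC A) i hi.
  by move=> j hj; have [hC hB] := hA j hj; exact: hC.
have hi1 : (i.+1 < n.+1)%N by exact: ltnW.
have hadj (Z W : 'M[C]_n.+1) : Z *m adj W = adj W *m Z <-> adj Z *m W = W *m adj Z.
  by split=> E; apply: (can_inj (@adjK _ _ _)); rewrite !adjM adjK E.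
exists (adj P), (adj L); split; [by rewrite adj_unitary|by rewrite adj_unitary|move=> X|move=> X|].
- have := hL (adj X); rewrite -adj_core // => /hadj; exact.
- have := hP (adj X); rewrite -adj_core // => /hadj; exact.
- split; rewrite -!adj_core // -!adjM; congr (adj _); rewrite mulmxA.
    exact: (hE (coreC A) (fun _ _ _ => erefl)).
  by apply: (hE (coreC A')) => j h1 h2; have [-> _] := hs j h1 h2.
Qed.

Lemma compress_corel i G X (Y Z : 'M[C]_n.+1) : (i.+1 < n)%N ->
  core n i G *m ((Pimx R n)^T *m Y *m Pimx R n) - (Pimx R n)^T *m Z *m Pimx R n *m core n i X
  = (Pimx R n)^T *m (core n.+1 i G *m Y - Z *m core n.+1 i X) *m Pimx R n.
Proof.
move=> hi; rewrite mulmxBr mulmxBl !mulmxA Pimx_tr_core //; congr (_ - _).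
by rewrite -!mulmxA core_Pimx.
Qed.

Lemma compress_corer i G X (Y Z : 'M[C]_n.+1) : (i.+1 < n)%N ->
  (Pimx R n)^T *m Y *m Pimx R n *m core n i G - core n i X *m ((Pimx R n)^T *m Z *m Pimx R n)
  = (Pimx R n)^T *m (Y *m core n.+1 i G - core n.+1 i X *m Z) *m Pimx R n.
Proof.
by move=> hi; rewrite -opprB compress_corel // -opprB mulmxN mulNmx opprK.
Qed.

Lemma pass_left_unitary A A' i G G' e : (i.+1 < n)%N -> unitary_factor n A ->
  pass_left e i A G G' A' -> unitary_factor n A' /\ G' \is unitarymx.
Proof.
move=> hi hA [hs [X [uX uB uB1 _] [uG uC1 uC _]]]; split; last exact: uG.
move=> j hj; have [->|ji] := eqVneq j i; first by split; [rewrite -adj_unitary|]; [exact: uC|exact: uB].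
have [->|ji1] := eqVneq j i.+1; first by split; [rewrite -adj_unitary|]; [exact: uC1|exact: uB1].
by have [-> ->] := hs j ji ji1; exact: (hA j hj).
Qed.

Lemma pass_right_unitary A A' i G G' e : (i.+1 < n)%N -> unitary_factor n A ->
  pass_right e i G A A' G' -> unitary_factor n A' /\ G' \is unitarymx.
Proof.
move=> hi hA [hs [X [uC1 uC uX _] [uB uB1 uG _]]]; split; last exact: uG.
move=> j hj; have [->|ji] := eqVneq j i; first by split; [rewrite -adj_unitary|]; [exact: uC|exact: uB].
have [->|ji1] := eqVneq j i.+1; first by split; [rewrite -adj_unitary|]; [exact: uC1|exact: uB1].
by have [-> ->] := hs j ji ji1; exact: (hA j hj).
Qed.

(** The turnover on [B] moves the core one position down, where it fixes [e_1]; the turnover on the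
    adjoint of [C] moves it back to position [i], where it fixes the last of the [n + 1] rows. These
    are the two invariances required by [extfactor_pass]. *)
Lemma pass_leftP A A' i G G' r e : (i.+1 < n)%N -> 0 < r <= 1 ->
  unitary_factor n A -> r + e <= normc (rho n A) -> pass_left e i A G G' A' ->
  normc (rho n A) - e <= normc (rho n A') /\
  fnorm (core n i G' *m factor_mx n A' - factor_mx n A *m core n i G)
    <= 8 * e / r ^+ 2.
Proof.
move=> hi hr hA hrho hp; have [hA' uG'] := pass_left_unitary hi hA hp.
have [hs [X hdown hup]] := hp.
have hi1 : (i.+1 < n.+1)%N by exact: ltnW.
have [uX _ _ _] := hdown.
have [L [P [uL uP hL hP [EB EB']]]] := prodB_split hi hA hs.
have [L2 [P2 [uL2 uP2 hP2 hL2 [EC EC']]]] := prodC_split hi hA hs.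
have hB : fnorm (core n.+1 i.+1 X *m prodB n A' - prodB n A *m core n.+1 i G) <= e.
  rewrite EB EB'; apply: sandwich_nearl uL uP (hL X) (hP _) _.
  exact: (turnover_down_core (hi : (i.+2 < n.+1)%N) hdown).
have hC : fnorm (core n.+1 i G' *m adj (prodC n A') - adj (prodC n A) *m core n.+1 i.+1 X) <= e.
  rewrite EC EC'; apply: sandwich_nearl uL2 uP2 (hL2 _) (hP2 X) _.
  exact: (turnover_up_core (hi : (i.+2 < n.+1)%N) hup).
have uK : core n.+1 i G' \is unitarymx by exact: (core_unitary hi1 uG').
have hrow : row ord_max (adj (core n.+1 i G')) = row ord_max 1%:M.
  by rewrite adj_core // core_row_max.
have uC : adj (prodC n A) \is unitarymx by rewrite adj_unitary prodC_unitary.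
have uC' : adj (prodC n A') \is unitarymx by rewrite adj_unitary prodC_unitary.
have [h1 h2] := extfactor_pass hr uC (prodB_unitary hA) uC' (prodB_unitary hA') uK
  (core_delta0 _ hi) hrow hB hC hrho.
split; first exact: h1.
by apply: le_trans h2; rewrite !factor_mx_ext compress_corel //; exact: fnorm_compress.
Qed.

Lemma pass_rightP A A' i G G' r e : (i.+1 < n)%N -> 0 < r <= 1 -> G \is unitarymx ->
  unitary_factor n A -> r + e <= normc (rho n A) -> pass_right e i G A A' G' ->
  normc (rho n A) - e <= normc (rho n A') /\
  fnorm (factor_mx n A' *m core n i G' - core n i G *m factor_mx n A)
    <= 8 * e / r ^+ 2.
Proof.
move=> hi hr uG hA hrho hp; have [hA' uG'] := pass_right_unitary hi hA hp.
have [hs [X hdown hup]] := hp.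
have hi1 : (i.+1 < n.+1)%N by exact: ltnW.
have [_ _ uX _] := hdown.
have [L [P [uL uP hL hP [EB EB']]]] := prodB_split hi hA hs.
have [L2 [P2 [uL2 uP2 hP2 hL2 [EC EC']]]] := prodC_split hi hA hs.
have uK : core n.+1 i G \is unitarymx by exact: (core_unitary hi1 uG).
have uK' : core n.+1 i G' \is unitarymx by exact: (core_unitary hi1 uG').
have uKX : core n.+1 i.+1 X \is unitarymx by exact: (core_unitary (hi : (i.+2 < n.+1)%N) uX).
have hB : fnorm (prodB n A' *m core n.+1 i G' - core n.+1 i.+1 X *m prodB n A) <= e.
  rewrite EB EB'; apply: sandwich_nearr uL uP (hL X) (hP _) _.
  exact: (turnover_up_core (hi : (i.+2 < n.+1)%N) hup).
have hC : fnorm (adj (prodC n A') *m core n.+1 i.+1 X - core n.+1 i G *m adj (prodC n A)) <= e.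
  rewrite EC EC'; apply: sandwich_nearr uL2 uP2 (hL2 _) (hP2 X) _.
  exact: (turnover_down_core (hi : (i.+2 < n.+1)%N) hdown).
have uC : adj (prodC n A) \is unitarymx by rewrite adj_unitary prodC_unitary.
have uC' : adj (prodC n A') \is unitarymx by rewrite adj_unitary prodC_unitary.
(* In terms of adjoint cores, passing to the right is passing to the left: the adjoint of [G']
   enters the new relation and the adjoint of [G] comes out. *)
rewrite -(fnorm_adj_gauge _ _ uK' uKX) in hB; rewrite -(fnorm_adj_gauge _ _ uKX uK) in hC.
have uKa : adj (core n.+1 i G) \is unitarymx by rewrite adj_unitary.
have hrow : row ord_max (adj (adj (core n.+1 i G))) = row ord_max 1%:M.
  by rewrite adjK core_row_max.
have hd : adj (core n.+1 i.+1 X) *m delta_mx ord0 ord0 = delta_mx ord0 ord0 :> 'cV[C]_n.+1.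
  by rewrite adj_core // core_delta0.
have [h1 h2] := extfactor_pass hr uC (prodB_unitary hA) uC' (prodB_unitary hA') uKa
  hd hrow hB hC hrho.
split; first exact: h1.
apply: le_trans h2; rewrite (fnorm_adj_gauge _ _ uK' uK).
by rewrite !factor_mx_ext compress_corer //; exact: fnorm_compress.
Qed.

End StoredFactors.

(** * Triangularity of stored factors and the initial size of [rho] *)

Section Triangular.
Variable R : realType.
Local Notation C := R[i].

Lemma mul_core_out m i (G : 'M[C]_2) p (X : 'M[C]_(p, m)) a (b : 'I_m) :
  (b != i :> nat) -> (b != i.+1 :> nat) -> (X *m core m i G) a b = X a b.
Proof.
move=> h1 h2; rewrite mxE (bigD1 b) //= mxE eqxx.
have -> : (i <= b <= i.+1)%N = false by lia.
rewrite andbF mulr1 big1 ?addr0 // => l /negbTE hl.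
have -> : core m i G l b = 0.
  rewrite mxE hl; have -> : (i <= b <= i.+1)%N = false by lia.
  by rewrite andbF.
by rewrite mulr0.
Qed.

Lemma mul_core_in m i (G : 'M[C]_2) p (X : 'M[C]_(p, m)) a (b b0 b1 : 'I_m) (s : 'I_2) :
  b0 = i :> nat -> b1 = i.+1 :> nat -> b = (i + s)%N :> nat ->
  (X *m core m i G) a b = X a b0 * G 0 s + X a b1 * G 1 s.
Proof.
move=> h0 h1 hb; have h01 : b1 != b0 by rewrite -val_eqE /= h0 h1; lia.
have hs : (s < 2)%N by [].
have hin : (i <= b <= i.+1)%N by lia.
have es : inord (b - i) = s by apply: val_inj; rewrite /= inordK ?hb; lia.
rewrite mxE (bigD1 b0) //= (bigD1 b1) //= big1 ?addr0 => [|l /andP[/eqP l0 /eqP l1]].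
  rewrite !mxE hin !andbT h0 h1 leqnn leqnSn subnn subSnn es.
  have e0 : inord 0 = 0 :> 'I_2 by apply: val_inj; rewrite /= inordK.
  have e1 : inord 1 = 1 :> 'I_2 by apply: val_inj; rewrite /= inordK.
  by rewrite e0 e1 leqnn.
have -> : core m i G l b = 0.
  rewrite mxE.
  have -> : (i <= l <= i.+1)%N = false.
    apply/negbTE/negP => hl; have [E|E] : l = i :> nat \/ l = i.+1 :> nat by lia.
      by apply: l0; apply: val_inj; rewrite /= E h0.
    by apply: l1; apply: val_inj; rewrite /= E h1.
  case: eqP => // E; exfalso; have [E'|E'] : b = i :> nat \/ b = i.+1 :> nat by lia.
    by apply: l0; apply: val_inj; rewrite /= E E' h0.
  by apply: l1; apply: val_inj; rewrite /= E E' h1.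
by rewrite mulr0.
Qed.

Lemma coreprod_right m t (g : nat -> 'M[C]_2) (a b : 'I_m.+1) : (t <= m)%N -> (t < b)%N ->
  coreprod m t g a b = (a == b)%:R.
Proof.
elim: t b => [|t IH] b ht hb; first by rewrite /coreprod big_ord0 mxE.
by rewrite coreprodS mul_core_out ?IH //; lia.
Qed.

(** Multiplying by the next core on the right only mixes the columns [t] and [t + 1], and column
    [t + 1] is still a unit vector; the entry of the core below its diagonal thus becomes the new
    subdiagonal entry. *)
Lemma coreprod_hess m t (g : nat -> 'M[C]_2) : (t <= m)%N ->
  (forall a b : 'I_m.+1, (t <= b)%N -> (b < a)%N -> coreprod m t g a b = 0) /\
  (forall a b : 'I_m.+1, (b < t)%N ->
     ((b.+1 < a)%N -> coreprod m t g a b = 0) /\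
     (a = b.+1 :> nat -> coreprod m t g a b = g b 1 0)).
Proof.
elim: t => [|t IH] ht.
  split=> // a b _ hab; rewrite /coreprod big_ord0 mxE.
  by case: eqP => // E; rewrite E ltnn in hab.
have [h1 h2] := IH (ltnW ht); have ht1 : (t < m.+1)%N by exact: ltnW.
have ht2 : (t.+1 < m.+1)%N by [].
pose b0 := Ordinal ht1; pose b1 := Ordinal ht2.
have hr (a b : 'I_m.+1) (hb : (t < b)%N) : coreprod m t g a b = (a == b)%:R.
  exact: coreprod_right (ltnW ht) hb.
have ine (a b : 'I_m.+1) : (b < a)%N -> (a == b) = false.
  by move=> hab; apply/eqP => E; rewrite E ltnn in hab.
split=> [a b|a b].
  rewrite leq_eqVlt => /orP[/eqP hb|hb] hab; rewrite coreprodS.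
    rewrite (mul_core_in _ _ _ (b0 := b0) (b1 := b1) (s := 1)) //; last by rewrite addn1.
    rewrite h1 //= ?mul0r ?add0r ?hr ?ine ?mul0r //=; lia.
  by rewrite mul_core_out ?hr ?ine //; lia.
rewrite ltnS leq_eqVlt => /orP[/eqP hb|hb].
  have E a' : coreprod m t.+1 g a' b = coreprod m t g a' b0 * g t 0 0 + coreprod m t g a' b1 * g t 1 0.
    by rewrite coreprodS (mul_core_in _ _ _ (b0 := b0) (b1 := b1) (s := 0)) // addn0.
  split=> ha; rewrite E.
    by rewrite h1 //= ?mul0r ?add0r ?hr ?ine ?mul0r //=; lia.
  rewrite h1 //=; last by lia.
  rewrite hr //= mul0r add0r (_ : a == b1) ?mul1r ?hb //.
  by apply/eqP; apply: val_inj; rewrite /= ha hb.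
have [h3 h4] := h2 a b hb.
by split=> ha; rewrite coreprodS mul_core_out; try lia; [exact: h3|exact: h4].
Qed.

(** For [t = m] this is the top right entry of the whole product, whose conjugate is [rho]: if [rho]
    does not vanish, no core [C_i] can be diagonal. *)
Lemma coreprod_row0 m t (g : nat -> 'M[C]_2) (b : 'I_m.+1) : (t <= m)%N -> b = t :> nat ->
  coreprod m t g ord0 b = \prod_(j < t) g j 0 1.
Proof.
elim: t b => [|t IH] b ht hb.
  rewrite /coreprod !big_ord0 mxE (_ : ord0 == b) //.
  by apply/eqP; apply: val_inj; rewrite /= hb.
have ht1 : (t < m.+1)%N by exact: ltnW.
rewrite coreprodS (mul_core_in _ _ _ (b0 := Ordinal ht1) (b1 := b) (s := 1)) //; last first.
  by rewrite hb addn1.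
rewrite (IH (Ordinal ht1) (ltnW ht) erefl).
rewrite (coreprod_right _ _ (ltnW ht)); last by rewrite hb.
rewrite (_ : (ord0 == b) = false) ?mul0r ?addr0 ?big_ord_recr //.
by apply/eqP => /(congr1 val) /=; rewrite hb.
Qed.

Lemma unitary2_offdiag (G : 'M[C]_2) : G \is unitarymx -> G 0 1 != 0 -> G 1 0 != 0.
Proof.
move=> uG h01; apply/eqP => h10.
have /matrixP E := unitary_mul_adj uG.
have e1 : lift ord0 ord0 = 1 :> 'I_2 by exact: val_inj.
have e0 : ord0 = 0 :> 'I_2 by exact: val_inj.
have Ei (i j : 'I_2) : G i 0 * Num.conj (G j 0) + G i 1 * Num.conj (G j 1) = (i == j)%:R.
  have := E i j; rewrite [X in X = _]mxE [X in _ = X]mxE !big_ord_recl big_ord0 /=.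
  by rewrite !adjE e1 e0 addr0.
have := Ei 0 1; rewrite h10 conjC0 mulr0 add0r => /eqP.
rewrite mulf_eq0 (negbTE h01) /= => /eqP h11.
by have /eqP := Ei 1 1; rewrite h10 h11 mul0r mulr0 addr0 eqxx eq_sym oner_eq0.
Qed.

(* In the rows 2 to n+1 of C R = B + e_1 y^T both C and B are triangular. *)
Lemma factor_triangular n (F : factor R) (a j : 'I_n) : unitary_factor n F -> rho n F != 0 ->
  (j <= a)%N ->
  factor_mx n F a j = if a == j then coreB F j 1 0 / coreC F j 1 0 else 0.
Proof.
move=> hF hrho; have hc (b : 'I_n) : coreC F b 1 0 != 0.
  apply: unitary2_offdiag; first by have [hC _] := hF b (ltn_ord b); exact: hC.
  apply/eqP => E; case/eqP: hrho; rewrite /rho adjE.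
  have -> : prodC n F ord0 ord_max = \prod_(j < n) coreC F j 0 1 by exact: coreprod_row0.
  by rewrite (bigD1 b) //= E mul0r conjC0.
pose E := adj (prodC n F) *m (prodB n F + delta_mx ord0 ord0 *m factor_y n F).
have hE : prodC n F *m E = prodB n F + delta_mx ord0 ord0 *m factor_y n F.
  by rewrite mulmxA unitary_mul_adj ?mul1mx //; exact: prodC_unitary.
(* The formula for [y] is exactly the condition that the last row of the extended factor vanish. *)
have hlast (b : 'I_n.+1) : E ord_max b = 0.
  have : row ord_max E = 0.
    rewrite /E mulmxDr linearD /= mulmxA -/(rho n F).
    have -> : row ord_max (adj (prodC n F) *m delta_mx ord0 ord0 *m factor_y n F)
       = rho n F *: factor_y n F.
      rewrite row_mul; apply/rowP => l; rewrite [RHS]mxE mxE big_ord1 mxE.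
      by rewrite (_ : 0 = ord0) // mul_delta_col.
    by rewrite /factor_y scalerA mulrN mulfV // scaleN1r subrr.
  by move=> /rowP/(_ b); rewrite !mxE.
have hfm (b l : 'I_n) : factor_mx n F b l =
   E (widen_ord (leqnSn n) b) (widen_ord (leqnSn n) l) by rewrite /factor_mx compressE.
have [_ hessC] := coreprod_hess (coreC F) (leqnn n).
have [_ hessB] := coreprod_hess (coreB F) (leqnn n).
have hB (b : 'I_n) : (j <= b)%N -> (forall l : 'I_n, (b < l)%N -> factor_mx n F l j = 0) ->
   coreC F b 1 0 * factor_mx n F b j = if b == j then coreB F j 1 0 else 0.
  move=> hjb hz.
  have hb1 : (b.+1 < n.+1)%N by rewrite ltnS.
  have /matrixP/(_ (Ordinal hb1) (widen_ord (leqnSn n) j)) := hE.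
  rewrite mxE (bigD1 (widen_ord (leqnSn n) b)) //= [X in _ + X]big1 => [|l hl].
    have [_ ->] := hessC (Ordinal hb1) (widen_ord (leqnSn n) b) (ltn_ord b) => //.
    rewrite addr0 -hfm => ->; rewrite addmxE [X in _ + X]mxE big_ord1 mxE /= mul0r addr0.
    have [h1 h2] := hessB (Ordinal hb1) (widen_ord (leqnSn n) j) (ltn_ord j).
    case: eqP => [bj|bj]; first by rewrite -h2 //= bj.
    by apply: h1; rewrite /= ltnS ltn_neqAle hjb andbT; apply/eqP => E'; apply: bj; apply: val_inj.
  case: (ltngtP l b) => hlb.
  - have [-> //] := hessC (Ordinal hb1) l (ltn_trans hlb (ltn_ord b)); first by rewrite mul0r.
  - case: (ltnP l n) => hln.
      have -> : l = widen_ord (leqnSn n) (Ordinal hln) by apply: val_inj.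
      by rewrite -hfm hz ?mulr0.
    by have -> : l = ord_max by [apply: val_inj => /=; have := ltn_ord l; lia]; rewrite hlast mulr0.
  - by case/eqP: hl; apply: val_inj.
(* Column [j] is cleared from the bottom upwards: row [l + 1] of the identity expresses entry [l]
   through the entries below it, and the subdiagonal entry of [C] can be divided out. *)
have hz m0 : forall l : 'I_n, (n - l <= m0)%N -> (j < l)%N -> factor_mx n F l j = 0.
  elim: m0 => [|m0 IH] l hl hjl; first by have := ltn_ord l; lia.
  have := hB l (ltnW hjl); rewrite (_ : (l == j) = false); last first.
    by apply/eqP => El; rewrite El ltnn in hjl.
  move=> H; have {H} : coreC F l 1 0 * factor_mx n F l j = 0.
    by apply: H => l' hl'; apply: IH; [have := ltn_ord l'; lia|exact: ltn_trans hl'].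
  by move/eqP; rewrite mulf_eq0 (negbTE (hc l)) /= => /eqP.
move=> hja; case: eqP => [E'|aj].
  have := hB a hja; rewrite E' eqxx => H.
  rewrite -H ?[coreC _ _ _ _ * _]mulrC ?mulfK // => l hl.
  by apply: (hz n); rewrite ?leq_subr.
by apply: (hz n); rewrite ?leq_subr // ltn_neqAle hja andbT; apply/eqP => E'; apply: aj; apply: val_inj.
Qed.

(** The vector [[v; -1]] equals [beta] times the adjoint of [C] applied to [e_1]. Its last entry
    gives [beta * rho = -1], and by unitarity the modulus of [beta] is the norm of [[v; -1]]. *)
Lemma stores_rho n l (v : 'cV[C]_n) F : stores (l, v) F ->
  1 <= normc (rho n F) * (fnorm v + 1).
Proof.
move=> [uF [beta hb] _]; rewrite /= in hb.
have uC := prodC_unitary uF.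
have hw : Pimx R n *m v - delta_mx ord_max ord0 =
   beta *: (adj (prodC n F) *m delta_mx ord0 ord0).
  by rewrite scalemxAr -hb mulmxA unitary_adj_mul // mul1mx.
have hbeta : normc beta <= fnorm v + 1.
  have -> : normc beta = fnorm (Pimx R n *m v - delta_mx ord_max ord0).
    by rewrite -(fnorm_unitaryl _ uC) hb fnormZ fnorm_delta mulr1.
  apply: le_trans (fnormB _ _) _; rewrite fnorm_delta fnorm_isometryl //.
  by rewrite Pimx_inj adj_inj inj_tr_inj.
have : normc (rho n F) * normc beta = 1.
  have /colP/(_ ord_max) := hw; rewrite addmxE oppmxE mxE big1 => [|j _]; last first.
    by rewrite Pimx_inj mxE add0n /= gtn_eqF ?mul0r.
  rewrite mxE !eqxx mxE (_ : 0 = ord0) // mul_delta_col -/(rho n F) mulrC => E.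
  by rewrite -normcM -E add0r normcN normc1.
move=> E1; rewrite -[leLHS]E1; exact: ler_wpM2l (normc_ge0 _) _ _ hbeta.
Qed.

(** Exact storage has [rho] at least [1 / b] in modulus, and the rounding of [n] cores costs at most
    [n e <= 1 / (2 b)]. Then [extfactor_near] with [r = 1 / (2 b)] and error [2 n e] yields
    [4 * 2 n e * (2 b)^2 = 32 n e b^2]. *)
Lemma fl_stores_near n e b l (v : 'cV[C]_n) F : fl_stores e (l, v) F ->
  1 <= b -> 0 <= e -> fnorm v + 1 <= b -> 2 * b * (n%:R * e) <= 1 ->
  [/\ unitary_factor n F, (2 * b)^-1 <= normc (rho n F) &
      fnorm (factor_mx n F - spikemx l v) <= 32 * n%:R * e * b ^+ 2].
Proof.
move=> [uF [F0 st hcl]] b1 e0 hv hsm; have [uF0 _ hF0] := st.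
have b0 : 0 < b by exact: lt_le_trans b1.
have uC := prodC_unitary uF; have uC0 := prodC_unitary uF0.
have uB := prodB_unitary uF; have uB0 := prodB_unitary uF0.
have hC : fnorm (prodC n F - prodC n F0) <= n%:R * e.
  apply: (@coreprod_near R n n) (leqnn n) _ => i hi; have [h1 h2] := hcl i hi.
  have [h3 _] := uF i hi; have [h4 _] := uF0 i hi.
  by split; [exact: h3|exact: h4|exact: h1].
have hB : fnorm (prodB n F - prodB n F0) <= n%:R * e.
  apply: (@coreprod_near R n n) (leqnn n) _ => i hi; have [h1 h2] := hcl i hi.
  have [_ h3] := uF i hi; have [_ h4] := uF0 i hi.
  by split; [exact: h3|exact: h4|exact: h2].
have hC' : fnorm (adj (prodC n F) - adj (prodC n F0)) <= n%:R * e.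
  by rewrite -adjB fnorm_adj; exact: hC.
have ne0 : 0 <= n%:R * e by rewrite mulr_ge0.
have hr0 : b^-1 <= normc (rho n F0).
  have h := le_trans (stores_rho st) (ler_wpM2l (normc_ge0 _) hv).
  by rewrite -(ler_pM2r b0) mulVf // gt_eqF.
have hr2 : (2 * b)^-1 = b^-1 / 2 by rewrite invfM mulrC.
have hne : n%:R * e <= b^-1 / 2.
  rewrite -hr2 -(ler_pM2l (_ : 0 < 2 * b)); last by rewrite mulr_gt0.
  by rewrite mulfV // gt_eqF // mulr_gt0.
have hr : (2 * b)^-1 <= normc (rho n F).
  have h1 : normc (rho n F0 - rho n F) <= n%:R * e.
    have := entry_fnorm (adj (prodC n F) - adj (prodC n F0)) ord_max ord0.
    by rewrite addmxE oppmxE normcB => h2; exact: le_trans h2 hC'.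
  have := le_normcD (rho n F0 - rho n F) (rho n F); rewrite subrK.
  by move: h1 hr0 hne; rewrite hr2; move: (b^-1) (n%:R * e); nlra.
split; [exact: uF|exact: hr|].
rewrite -[spikemx l v]hF0 !factor_mx_ext -mulmxBl -mulmxBr; apply: le_trans (fnorm_compress _) _.
have -> : 32 * n%:R * e * b ^+ 2 = 4 * (2 * (n%:R * e)) / (2 * b)^-1 ^+ 2.
  by rewrite -exprVn invrK exprMn; ring.
have uA0 : adj (prodC n F0) \is unitarymx by rewrite adj_unitary; exact: uC0.
have uA : adj (prodC n F) \is unitarymx by rewrite adj_unitary; exact: uC.
apply: extfactor_near.
- rewrite invr_gt0 mulr_gt0 //= invf_le1 ?mulr_gt0 //.
  by apply: le_trans b1 _; rewrite ler_peMl ?(ltW b0) // ler1n.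
- rewrite mul_delta_col; apply: le_trans hr0; rewrite hr2.
  by rewrite ler_pdivrMr // ler_peMr ?invr_ge0 ?(ltW b0) // ler1n.
- rewrite mul_delta_col; exact: hr.
- by rewrite (fnorm_unitaryl _ uA0) fnorm_delta.
- by rewrite (fnorm_row_unitary _ (mul_unitarymx uA uB)).
- rewrite -mulmxBl; apply: le_trans (fnormM _ _) _; rewrite fnorm_delta mulr1.
  by apply: le_trans hC' _; rewrite ler_peMl // ler1n.
move: hC' hB uA0 uB; move: (adj (prodC n F)) (adj (prodC n F0)) (prodB n F) (prodB n F0).
move=> K K0 B B0 hK hB uK uB; have -> : K *m B - K0 *m B0 = (K - K0) *m B + K0 *m (B - B0).
  by rewrite mulmxBl mulmxBr; mxabel.
apply: le_trans (fnormD _ _) _; rewrite (fnorm_unitaryl _ uK) (fnorm_unitaryr _ uB).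
by apply: le_trans (lerD hK hB) _; rewrite mulrDl mul1r.
Qed.

End Triangular.

(** * Factored matrices up to unitary gauge *)

Section Words.
Variable R : realType.
Local Notation C := R[i].
Variable n : nat.
Implicit Types (A : factor R) (F G H : 'M[C]_2) (w x y : seq (letter R)) (q r e g : R).
Implicit Types (l : seq 'M[C]_n).

Definition letter_mx (a : letter R) : 'M[C]_n :=
  match a with Core i G => core n i G | Tri A => factor_mx n A end.

Definition word_mx w : 'M[C]_n := lprod (map letter_mx w).

Definition letter_ok r (a : letter R) : Prop :=
  match a with
  | Core i G => (i.+1 < n)%N /\ G \is unitarymx
  | Tri A => unitary_factor n A /\ r <= normc (rho n A)
  end.

Fixpoint word_ok r w : Prop :=
  if w is a :: w' then letter_ok r a /\ word_ok r w' else True.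

Definition state_ok r (s : state R) := word_ok r s.1 /\ word_ok r [seq Tri A | A <- s.2].

Lemma word_ok_cat r x y : word_ok r (x ++ y) <-> word_ok r x /\ word_ok r y.
Proof.
elim: x => [|a x IH] /=; first by split=> [|[]].
by split=> [[ha /IH[hx hy]]|[[ha hx] hy]]; split=> //; apply/IH.
Qed.

Lemma letter_ok_le r r' a : r' <= r -> letter_ok r a -> letter_ok r' a.
Proof. by case: a => [i G|A] //= h [hA]; split=> //; apply: le_trans h _. Qed.

Lemma word_ok_le r r' w : r' <= r -> word_ok r w -> word_ok r' w.
Proof.
move=> h; elim: w => [|a w IH] //= [ha /IH hw]; split; [exact: letter_ok_le ha|exact: hw].
Qed.

(* A word of cores and triangular factors, cut before each triangular factor. *)
Fixpoint blocks w : 'M[C]_n * seq 'M[C]_n :=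
  match w with
  | [::] => (1%:M, [::])
  | Core i G :: w' => (core n i G *m (blocks w').1, (blocks w').2)
  | Tri A :: w' => (1%:M, (factor_mx n A *m (blocks w').1) :: (blocks w').2)
  end.

Definition blockseq w := (blocks w).1 :: (blocks w).2.

Lemma lprod_blockseq w : lprod (blockseq w) = word_mx w.
Proof.
rewrite /blockseq /word_mx; elim: w => [|[i G|A] w IH] /=; first by rewrite mul1mx.
  by rewrite -IH /= mulmxA.
by rewrite -IH /= mul1mx mulmxA.
Qed.

Lemma blocks_unitary r w : word_ok r w -> (blocks w).1 \is unitarymx.
Proof.
elim: w => [_|[i G|A] w IH /=]; first exact: unitary1.
  move=> [[hi hG] /IH hw]; apply: mul_unitarymx; last exact: hw.
  exact: core_unitary hi hG.
by move=> _; exact: unitary1.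
Qed.

(* The factors of l' are those of l up to unitary matrices inserted between
   them, Z and Z' being inserted at the ends, and up to errors g. *)
Fixpoint gauge g (Z : 'M[C]_n) l l' (Z' : 'M[C]_n) : Prop :=
  match l, l' with
  | [::], [::] => Z' = Z
  | A :: l1, A' :: l1' => exists Y : 'M[C]_n,
      [/\ Y \is unitarymx, fnorm (Z *m A' - A *m Y) <= g & gauge g Y l1 l1' Z']
  | _, _ => False
  end.

Lemma gauge_unitary g Z l l' Z' : gauge g Z l l' Z' -> Z \is unitarymx -> Z' \is unitarymx.
Proof.
elim: l l' Z => [|A l IH] [|A' l'] Z /=; [by move=> -> uZ; exact: uZ|case|case|].
by move=> [Y [uY _ hY]] _; exact: IH hY uY.
Qed.

Lemma gauge_refl g l : 0 <= g -> gauge g 1%:M l l 1%:M.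
Proof.
move=> g0; elim: l => [|A l IH] //=; exists 1%:M; split; [exact: unitary1| |exact: IH].
by rewrite mul1mx mulmx1 subrr fnorm0.
Qed.

(** The inserted matrices multiply, and since they are unitary they do not amplify the errors, which
    simply add. *)
Lemma gauge_trans g1 g2 Z1 Z2 l l' l'' Z1' Z2' : Z1 \is unitarymx ->
  gauge g1 Z1 l l' Z1' -> gauge g2 Z2 l' l'' Z2' ->
  gauge (g1 + g2) (Z1 *m Z2) l l'' (Z1' *m Z2').
Proof.
elim: l l' l'' Z1 Z2 => [|A l IH] [|A' l'] [|A'' l''] Z1 Z2 uZ /=;
  try solve [by case | by move=> _ []]; first by move=> -> ->.
move=> [Y [uY hA hY]] [Y2 [uY2 hA2 hY2]]; exists (Y *m Y2).
split; [exact: mul_unitarymx uY uY2| |exact: IH uY hY hY2].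
have -> : Z1 *m Z2 *m A'' - A *m (Y *m Y2) =
   Z1 *m (Z2 *m A'' - A' *m Y2) + (Z1 *m A' - A *m Y) *m Y2.
  by rewrite mulmxBr mulmxBl !mulmxA addrA subrK.
apply: le_trans (fnormD _ _) _; rewrite (fnorm_unitaryl _ uZ) (fnorm_unitaryr _ uY2).
by rewrite addrC lerD.
Qed.

(** Each factor [A'] is replaced by [Z A' adj Y], with the gauges on its two sides; the inner gauges
    cancel in the product. *)
Lemma gauge_prod g Z l l' Z' : gauge g Z l l' Z' -> Z \is unitarymx ->
  exists2 l2, near g l l2 & lprod l2 = Z *m lprod l' *m adj Z'.
Proof.
elim: l l' Z => [|A l IH] [|A' l'] Z /=; [|case|case|].
  move=> -> uZ; exists [::]; first by []; rewrite /= mulmx1 unitary_mul_adj; [by []|exact: uZ].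
move=> [Y [uY hA hY]] uZ; have [l2 h2 E2] := IH _ _ hY uY.
exists (Z *m A' *m adj Y :: l2); rewrite /=.
  split; last exact: h2; rewrite -(fnorm_unitaryr _ uY) mulmxBl -!mulmxA.
  rewrite (unitary_adj_mul uY) mulmx1; exact: hA.
by rewrite E2 !mulmxA -[_ *m adj Y *m Y]mulmxA (unitary_adj_mul uY) mulmx1.
Qed.

Lemma gauge_size g Z l l' Z' : gauge g Z l l' Z' -> size l' = size l.
Proof. by elim: l l' Z => [|A l IH] [|A' l'] Z //= [Y [_ _ /IH ->]]. Qed.

(** The head block is still open on the left and has its own bound [e]. Prepending a core keeps this
    bound; prepending a triangular factor closes the block and multiplies its error by the norm of
    that factor, which [g] has to cover. *)
Definition close e g w w' := exists Y : 'M[C]_n,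
  [/\ Y \is unitarymx, fnorm ((blocks w').1 - (blocks w).1 *m Y) <= e &
      gauge g Y (blocks w).2 (blocks w').2 1%:M].

Lemma close_gauge e g w w' : e <= g -> close e g w w' ->
  gauge g 1%:M (blockseq w) (blockseq w') 1%:M.
Proof.
move=> eg [Y [uY hY hg]] /=; exists Y; split; [exact: uY| |exact: hg].
by rewrite mul1mx; exact: le_trans hY eg.
Qed.

Lemma factor_mx_le r A : 0 < r -> unitary_factor n A -> r <= normc (rho n A) ->
  fnorm (factor_mx n A) <= n.+1%:R + r^-1.
Proof.
move=> r0 uA hr; rewrite factor_mx_ext; apply: le_trans (fnorm_compress _) _.
have uC : adj (prodC n A) \is unitarymx by rewrite adj_unitary; exact: prodC_unitary.
apply: extfactor_le r0 _ _ _; first by rewrite mul_delta_col.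
  by rewrite (fnorm_unitaryl _ uC) fnorm_delta.
exact: mul_unitarymx uC (prodB_unitary uA).
Qed.

Lemma close_cons r e g a w w' : 0 < r -> 0 <= e -> (n.+1%:R + r^-1) * e <= g ->
  letter_ok r a -> close e g w w' -> close e g (a :: w) (a :: w').
Proof.
move=> r0 e0 hg; case: a => [i G [hi uG]|A [uA hA]] [Y [uY hY hl]].
  exists Y; split; [exact: uY| |exact: hl]; rewrite /= -mulmxA -mulmxBr.
  by rewrite (fnorm_unitaryl _ (core_unitary hi uG)).
exists 1%:M; split; first exact: unitary1.
  by rewrite /= mulmx1 subrr fnorm0.
exists Y; split; [exact: uY| |exact: hl].
rewrite mul1mx -mulmxA -mulmxBr; apply: le_trans (fnormM _ _) _; apply: le_trans hg.
by apply: ler_pM; rewrite ?fnorm_ge0 ?(factor_mx_le r0 uA).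
Qed.

Lemma close_cat r e g x w w' : 0 < r -> 0 <= e -> (n.+1%:R + r^-1) * e <= g ->
  word_ok r x -> close e g w w' -> close e g (x ++ w) (x ++ w').
Proof.
move=> r0 e0 hg; elim: x => //= a x IH [ha /IH hx] hw.
exact: close_cons ha (hx hw).
Qed.

Lemma close_heads e g w w' : 0 <= g -> (blocks w').2 = (blocks w).2 ->
  fnorm ((blocks w').1 - (blocks w).1) <= e -> close e g w w'.
Proof.
move=> g0 E h; exists 1%:M; split; [exact: unitary1|by rewrite mulmx1|].
by rewrite E; exact: gauge_refl.
Qed.

Lemma pass_left_block g (K K' X X' h : 'M[C]_n) : fnorm (K' *m X' - X *m K) <= g ->
  h \is unitarymx -> fnorm (K' *m (X' *m h) - X *m (K *m h)) <= g.
Proof. by move=> hg uh; rewrite !mulmxA -mulmxBl (fnorm_unitaryr _ uh). Qed.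

Lemma pass_right_block g (K K' X X' h : 'M[C]_n) : fnorm (X' *m K' - K *m X) <= g ->
  K \is unitarymx -> h \is unitarymx ->
  fnorm (adj K *m (X' *m (K' *m h)) - X *m h) <= g.
Proof.
move=> hg uK uh; have uK' : adj K \is unitarymx by rewrite adj_unitary; exact: uK.
by rewrite (fnorm_gauge _ _ uK') adjK !mulmxA -mulmxBl (fnorm_unitaryr _ uh); exact: hg.
Qed.

(** The core that crosses the cut before the triangular factor becomes the gauge at this cut.
    Without gauges the two sequences of blocks would not be close. *)
Lemma close_pass_left e g i A A' G G' y : 0 <= e -> 0 <= g ->
  (blocks y).1 \is unitarymx -> core n i G' \is unitarymx ->
  fnorm (core n i G' *m factor_mx n A' - factor_mx n A *m core n i G) <= g ->
  close e g [:: Tri A, Core i G & y] [:: Core i G', Tri A' & y].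
Proof.
move=> e0 g0 uy uK h; exists (core n i G'); split; first exact: uK.
  by rewrite /= mulmx1 mul1mx subrr fnorm0.
exists 1%:M; split; [exact: unitary1| |exact: gauge_refl].
by rewrite mulmx1; move: h uy; exact: pass_left_block.
Qed.

Lemma close_pass_right e g i A A' G G' y : 0 <= e -> 0 <= g ->
  (blocks y).1 \is unitarymx -> core n i G \is unitarymx ->
  fnorm (factor_mx n A' *m core n i G' - core n i G *m factor_mx n A) <= g ->
  close e g [:: Core i G, Tri A & y] [:: Tri A', Core i G' & y].
Proof.
move=> e0 g0 uy uK h; have uK' : adj (core n i G) \is unitarymx by rewrite adj_unitary; exact: uK.
exists (adj (core n i G)); split; first exact: uK'.
  by rewrite /= mulmx1 unitary_mul_adj // subrr fnorm0.
exists 1%:M; split; [exact: unitary1| |exact: gauge_refl].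
by rewrite mulmx1; move: h uK uy; exact: pass_right_block.
Qed.

(* The same Z and Z' serve S and T: the pencil undergoes a unitary equivalence. *)
Definition linked g (s s' : state R) := exists Z Z' : 'M[C]_n,
  [/\ Z \is unitarymx, gauge g Z (blockseq s.1) (blockseq s'.1) Z' &
      gauge g Z (map (factor_mx n) s.2) (map (factor_mx n) s'.2) Z'].

Lemma linked_close e g w w' Ts : e <= g -> 0 <= g -> close e g w w' ->
  linked g (w, Ts) (w', Ts).
Proof.
move=> eg g0 h; exists 1%:M, 1%:M; split; [exact: unitary1|exact: close_gauge h|].
exact: gauge_refl.
Qed.

Lemma linked_trans g1 g2 s s' s'' :
  linked g1 s s' -> linked g2 s' s'' -> linked (g1 + g2) s s''.
Proof.
move=> [Z [Z' [uZ hS hT]]] [Y [Y' [uY hS' hT']]]; exists (Z *m Y), (Z' *m Y').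
by split; [exact: mul_unitarymx uZ uY|exact: gauge_trans uZ hS hS'|exact: gauge_trans uZ hT hT'].
Qed.

(** A core appended at the right end multiplies the last block exactly, so it is accounted for by
    the end gauge and produces no error. *)
Lemma gauge_rcons g w i G : 0 <= g -> (i.+1 < n)%N -> G \is unitarymx ->
  gauge g 1%:M (blockseq w) (blockseq (rcons w (Core i G))) (core n i G).
Proof.
move=> g0 hi uG; have uK := core_unitary hi uG.
suff : exists Y : 'M[C]_n, [/\ Y \is unitarymx,
    (blocks (rcons w (Core i G))).1 = (blocks w).1 *m Y &
    gauge g Y (blocks w).2 (blocks (rcons w (Core i G))).2 (core n i G)].
  move=> [Y [uY E hY]]; exists Y; split; [exact: uY| |exact: hY].
  by rewrite mul1mx E subrr fnorm0.
elim: w => [|[j H|A] w [Y [uY E hY]]] /=.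
- by exists (core n i G); split; [exact: uK|rewrite mulmx1 mul1mx|].
- by exists Y; split; [exact: uY|rewrite E mulmxA|exact: hY].
exists 1%:M; split; [exact: unitary1|by rewrite mulmx1|].
exists Y; split; [exact: uY| |exact: hY].
by rewrite mul1mx E mulmxA subrr fnorm0.
Qed.

(** * Effect of a single operation on the factors *)

Section Operations.
Variables (r e g : R).
Hypotheses (hr : 0 < r <= 1) (e0 : 0 <= e) (eg : e <= g)
  (hgA : (n.+1%:R + r^-1) * e <= g) (hgP : 8 * e / r ^+ 2 <= g).

Let r0 : 0 < r. Proof. by case/andP: hr. Qed.
Let g0 : 0 <= g. Proof. exact: le_trans e0 eg. Qed.

(** Each factor of [T] is passed exactly once, so each [rho] loses only [e] although there are as
    many pass-throughs as factors. The intermediate cores are the gauges between consecutive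
    factors. *)
Lemma pass_allP (q : R) i G Ts Ts' G' : r + e <= q -> (i.+1 < n)%N -> G \is unitarymx ->
  word_ok q [seq Tri A | A <- Ts] -> pass_all e i G Ts Ts' G' ->
  [/\ word_ok (q - e) [seq Tri A | A <- Ts'], G' \is unitarymx &
      gauge g (adj (core n i G)) (map (factor_mx n) Ts) (map (factor_mx n) Ts')
        (adj (core n i G'))].
Proof.
move=> hq hi; elim: Ts Ts' G => [|A Ts IH] [|A' Ts'] G uG /=.
- by move=> _ ->; split; [by []|exact: uG|].
- by move=> _ [].
- by move=> _ [].
move=> [[uA hA] hTs] [X hp hall].
have [uA' uX] := pass_right_unitary hi uA hp.
have [h1 h2] := pass_rightP hi hr uG uA (le_trans hq hA) hp.
have [ok uG' hg] := IH _ _ uX hTs hall.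
split; [split; [split; [exact: uA'|]|exact: ok]|exact: uG'|].
  by apply: le_trans h1; rewrite lerD2r.
have uK := core_unitary hi uG; have uKX := core_unitary hi uX.
exists (adj (core n i X)); split; [by rewrite adj_unitary; exact: uKX| |exact: hg].
by rewrite (fnorm_adj_gauge _ _ uKX uK); exact: le_trans h2 hgP.
Qed.

Lemma close_linked x w w' Ts : word_ok r x -> close e g w w' ->
  linked g (x ++ w, Ts) (x ++ w', Ts).
Proof.
by move=> hx hw; apply: (linked_close Ts eg g0); exact: close_cat r0 e0 hgA hx hw.
Qed.

Definition step_ok (q : R) (s s' : state R) := state_ok (q - e) s' /\ linked g s s'.

Lemma step_close (q : R) x a b y Ts : r + e <= q ->
  state_ok q (x ++ a ++ y, Ts) -> word_ok (q - e) b -> close e g (a ++ y) (b ++ y) ->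
  step_ok q (x ++ a ++ y, Ts) (x ++ b ++ y, Ts).
Proof.
move=> hq [/= /word_ok_cat[hx /word_ok_cat[ha hy]] hTs] hb hab.
have qe : q - e <= q by rewrite gerBl.
have rq : r <= q by apply: le_trans hq; rewrite lerDl.
split; first split=> /=.
- apply/word_ok_cat; split; first exact: word_ok_le qe hx.
  by apply/word_ok_cat; split; [exact: hb|exact: word_ok_le qe hy].
- exact: word_ok_le qe hTs.
exact: close_linked (word_ok_le rq hx) hab.
Qed.

Lemma step_cores (q : R) x a b y Ts (K K' : 'M[C]_n) : r + e <= q ->
  state_ok q (x ++ a ++ y, Ts) -> word_ok (q - e) b ->
  blocks (a ++ y) = (K *m (blocks y).1, (blocks y).2) ->
  blocks (b ++ y) = (K' *m (blocks y).1, (blocks y).2) ->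
  fnorm (K' - K) <= e -> step_ok q (x ++ a ++ y, Ts) (x ++ b ++ y, Ts).
Proof.
move=> hq hs hb Ea Eb hK; apply: step_close => //.
have [/= /word_ok_cat[_ /word_ok_cat[_ hy]] _] := hs.
apply: close_heads g0 _ _; rewrite Ea Eb //=.
by rewrite -mulmxBl (fnorm_unitaryr _ (blocks_unitary hy)).
Qed.

Lemma word_ok_rcons (q : R) w a : word_ok q w -> letter_ok q a -> word_ok q (rcons w a).
Proof. by move=> hw ha; rewrite -cats1; apply/word_ok_cat. Qed.

(** The core removed on the left of [S] is the left gauge and the core appended on the right is the
    right gauge. By [pass_allP] the same pair relates the old and new factors of [T]. *)
Lemma step_similarity (q : R) w i G G' Ts Ts' : r + e <= q ->
  pass_all e i (adj G) Ts Ts' G' -> state_ok q (Core i G :: w, Ts) ->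
  step_ok q (Core i G :: w, Ts) (rcons w (Core i (adj G')), Ts').
Proof.
move=> hq hp [/= [[hi uG] hw] hTs].
have uaG : adj G \is unitarymx by rewrite adj_unitary; exact: uG.
have [hTs' uG' hT] := pass_allP hq hi uaG hTs hp.
have uaG' : adj G' \is unitarymx by rewrite adj_unitary; exact: uG'.
have qe : q - e <= q by rewrite gerBl.
split; first split=> /=.
- by apply: word_ok_rcons; [exact: word_ok_le qe hw|split; [exact: hi|exact: uaG']].
- exact: hTs'.
have uK := core_unitary hi uG.
exists (core n i G), (core n i (adj G')); split; first exact: uK.
  have [Y [uY hY hg]] := gauge_rcons w g0 hi uaG'.
  exists Y; split; [exact: uY| |exact: hg]; rewrite /= -mulmxA -mulmxBr.
  by rewrite (fnorm_unitaryl _ uK) -[_.1 in X in X - _]mul1mx; exact: hY.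
by move: hT; rewrite !adj_core // adjK.
Qed.

Lemma op_ok (q : R) s s' : r + e <= q -> op n e s s' -> state_ok q s -> step_ok q s s'.
Proof.
move=> hq; case=> [x y i j F G Ts hij|x y i Ts hi|x y i Ts|x y i F G H Ts uH he
  |x y i F G H F' G' H' Ts ht|x y i F G H F' G' H' Ts ht|x y i A G G' A' Ts hp
  |x y i G A A' G' Ts hp|w i G G' Ts Ts' hp] hs; last exact: step_similarity.
- have [/= /word_ok_cat[_ [[hi uF] [[hj uG] _]]] _] := hs.
  apply: (@step_cores q x _ [:: Core j G; Core i F] y Ts
    (core n i F *m core n j G) (core n j G *m core n i F) hq hs).
  + by split; [split; [exact: hj|exact: uG]|split; [split; [exact: hi|exact: uF]|]].
  + by rewrite /= mulmxA.
  + by rewrite /= mulmxA.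
  + by rewrite (core_comm F G hi hj hij) subrr fnorm0.
- apply: (@step_cores q x [::] [:: Core i 1%:M] y Ts 1%:M 1%:M hq hs).
  + by split; [split; [exact: hi|exact: unitary1]|].
  + by rewrite /= mul1mx; case: (blocks y).
  + by rewrite /= core1.
  + by rewrite subrr fnorm0.
- apply: (@step_cores q x [:: Core i 1%:M] [::] y Ts 1%:M 1%:M hq hs) => //.
  + by rewrite /= core1.
  + by rewrite /= mul1mx; case: (blocks y).
  + by rewrite subrr fnorm0.
- have [/= /word_ok_cat[_ [[hi uF] _]] _] := hs.
  apply: (@step_cores q x _ [:: Core i H] y Ts
    (core n i F *m core n i G) (core n i H) hq hs).
  + by split; [split; [exact: hi|exact: uH]|].
  + by rewrite /= mulmxA.
  + by [].
  + by rewrite coreM // fnorm_coreB.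
- have [uF' uG' uH' _] := ht; have [/= /word_ok_cat[_ [[hi _] [[hj _] _]]] _] := hs.
  apply: (@step_cores q x _ [:: Core i.+1 F'; Core i G'; Core i.+1 H'] y Ts
    (core n i F *m core n i.+1 G *m core n i H)
    (core n i.+1 F' *m core n i G' *m core n i.+1 H') hq hs).
  + by split; [split; [exact: hj|exact: uF']|split; [split; [exact: hi|exact: uG']|
      split; [split; [exact: hj|exact: uH']|]]].
  + by rewrite /= !mulmxA.
  + by rewrite /= !mulmxA.
  + exact: turnover_down_core hj ht.
- have [uF' uG' uH' _] := ht; have [/= /word_ok_cat[_ [[hj _] [[hi _] _]]] _] := hs.
  apply: (@step_cores q x _ [:: Core i F'; Core i.+1 G'; Core i H'] y Ts
    (core n i.+1 F *m core n i G *m core n i.+1 H)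
    (core n i F' *m core n i.+1 G' *m core n i H') hq hs).
  + by split; [split; [exact: hi|exact: uF']|split; [split; [exact: hj|exact: uG']|
      split; [split; [exact: hi|exact: uH']|]]].
  + by rewrite /= !mulmxA.
  + by rewrite /= !mulmxA.
  + exact: turnover_up_core hj ht.
- have [/= /word_ok_cat[_ [[uA hA] [[hi uG] hy]]] _] := hs.
  have [uA' uG'] := pass_left_unitary hi uA hp.
  have [h1 h2] := pass_leftP hi hr uA (le_trans hq hA) hp.
  apply: (@step_close q x _ [:: Core i G'; Tri A'] y Ts hq hs).
    split; [split; [exact: hi|exact: uG']|split; [split; [exact: uA'|]|by []]].
    by apply: le_trans h1; rewrite lerD2r.
  exact: close_pass_left e0 g0 (blocks_unitary hy) (core_unitary hi uG') (le_trans h2 hgP).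
- have [/= /word_ok_cat[_ [[hi uG] [[uA hA] hy]]] _] := hs.
  have [uA' uG'] := pass_right_unitary hi uA hp.
  have [h1 h2] := pass_rightP hi hr uG uA (le_trans hq hA) hp.
  apply: (@step_close q x _ [:: Tri A'; Core i G'] y Ts hq hs).
    split; [split; [exact: uA'|]|split; [split; [exact: hi|exact: uG']|by []]].
    by apply: le_trans h1; rewrite lerD2r.
  exact: close_pass_right e0 g0 (blocks_unitary hy) (core_unitary hi uG) (le_trans h2 hgP).
Qed.

Lemma start_chase_ok (q : R) s s' : r + e <= q -> start_chase n e s s' ->
  state_ok q s -> step_ok q s s'.
Proof.
move=> hq; case=> w i F G' Ts Ts' hi uF hp [/= hw hTs].
have uaF : adj F \is unitarymx by rewrite adj_unitary; exact: uF.
have [hTs' uG' hT] := pass_allP hq hi uaF hTs hp.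
have uaG' : adj G' \is unitarymx by rewrite adj_unitary; exact: uG'.
have qe : q - e <= q by rewrite gerBl.
split; first split=> /=.
- split; first by split; [exact: hi|exact: uaF].
  by apply: word_ok_rcons; [exact: word_ok_le qe hw|split; [exact: hi|exact: uaG']].
- exact: hTs'.
have uK := core_unitary hi uF.
exists (core n i F), (core n i (adj G')); split; first exact: uK.
  have [Y [uY hY hg]] := gauge_rcons w g0 hi uaG'.
  exists Y; split; [exact: uY| |exact: hg]; rewrite /= -adj_core // mulmxA.
  by rewrite (unitary_mul_adj uK); exact: hY.
by move: hT; rewrite !adj_core // adjK.
Qed.

Lemma deflation_ok (q : R) s s' : r + e <= q -> deflation n e s s' ->
  state_ok q s -> step_ok q s s'.
Proof.
move=> hq; case=> h h' Rs Ts i hi uh _ hd hE hs.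
have Ew (f : nat -> 'M[C]_2) : hess_word n f Rs = [seq Core j (f j) | j <- iota 0 i]
   ++ [:: Core i (f i)] ++ ([seq Core j (f j) | j <- iota i.+1 (n.-1 - i.+1)]
   ++ [seq Tri A | A <- Rs]).
  have En : n.-1 = (i + (1 + (n.-1 - i.+1)))%N by move: hi; clear; lia.
  by rewrite /hess_word {1}En !iotaD /= !map_cat /= addn1 add0n -!catA.
have E1 : [seq Core j (h' j) | j <- iota 0 i] = [seq Core j (h j) | j <- iota 0 i].
  apply/eq_in_map => j; rewrite mem_iota => hj; rewrite hE //.
  by move: hj; clear; lia.
have E2 : [seq Core j (h' j) | j <- iota i.+1 (n.-1 - i.+1)] =
          [seq Core j (h j) | j <- iota i.+1 (n.-1 - i.+1)].
  apply/eq_in_map => j; rewrite mem_iota => hj; rewrite hE //.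
  by move: hj; clear; lia.
rewrite !Ew E1 E2 in hs *; have hin : (i.+1 < n)%N by move: hi; clear; lia.
apply: (@step_cores q _ [:: Core i (h i)] [:: Core i (h' i)] _ Ts
  (core n i (h i)) (core n i (h' i)) hq hs).
- by split; [split; [exact: hin|exact: uh]|].
- by [].
- by [].
- by rewrite fnorm_coreB.
Qed.

End Operations.

Section Runs.
Variables (r e g : R).
Hypotheses (hr : 0 < r <= 1) (e0 : 0 <= e) (eg : e <= g)
  (hgA : (n.+1%:R + r^-1) * e <= g) (hgP : 8 * e / r ^+ 2 <= g).

Lemma linked_refl s : linked 0 s s.
Proof. by exists 1%:M, 1%:M; split; [exact: unitary1|exact: gauge_refl|exact: gauge_refl]. Qed.

(** Here [q] bounds the moduli of all [rho] from below; it must leave room for [m] losses of size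
    [e] above the floor [r], for which the bounds of a single operation are valid. *)
Definition run_ok m (s s' : state R) := forall q, r + m%:R * e <= q ->
  state_ok q s -> state_ok (q - m%:R * e) s' /\ linked (m%:R * g) s s'.

Lemma run_ok0 s : run_ok 0 s s.
Proof. by move=> q _ hs; rewrite !mul0r subr0; split; [exact: hs|exact: linked_refl]. Qed.

Lemma run_ok_trans m1 m2 s s' s'' :
  run_ok m1 s s' -> run_ok m2 s' s'' -> run_ok (m1 + m2) s s''.
Proof.
move=> h1 h2 q hq hs; rewrite natrD !mulrDl in hq *.
have m2e : 0 <= m2%:R * e by rewrite mulr_ge0.
have [|hs' l1] := h1 q _ hs; first by apply: le_trans hq; rewrite lerD2l lerDl.
have [|hs'' l2] := h2 _ _ hs'; first by rewrite lerBrDr -addrA [m2%:R * e + _]addrC.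
by rewrite opprD addrA; split; [exact: hs''|exact: linked_trans l1 l2].
Qed.

Lemma run_ok1 s s' : (forall q, r + e <= q -> state_ok q s -> step_ok e g q s s') ->
  run_ok 1 s s'.
Proof. by move=> h q; rewrite !mul1r => hq hs; exact: h hq hs. Qed.

Lemma nsteps_run_ok (rel : state R -> state R -> Prop) m s s' :
  (forall q s s', r + e <= q -> rel s s' -> state_ok q s -> step_ok e g q s s') ->
  nsteps rel m s s' -> run_ok m s s'.
Proof.
move=> hrel; elim=> [s1|m1 s1 s2 s3 h12 _ IH]; first exact: run_ok0.
rewrite -add1n; apply: run_ok_trans IH; apply: run_ok1 => q hq hs.
exact: hrel hq h12 hs.
Qed.

Lemma qr_iteration_run_ok m s s' : qr_iteration n e m s s' -> run_ok m s s'.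
Proof.
elim=> [s1|j m1 m2 s1 s2 s3 s4 h12 h23 _ _ IH|m1 s1 s2 s3 h12 _ IH].
- exact: run_ok0.
- apply: run_ok_trans IH; apply: run_ok_trans.
    by apply: nsteps_run_ok h12 => q t t'; exact: start_chase_ok.
  by apply: nsteps_run_ok h23 => q t t'; exact: op_ok.
- rewrite -add1n; apply: run_ok_trans IH; apply: run_ok1 => q hq hs.
  exact: (deflation_ok hr e0 eg hgA hq h12 hs).
Qed.

Lemma algorithm_run_ok m m' s0 s1 s2 : nsteps (op n e) m s0 s1 ->
  qr_iteration n e m' s1 s2 -> run_ok (m + m') s0 s2.
Proof.
move=> h01 h12; apply: run_ok_trans (qr_iteration_run_ok h12).
by apply: nsteps_run_ok h01 => q t t'; exact: op_ok.
Qed.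

End Runs.


End Words.

(** * Block companion pencils *)

Section BlockShift.
Variable R : realType.
Local Notation C := R[i].

(** Each column contains at most one 1, so the squared norm is at most [n], hence at most
    [n ^ 2]. *)
Lemma fnorm_boolmx m n (f : 'I_m -> 'I_n -> bool) :
  (forall a a' b, f a b -> f a' b -> a = a') ->
  fnorm (\matrix_(a, b) (f a b)%:R : 'M[C]_(m, n)) <= n%:R.
Proof.
move=> inj_f; apply: fnorm_le; first exact: ler0n.
apply: le_trans (sqr_natr_ge R n); rewrite /fnorm2 exchange_big /=.
have -> : n%:R = \sum_(j < n) (1 : R) by rewrite sumr_const card_ord.
apply: ler_sum => b _; have [/existsP[a fa]|/existsPn h] := boolP [exists a, f a b].
  rewrite (bigD1 a) //= mxE fa normc1 expr1n big1 ?addr0 // => a' ha'.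
  rewrite mxE; case fa' : (f a' b); last by rewrite normc0 expr0n.
  by rewrite (inj_f _ _ _ fa fa') eqxx in ha'.
by rewrite big1 // => a _; rewrite mxE (negbTE (h a)) normc0 expr0n.
Qed.

Variables d k : nat.
Local Notation n := (d * k)%N.

(** The [j]-th power of the nilpotent block downshift; its transpose moves blocks up by [j]. *)
Definition bshift j : 'M[C]_n := \matrix_(a, b) (a == (b + j * k)%N :> nat)%:R.

Definition firstD : 'M[C]_n := \matrix_(a, b) ((a == b) && (b < d.-1 * k)%N)%:R.
Definition lastD : 'M[C]_n := \matrix_(a, b) ((a == b) && (d.-1 * k <= b)%N)%:R.

Local Notation N := (bshift 1).
Local Notation D := firstD.
Local Notation P := lastD.

Lemma boolmx_mul m p q (f : 'I_m -> 'I_p -> bool) (h : 'I_p -> 'I_q -> bool) a b :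
  (forall c c', f a c && h c b -> f a c' && h c' b -> c = c') ->
  ((\matrix_(a, c) (f a c)%:R : 'M[C]__) *m (\matrix_(c, b) (h c b)%:R : 'M[C]__)) a b
   = [exists c, f a c && h c b]%:R.
Proof.
move=> hu; rewrite mxE; under eq_bigr do rewrite !mxE -natrM mulnb.
have [/existsP[c hc]|/existsPn h0] := boolP [exists c, f a c && h c b].
  rewrite (bigD1 c) //= hc big1 ?addr0 // => c' hc'.
  case h' : (f a c' && h c' b) => //.
  by rewrite (hu _ _ hc h') eqxx in hc'.
by rewrite big1 // => c _; rewrite (negbTE (h0 c)).
Qed.

Lemma bshift_tr j : (bshift j)^T = \matrix_(a, b) (b == (a + j * k)%N :> nat)%:R.
Proof. by apply/matrixP => a b; rewrite !mxE. Qed.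

Lemma bshift0 : bshift 0 = 1%:M.
Proof. by apply/matrixP => a b; rewrite !mxE mul0n addn0. Qed.

Lemma bshift_ge j : (d <= j)%N -> bshift j = 0.
Proof.
move=> h; apply/matrixP => a b; rewrite !mxE; case: eqP => // E.
have := ltn_ord a; rewrite E; have : (d * k <= j * k)%N by rewrite leq_mul2r h orbT.
by lia.
Qed.

Lemma bshiftM i j : bshift i *m bshift j = bshift (i + j).
Proof.
apply/matrixP => a b; rewrite boolmx_mul => [|c c' /andP[_ /eqP h] /andP[_ /eqP h']]; last first.
  by apply: val_inj; rewrite /= h h'.
rewrite mxE; congr (nat_of_bool _)%:R; apply/existsP/eqP => [[c /andP[/eqP -> /eqP ->]]|h].
  by rewrite mulnDl; lia.
have hc : (b + j * k < n)%N by have := ltn_ord a; rewrite h mulnDl; lia.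
by exists (Ordinal hc); rewrite /= h eqxx andbT mulnDl; apply/eqP; lia.
Qed.

Lemma bshift_trM i j : (bshift i)^T *m (bshift j)^T = (bshift (i + j))^T.
Proof. by rewrite -trmx_mul bshiftM addnC. Qed.

Lemma bshift_le j : fnorm (bshift j) <= n%:R.
Proof. by apply: fnorm_boolmx => a a' b /eqP h /eqP h'; apply: val_inj; rewrite /= h h'. Qed.

Lemma bshift_tr_le j : fnorm (bshift j)^T <= n%:R.
Proof.
rewrite bshift_tr; apply: fnorm_boolmx => a a' b /eqP h /eqP h'; apply: val_inj => /=.
by apply/eqP; rewrite -(eqn_add2r (j * k)) -h -h'.
Qed.

Lemma firstD_le : fnorm D <= n%:R.
Proof. by apply: fnorm_boolmx => a a' b /andP[/eqP -> _] /andP[/eqP -> _]. Qed.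

Lemma lastD_le : fnorm P <= n%:R.
Proof. by apply: fnorm_boolmx => a a' b /andP[/eqP -> _] /andP[/eqP -> _]. Qed.

Lemma first_last : D + P = 1%:M.
Proof.
apply/matrixP => a b; rewrite !mxE -natrD; congr (_%:R).
by case: eqP => //= _; case: ltnP.
Qed.

Lemma mulmx_firstD m (X : 'M[C]_(m, n)) a b : (X *m D) a b = if (b < d.-1 * k)%N then X a b else 0.
Proof.
rewrite mxE (bigD1 b) //= mxE eqxx /= big1 ?addr0 => [|c /negbTE hc]; last first.
  by rewrite mxE hc mulr0.
by case: ifP; rewrite ?mulr1 ?mulr0.
Qed.

Lemma mulmx_lastD m (X : 'M[C]_(m, n)) a b : (X *m P) a b = if (d.-1 * k <= b)%N then X a b else 0.
Proof.
rewrite mxE (bigD1 b) //= mxE eqxx /= big1 ?addr0 => [|c /negbTE hc]; last first.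
  by rewrite mxE hc mulr0.
by case: ifP; rewrite ?mulr1 ?mulr0.
Qed.

Lemma mul_lastD_l m (X : 'M[C]_(n, m)) a b : (P *m X) a b = if (d.-1 * k <= a)%N then X a b else 0.
Proof.
rewrite mxE (bigD1 a) //= mxE eqxx /= big1 ?addr0 => [|c /negbTE hc]; last first.
  by rewrite mxE eq_sym hc mul0r.
by case: ifP; rewrite ?mul1r ?mul0r.
Qed.

Lemma firstD_idem : D *m D = D.
Proof. by apply/matrixP => a b; rewrite mulmx_firstD !mxE; case: ltnP => //; rewrite andbF. Qed.

Lemma lastD_firstD : P *m D = 0.
Proof.
apply/matrixP => a b; rewrite mulmx_firstD !mxE; case: ltnP => //.
by rewrite andbF.
Qed.

Hypothesis d0 : (0 < d)%N.

Lemma last_start : (d.-1 * k + k)%N = n.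
Proof. by rewrite -mulSnr prednK. Qed.

Lemma bshift_firstD : N *m D = N.
Proof.
apply/matrixP => a b; rewrite mulmx_firstD mxE; case: ltnP => // hb.
by case: eqP => // E; have := ltn_ord a; have := last_start; rewrite E mul1n; lia.
Qed.

Lemma bshift_tr_bshift : N^T *m N = D.
Proof.
apply/matrixP => a b; rewrite bshift_tr boolmx_mul => [|c c' /andP[/eqP h _] /andP[/eqP h' _]].
  rewrite mxE; congr (nat_of_bool _)%:R.
  apply/existsP/andP => [[c /andP[/eqP h /eqP h']]|[/eqP -> hb]].
    have E : a = b by apply: val_inj => /=; lia.
    by rewrite E eqxx; split=> //; have := ltn_ord c; have := last_start; rewrite h' mul1n; lia.
  have hc : (b + 1 * k < n)%N by have := last_start; rewrite mul1n; lia.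
  by exists (Ordinal hc); rewrite /= eqxx.
by apply: val_inj; rewrite /= h h'.
Qed.

Lemma bshift_lastD j : (j.+1 < d)%N -> N *m (bshift j.+1)^T *m P = (bshift j)^T *m P.
Proof.
move=> hj; apply/matrixP => a b; rewrite !mulmx_lastD; case: leqP => // hb.
rewrite !bshift_tr boolmx_mul => [|c c' /andP[/eqP h _] /andP[/eqP h' _]]; last first.
  by apply: val_inj => /=; lia.
rewrite mxE; congr (nat_of_bool _)%:R.
apply/existsP/eqP => [[c /andP[/eqP h /eqP h']]|h].
  by move: h h'; rewrite mul1n mulSn => h h'; lia.
have hjk : (j * k + k <= d.-1 * k)%N by rewrite -mulSnr leq_mul2r; lia.
have hc : (a - k < n)%N by have := ltn_ord a; lia.
exists (Ordinal hc) => /=; rewrite mul1n mulSn; apply/andP; split; apply/eqP; lia.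
Qed.

Lemma bshift_lastD0 : N *m P = 0.
Proof.
have := bshift_firstD; rewrite -[X in _ = X]mulmx1 -first_last mulmxDr => E.
by apply: (addrI (N *m D)); rewrite addr0 -E.
Qed.

Lemma lastD_bshift_tr j : (0 < j)%N -> P *m (bshift j)^T = 0.
Proof.
move=> hj; apply/matrixP => a b; rewrite mul_lastD_l !mxE; case: leqP => // ha.
case: eqP => // E; have := ltn_ord b; have := last_start; rewrite E.
have : (k <= j * k)%N by rewrite leq_pmull.
by lia.
Qed.

Lemma lastD_bshift_mul s : (s < d.-1)%N -> P *m bshift s *m (bshift d.-1)^T = 0.
Proof.
move=> hs; apply/matrixP => a b; rewrite -mulmxA mul_lastD_l [RHS]mxE; case: leqP => // ha.
rewrite mxE big1 // => c _; rewrite !mxE.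
case: eqP => E1; last by rewrite mul0r.
case: eqP => E2; last by rewrite mulr0.
have := ltn_ord b; have := last_start; rewrite E2.
have : (s * k + k <= d.-1 * k)%N by rewrite -mulSnr leq_mul2r hs orbT.
by lia.
Qed.

Lemma bshift_tr_firstD : (bshift d.-1)^T *m D = 0.
Proof.
apply/matrixP => a b; rewrite mulmx_firstD !mxE; case: ltnP => // hb.
by case: eqP => // E; lia.
Qed.

(** The observability matrix of the unperturbed shift is the identity. Since [P = 1 - N^T N], the
    summands are differences of consecutive matrices [(bshift j)^T (bshift j)], and the sum
    telescopes down to the zeroth because [bshift d = 0]. *)
Lemma sum_bshift_lastD : \sum_(j < d) (bshift j)^T *m P *m bshift j = 1%:M.
Proof.
pose f j := - ((bshift j)^T *m bshift j).
have E j : (bshift j)^T *m P *m bshift j = f j.+1 - f j.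
  have -> : P = 1%:M - D by rewrite -first_last addrAC subrr add0r.
  rewrite /f opprK [RHS]addrC mulmxBr mulmxBl mulmx1; congr (_ - _).
  by rewrite -bshift_tr_bshift -[j.+1]add1n -bshiftM trmx_mul !mulmxA.
under eq_bigr do rewrite E.
rewrite -(big_mkord xpredT (fun j => f j.+1 - f j)) telescope_sumr // /f.
by rewrite opprK bshift_ge // trmx0 mul0mx oppr0 add0r bshift0 trmx1 mulmx1.
Qed.

End BlockShift.

Lemma sum_nat_recr_pred (V : nmodType) m (f : nat -> V) : (0 < m)%N ->
  \sum_(0 <= j < m) f j = \sum_(0 <= j < m.-1) f j + f m.-1.
Proof. by case: m => // m _; rewrite big_nat_recr. Qed.

Lemma sum_nat_recl_pred (V : nmodType) m (f : nat -> V) : (0 < m)%N ->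
  \sum_(0 <= j < m) f j = f 0%N + \sum_(0 <= j < m.-1) f j.+1.
Proof. by case: m => // m _; rewrite big_nat_recl. Qed.

(** * Restoring the block companion form *)

Section Restoration.
Variable R : realType.
Local Notation C := R[i].
Variables d k : nat.
Hypotheses (d0 : (0 < d)%N) (k0 : (0 < k)%N).
Local Notation n := (d * k)%N.
Local Notation bshift := (bshift R d k).
Local Notation N := (bshift 1).
Local Notation D := (firstD R d k).
Local Notation P := (lastD R d k).
Local Notation nu := (n%:R : R).

Lemma nu_ge1 : 1 <= nu.
Proof. by rewrite ler1n muln_gt0 d0. Qed.

Let nu0 : 0 <= nu. Proof. exact: ler0n. Qed.

Lemma d_le_nu : d%:R <= nu.
Proof. by rewrite ler_nat leq_pmulr. Qed.

Definition mxpow (Z : 'M[C]_n) j := lprod (nseq j Z).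

Lemma mxpowSr Z j : mxpow Z j *m Z = mxpow Z j.+1.
Proof.
rewrite /mxpow; elim: j => [|j IH]; first by rewrite /= mul1mx mulmx1.
by rewrite [in LHS]/= -mulmxA IH.
Qed.

Lemma mxpow_bshift j : mxpow N j = bshift j.
Proof.
elim: j => [|j IH]; first by rewrite /mxpow /= bshift0.
by rewrite -mxpowSr IH bshiftM addn1.
Qed.

(** Consecutive products of copies of [N] are powers of [N], of norm at most [n], so the bound is
    linear and not exponential in [j]. *)
Lemma mxpow_near Z (e : R) j : 0 <= e -> fnorm (Z - N) <= e -> 2 * j%:R * nu * e <= 1 ->
  fnorm (mxpow Z j - bshift j) <= 2 * j%:R * nu ^+ 2 * e.
Proof.
move=> e0 hZ hs; rewrite -mxpow_bshift /mxpow.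
have H := @near_lprod R n nu e (nseq j N) (nseq j Z) e0; rewrite size_nseq in H.
apply: H => //.
  move=> l1 l2 l3 E; have -> : l2 = nseq (size l2) N.
    apply/all_pred1P; have : all (pred1 N) (l1 ++ l2 ++ l3) by rewrite -E all_nseq /= eqxx orbT.
    by rewrite !all_cat => /and3P[].
  by rewrite -/(mxpow N _) mxpow_bshift; exact: bshift_le.
by elim: j {hs} => //= j IH; split.
Qed.

Lemma fnormM3_le (X Y W : 'M[C]_n) (x y w : R) : fnorm X <= x -> fnorm Y <= y ->
  fnorm W <= w -> fnorm (X *m Y *m W) <= x * y * w.
Proof.
move=> hX hY hW; apply: le_trans (fnormM _ _) _; apply: ler_pM; rewrite ?fnorm_ge0 //.
by apply: le_trans (fnormM _ _) _; apply: ler_pM; rewrite ?fnorm_ge0.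
Qed.

Lemma fnorm_sum_le m (F : 'I_m -> 'M[C]_n) (x : R) : 0 <= x -> (m <= n)%N ->
  (forall i, fnorm (F i) <= x) -> fnorm (\sum_i F i) <= nu * x.
Proof.
move=> x0 hm hF; apply: le_trans (fnorm_sum _ _ _) _.
apply: (@le_trans _ _ (\sum_(i < m) x)); first by apply: ler_sum.
by rewrite sumr_const card_ord -[x *+ m]mulr_natl ler_wpM2r // ler_nat.
Qed.

Lemma near1_le (X : 'M[C]_n) (x : R) : fnorm (X - 1%:M) <= x -> fnorm X <= nu + x.
Proof.
move=> h; rewrite -(subrK 1%:M X); apply: le_trans (fnormD _ _) _.
by rewrite addrC lerD // fnorm1.
Qed.

(* The rows of O are the last block rows of the powers of Z, as in the
   observability matrix of a linear system; hence O conjugates Z to N up to the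
   first block row. *)
Lemma observability Z (e e2 : R) : 0 <= e -> fnorm (Z - N) <= e ->
  e2 = 2 * nu ^+ 3 * e -> nu ^+ 3 * e2 <= 1 / 2 ->
  exists (O : 'M[C]_n) (c : 'M[C]_n), let a := (bshift d.-1)^T *m c in
  [/\ O \in unitmx, fnorm (O - 1%:M) <= nu ^+ 3 * e2 /\
      fnorm (invmx O - 1%:M) <= 2 * (nu ^+ 3 * e2), P *m O = P,
      O *m Z = (N + a) *m O & fnorm a <= 2 * nu ^+ 3 * e2].
Proof.
move=> e0 hZ he2 hs; have nu1 := nu_ge1.
have e20 : 0 <= e2 by rewrite he2 !mulr_ge0 // exprn_ge0.
have dnu := d_le_nu; have dn : (d <= n)%N by rewrite leq_pmulr.
have nu2 : 1 <= nu ^+ 2 by rewrite exprn_ege1.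
have nu3 : 1 <= nu ^+ 3 by rewrite exprn_ege1.
have he2s : e2 <= 1 / 2.
  by apply: le_trans hs; rewrite -{1}[e2]mul1r ler_wpM2r.
have hj (j : nat) : (j <= d)%N -> 2 * j%:R * nu ^+ 2 * e <= e2.
  move=> hj; have jnu : j%:R <= nu by rewrite ler_nat (leq_trans hj).
  rewrite he2 ler_wpM2r // (exprS nu 2) mulrA ler_wpM2r ?exprn_ge0 //.
  by rewrite ler_wpM2l.
have pw j : (j <= d)%N -> fnorm (mxpow Z j - bshift j) <= e2.
  move=> jd; apply: le_trans (hj j jd); apply: mxpow_near => //.
  have h1 := hj j jd; have h2 : 2 * j%:R * nu * e <= 2 * j%:R * nu ^+ 2 * e.
    by rewrite ler_wpM2r // expr2 mulrA ler_peMr // !mulr_ge0.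
  by apply: le_trans h2 _; apply: le_trans h1 _; apply: le_trans he2s _; lra.
(* Block row [d - 1 - j] of [O] is the last block row of [Z ^ j]. For [Z = N] this is the identity
   by [sum_bshift_lastD]. *)
pose O := \sum_(j < d) (bshift j)^T *m P *m mxpow Z j.
have hO : fnorm (O - 1%:M) <= nu ^+ 3 * e2.
  rewrite -(@sum_bshift_lastD R d k d0) -sumrB.
  have -> : nu ^+ 3 * e2 = nu * (nu * nu * e2) by rewrite !exprS expr0 mulr1 !mulrA.
  apply: fnorm_sum_le => // [|j]; first by rewrite !mulr_ge0.
  rewrite -mulmxBr; apply: fnormM3_le; [exact: bshift_tr_le|exact: lastD_le|].
  exact: pw (ltnW (ltn_ord j)).
have [uO hOi] : O \in unitmx /\ fnorm (invmx O - 1%:M) <= 2 * (nu ^+ 3 * e2).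
  have E1 : 1%:M + (O - 1%:M) = O by rewrite addrC subrK.
  have := @neumann R n (O - 1%:M); rewrite E1 => h.
  have [u h2] := h (le_trans hO hs); split=> //.
  by apply: le_trans h2 _; rewrite ler_wpM2l.
have PO : P *m O = P.
  rewrite /O mulmx_sumr (bigD1 (Ordinal d0)) //= big1 ?addr0 => [|j hj0]; last first.
    by rewrite !mulmxA lastD_bshift_tr ?mul0mx // lt0n; apply: contra hj0.
  rewrite bshift0 trmx1 mul1mx /mxpow /= mulmx1 -[RHS]mulmx1 -(first_last R d k).
  by rewrite mulmxDr lastD_firstD add0r.
(* Multiplying [O] by [Z] shifts its block rows as [N] does; only the first block row, holding the
   last block row of [Z ^ d], does not fit. It is small because [N ^ d = 0]. *)
pose c := P *m mxpow Z d *m invmx O.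
exists O, c => /=; split=> //.
  have -> : O *m Z = N *m O + (bshift d.-1)^T *m (P *m mxpow Z d).
    rewrite /O mulmx_suml mulmx_sumr.
    under eq_bigr do rewrite -mulmxA mxpowSr.
    pose f j := (bshift j)^T *m P *m mxpow Z j.+1.
    pose g j := N *m ((bshift j)^T *m P *m mxpow Z j).
    rewrite -(big_mkord xpredT f) -(big_mkord xpredT g).
    rewrite (sum_nat_recr_pred f d0) (sum_nat_recl_pred g d0) /g bshift0 trmx1 mul1mx !mulmxA bshift_lastD0 // mul0mx add0r.
    congr (_ + _); last by rewrite /f prednK // mulmxA.
    apply: eq_big_nat => j /andP[_ hjd]; rewrite ltn_predRL in hjd.
    by rewrite /f -(bshift_lastD R k d0 hjd) !mulmxA.
  by rewrite mulmxDl /c; congr (_ + _); rewrite -!mulmxA mulVmx // mulmx1.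
rewrite /c !mulmxA.
have hOi2 : fnorm (invmx O) <= 2 * nu.
  apply: le_trans (near1_le hOi) _.
  have -> : 2 * nu = nu + nu by rewrite mulrDl mul1r.
  rewrite lerD2l; apply: le_trans nu1; rewrite mulrC -ler_pdivlMr //.
have hd : fnorm (mxpow Z d) <= e2.
  by have := pw d (leqnn d); rewrite bshift_ge // subr0.
have h3 : fnorm ((bshift d.-1)^T *m P *m mxpow Z d) <= nu * nu * e2.
  by apply: fnormM3_le; [exact: bshift_tr_le|exact: lastD_le|exact: hd].
have h4 := ler_pM (fnorm_ge0 _) (fnorm_ge0 _) h3 hOi2.
have h5 := le_trans (fnormM _ _) h4; apply: le_trans h5 _.
by rewrite le_eqVlt; apply/orP; left; apply/eqP; rewrite !exprS expr0; ring.
Qed.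

(* Up to the right factor 1 - Y D, multiplication by 1 - Y clears the first
   block row of N + a outside the last block column. *)
Lemma companion_equivalence (c : 'M[C]_n) (ea : R) : let a := (bshift d.-1)^T *m c in
  fnorm a <= ea ->
  exists Y : 'M[C]_n, [/\ P *m Y = 0, fnorm Y <= nu ^+ 3 * ea,
    (1%:M - Y) *m D = D *m (1%:M - Y *m D) &
    (1%:M - Y) *m (N + a) *m D = N *m (1%:M - Y *m D)].
Proof.
move=> a ha; have ea0 : 0 <= ea by apply: le_trans ha; exact: fnorm_ge0.
(* [Y] solves [Y N = N Y D + a D]: multiplication by [N] on either side produces the terms [f s]
   below, shifted by one index, and the last of them vanishes. Moreover [Y a = 0], since [a] lives
   in the first block row. *)
pose Y := \sum_(s < d.-1) bshift s *m a *m (bshift s.+1)^T.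
have dn : (d.-1 <= n)%N by apply: leq_trans (leq_pred d) _; rewrite leq_pmulr.
have PY : P *m Y = 0.
  rewrite /Y mulmx_sumr big1 // => s _.
  by rewrite /a !mulmxA lastD_bshift_mul // !mul0mx.
have DY : D *m Y = Y by rewrite -[RHS]mul1mx -(first_last R d k) mulmxDl PY addr0.
have Na s : (0 < s)%N -> (bshift s)^T *m a = 0.
  move=> hs; rewrite /a mulmxA bshift_trM bshift_ge ?trmx0 ?mul0mx //; lia.
have Ya : Y *m a = 0.
  by rewrite /Y mulmx_suml big1 // => s _; rewrite -mulmxA Na // mulmx0.
exists Y; split=> //.
- have -> : nu ^+ 3 * ea = nu * (nu * ea * nu) by rewrite !exprS expr0; ring.
  apply: fnorm_sum_le => // [|s]; first by rewrite !mulr_ge0.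
  by apply: fnormM3_le; [exact: bshift_le|exact: ha|exact: bshift_tr_le].
- by rewrite mulmxBl mulmxBr mul1mx mulmx1 mulmxA DY.
pose f s := bshift s *m a *m (bshift s)^T *m D.
have E1 : Y *m N = \sum_(0 <= s < d.-1) f s.
  rewrite /Y mulmx_suml big_mkord; apply: eq_bigr => s _; rewrite /f -!mulmxA; congr (_ *m (_ *m _)).
  by rewrite -[s.+1]addn1 -bshift_trM -mulmxA bshift_tr_bshift.
have E2 : N *m (Y *m D) = \sum_(0 <= s < d.-1) f s.+1.
  rewrite /Y mulmx_suml mulmx_sumr big_mkord; apply: eq_bigr => s _.
  by rewrite /f !mulmxA bshiftM add1n.
have f0 : f 0%N = a *m D by rewrite /f bshift0 trmx1 mul1mx mulmx1.
have fd : f d.-1 = 0 by rewrite /f -mulmxA (bshift_tr_firstD R k d0) mulmx0.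
have E3 : N *m (Y *m D) + a *m D = Y *m N.
  by rewrite E1 E2 -f0 addrC -big_nat_recl // big_nat_recr //= fd addr0.
have E4 : (1%:M - Y) *m (N + a) = N + a - Y *m N.
  by rewrite mulmxBl mul1mx mulmxDr Ya addr0.
have E5 : Y *m N *m D = Y *m N by rewrite -mulmxA (bshift_firstD R k d0).
rewrite E4 mulmxBl mulmxDl E5 (bshift_firstD R k d0) mulmxBr mulmx1 -E3.
by mxabel.
Qed.

Lemma lastD_inv (X : 'M[C]_n) : X \in unitmx -> P *m X = P -> P *m invmx X = P.
Proof. by move=> uX h; rewrite -{1}h -mulmxA mulmxV // mulmx1. Qed.

Lemma firstD_inv (X : 'M[C]_n) : P *m X = P -> X *m D = D *m (X *m D).
Proof.
move=> h; rewrite -[LHS]mul1mx -(first_last R d k) mulmxDl [P *m _]mulmxA h.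
by rewrite lastD_firstD addr0.
Qed.

Lemma near1M (X Y : 'M[C]_n) (x y : R) : fnorm (X - 1%:M) <= x -> fnorm (Y - 1%:M) <= y ->
  fnorm (X *m Y - 1%:M) <= x + y + x * y.
Proof.
move=> hX hY.
have -> : X *m Y - 1%:M = (X - 1%:M) + (Y - 1%:M) + (X - 1%:M) *m (Y - 1%:M).
  by rewrite mulmxBl !mulmxBr !mul1mx mulmx1; mxabel.
apply: le_trans (fnormD _ _) _; apply: lerD.
  by apply: le_trans (fnormD _ _) _; apply: lerD.
by apply: le_trans (fnormM _ _) _; apply: ler_pM; rewrite ?fnorm_ge0.
Qed.

End Restoration.

Section PencilRestoration.
Variable R : realType.
Local Notation C := R[i].
Variables d k : nat.
Hypotheses (d0 : (0 < d)%N) (k0 : (0 < k)%N).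
Local Notation n := (d * k)%N.
Local Notation bshift := (bshift R d k).
Local Notation N := (bshift 1).
Local Notation D := (firstD R d k).
Local Notation P := (lastD R d k).
Local Notation nu := (n%:R : R).

(** With [W] bounded by [2 b] and [B] by [5 nu], the terms [(A - 1) W B] and [W (B - 1)] contribute
    [10 b nu t] and at most [2 b nu t]. *)
Lemma equivalence_near (A B W S0 dS : 'M[C]_n) (t b e : R) :
  fnorm (A - 1%:M) <= t -> fnorm (B - 1%:M) <= t -> t <= 4 -> fnorm S0 <= b -> 1 <= b ->
  fnorm dS <= e -> e <= b -> 1 <= nu -> W = S0 + dS ->
  fnorm (A *m W *m B - S0) <= 12 * b * nu * t + e.
Proof.
move=> hA hB ht hS b1 hd eb nu1 EW.
have t0 : 0 <= t by apply: le_trans hA; exact: fnorm_ge0.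
have b0 : 0 <= b by apply: le_trans b1; exact: ler01.
have -> : A *m W *m B - S0 = (A - 1%:M) *m W *m B + W *m (B - 1%:M) + dS.
  by rewrite !mulmxBl mul1mx mulmxBr mulmx1 EW; mxabel.
have hW : fnorm W <= 2 * b.
  by rewrite EW; apply: le_trans (fnormD _ _) _; rewrite mulrDl mul1r lerD // (le_trans hd).
have hB2 : fnorm B <= 5 * nu.
  apply: le_trans (near1_le hB) _.
  have -> : 5 * nu = nu + 4 * nu by rewrite -{2}[nu]mul1r -mulrDl -natr1 addrC.
  by rewrite lerD2l (le_trans ht) // ler_peMr.
have h1 : fnorm ((A - 1%:M) *m W *m B) <= t * (2 * b) * (5 * nu) by exact: fnormM3_le.
have h2 : fnorm (W *m (B - 1%:M)) <= 2 * b * t.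
  by apply: le_trans (fnormM _ _) _; apply: ler_pM; rewrite ?fnorm_ge0.
apply: le_trans (fnormD _ _) _; rewrite lerD //.
apply: le_trans (fnormD _ _) _; apply: le_trans (lerD h1 h2) _.
have h3 : 2 * b * t <= 2 * b * nu * t.
  by rewrite ler_wpM2r // ler_peMr // mulr_ge0.
apply: le_trans (lerD (lexx _) h3) _.
by rewrite le_eqVlt; apply/orP; left; apply/eqP; ring.
Qed.

(** The computation common to both coefficients of the pencil: it is used with [V = D], [E = D] for
    the second one and with [V = Z], [E = N] for the first one. *)
Lemma conj_firstD (X Oo Ti Th Oi Hi H T V E : 'M[C]_n) :
  T *m D = Th *m V -> V = V *m D -> Ti *m Th = 1%:M ->
  Oi *m Hi *m D = D *m (Oi *m Hi *m D) -> Hi *m D = D *m (Hi *m D) -> H *m Hi = 1%:M ->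
  X *m Oo *m V *m Oi *m D = E *m H *m D ->
  X *m Oo *m Ti *m T *m (Oi *m Hi) *m D = E *m D.
Proof.
move=> hT hV hTi hBD hHiD hH hX.
have e1 : T *m (Oi *m Hi *m D) = Th *m (V *m (Oi *m Hi *m D)).
  by rewrite {1}hBD mulmxA hT -mulmxA.
rewrite -(mulmxA _ (Oi *m Hi) D) -(mulmxA _ T) e1 -(mulmxA _ Ti) (mulmxA Ti) hTi mul1mx.
rewrite -(mulmxA Oi) hHiD (mulmxA Oi) (mulmxA V) (mulmxA V) !(mulmxA (X *m Oo)) hX.
by rewrite -(mulmxA _ D) -hHiD mulmxA -(mulmxA E) hH mulmx1.
Qed.

(* The equations X D = N and X D = D characterize the two coefficients of a
   block companion pencil. *)
Lemma pencil_restore (S0 T0 dS dT : 'M[C]_n) (b e : R) :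
  S0 *m D = N -> T0 *m D = D -> fnorm S0 <= b -> fnorm T0 <= b -> 1 <= b ->
  fnorm dS <= e -> fnorm dT <= e -> 40 * nu ^+ 12 * e <= 1 ->
  exists A B : 'M[C]_n, [/\ A \in unitmx, B \in unitmx,
    A *m (S0 + dS) *m B *m D = N /\ A *m (T0 + dT) *m B *m D = D,
    fnorm (A *m (S0 + dS) *m B - S0) <= 1921 * b * nu ^+ 13 * e &
    fnorm (A *m (T0 + dT) *m B - T0) <= 1921 * b * nu ^+ 13 * e].
Proof.
move=> hS0 hT0 bS bT b1 hdS hdT hs; have nu1 := nu_ge1 R d0 k0.
have e0 : 0 <= e by apply: le_trans hdS; exact: fnorm_ge0.
have nu0 : 0 <= nu by apply: le_trans nu1; exact: ler01.
have pe j l : (j <= l)%N -> nu ^+ j * e <= nu ^+ l * e.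
  by move=> jl; rewrite ler_wpM2r // ler_weXn2l.
(* A common bound for all perturbations below: [Z - N] is at most [5 nu^2 e], so [e2 = 10 nu^5 e],
   [a] is at most [20 nu^8 e], [Y] at most [20 nu^11 e], and [Y D] costs one more [nu]. The
   hypothesis on [e] says [w <= 1 / 2], as [neumann] demands. *)
pose w := 20 * nu ^+ 12 * e.
have pw (m : nat) j : (m <= 20)%N -> (j <= 12)%N -> m%:R * nu ^+ j * e <= w.
  move=> hm hj; rewrite /w -[m%:R * _ * e]mulrA -[20 * _ * e]mulrA; apply: ler_pM.
  - exact: ler0n.
  - by rewrite mulr_ge0 // exprn_ge0.
  - by rewrite ler_nat.
  - exact: (pe _ _ hj).
have hw : w <= 1 / 2.
  rewrite ler_pdivlMr // /w; apply: le_trans hs.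
  by rewrite le_eqVlt; apply/orP; left; apply/eqP; ring.
have w0 : 0 <= w by rewrite /w !mulr_ge0 // exprn_ge0.
have e1 : e <= w by have := pw 1%N 0%N isT isT; rewrite expr0 !mul1r.
have nue : nu * e <= w by have := pw 1%N 1%N isT isT; rewrite expr1 mul1r.
have hdTD : fnorm (dT *m D) <= nu * e.
  by apply: le_trans (fnormM _ _) _; rewrite mulrC; apply: ler_pM;
     rewrite ?fnorm_ge0 // firstD_le.
have hdSD : fnorm (dS *m D) <= nu * e.
  by apply: le_trans (fnormM _ _) _; rewrite mulrC; apply: ler_pM;
     rewrite ?fnorm_ge0 // firstD_le.
have [uT hTi] := neumann (le_trans hdTD (le_trans nue hw)).
pose Th := 1%:M + dT *m D; rewrite -/Th in uT hTi.
pose Ti : 'M[C]_n := invmx Th.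
have hTi2 : fnorm (Ti - 1%:M) <= 2 * (nu * e).
  by apply: le_trans hTi _; rewrite ler_wpM2l.
(* On the first block columns, [T0 + dT] equals [Th D] and [S0 + dS] equals [N + dS D = Th Z].
   Inverting [Th] therefore suffices, and [T0 + dT] itself may be singular. *)
pose Z : 'M[C]_n := Ti *m (N + dS *m D).
have ez0 : 0 <= 5 * nu ^+ 2 * e by rewrite !mulr_ge0 // exprn_ge0.
have hZ : fnorm (Z - N) <= 5 * nu ^+ 2 * e.
  have -> : Z - N = (Ti - 1%:M) *m (N + dS *m D) + dS *m D.
    by rewrite mulmxBl mul1mx /Z; mxabel.
  apply: le_trans (fnormD _ _) _.
  have h1 : fnorm (N + dS *m D) <= 2 * nu.
    apply: le_trans (fnormD _ _) _; rewrite mulrDl mul1r lerD ?bshift_le //.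
    apply: le_trans hdSD _; apply: le_trans nue _; apply: le_trans hw _.
    by apply: le_trans nu1; rewrite mul1r invf_le1 // ler1n.
  have h2 : fnorm ((Ti - 1%:M) *m (N + dS *m D)) <= 2 * (nu * e) * (2 * nu).
    by apply: le_trans (fnormM _ _) _; apply: ler_pM; rewrite ?fnorm_ge0.
  apply: le_trans (lerD h2 hdSD) _.
  have h3 : nu * e <= nu ^+ 2 * e by have := pe 1%N 2%N isT; rewrite expr1.
  apply: le_trans (lerD (lexx _) h3) _.
  by rewrite le_eqVlt; apply/orP; left; apply/eqP; ring.
pose e2 := 2 * nu ^+ 3 * (5 * nu ^+ 2 * e).
have E2 : nu ^+ 3 * e2 = 10 * nu ^+ 8 * e by rewrite /e2; ring.
have h2s : nu ^+ 3 * e2 <= w by rewrite E2; exact: pw.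
have [Oo [c [uO [hO hOi] PO hOZ ha]]] :=
  observability d0 k0 ez0 hZ (erefl e2) (le_trans h2s hw).
set a := (bshift d.-1)^T *m c in hOZ ha.
have [Y [PY hY hXD hXN]] := companion_equivalence d0 k0 ha.
have EY : nu ^+ 3 * (2 * nu ^+ 3 * e2) = 20 * nu ^+ 11 * e by rewrite /e2; ring.
have hY1 : fnorm Y <= w by apply: le_trans hY _; rewrite EY; exact: pw.
have hYD : fnorm (Y *m D) <= w.
  apply: le_trans (fnormM _ _) _.
  have -> : w = 20 * nu ^+ 11 * e * nu by rewrite /w; ring.
  by apply: ler_pM; rewrite ?fnorm_ge0 ?firstD_le // -EY.
pose X := 1%:M - Y; pose H := 1%:M - Y *m D; rewrite -/X -/H in hXD hXN.
have hX : fnorm (X - 1%:M) <= w by rewrite /X addrAC subrr add0r fnormN.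
have hH : H = 1%:M + - (Y *m D) by [].
have hYDn : fnorm (- (Y *m D)) <= w by rewrite fnormN.
have [uH hHi] := neumann (le_trans hYDn hw); rewrite -hH in uH hHi.
have uX : X \in unitmx.
  have h : fnorm (- Y) <= w by rewrite fnormN.
  by have [] := neumann (le_trans h hw).
pose Oi : 'M[C]_n := invmx Oo; pose Hi : 'M[C]_n := invmx H.
have hHi2 : fnorm (Hi - 1%:M) <= 2 * w by apply: le_trans hHi _; rewrite ler_wpM2l.
have hOi2 : fnorm (Oi - 1%:M) <= 2 * w by apply: le_trans hOi _; rewrite ler_wpM2l.
have hTi3 : fnorm (Ti - 1%:M) <= 2 * w by apply: le_trans hTi2 _; rewrite ler_wpM2l.
have hO2 : fnorm (Oo - 1%:M) <= w by exact: le_trans hO h2s.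
(* [Ti] normalizes the first block columns of the second coefficient, [Oo] conjugates [Z] to
   [N + a], and [X] together with the inverse of [H] removes [a]. *)
pose A := X *m Oo *m Ti; pose B := Oi *m Hi.
have ww : w * w <= w / 2 by rewrite ler_wpM2l // -[2^-1]mul1r.
have www : w * w * w <= w / 2.
  by apply: le_trans ww; rewrite ler_piMr ?mulr_ge0 // (le_trans hw) // mul1r invf_le1 // ler1n.
have hA : fnorm (A - 1%:M) <= 8 * w.
  apply: le_trans (near1M (near1M hX hO2) hTi3) _.
  have -> : w + w + w * w + 2 * w + (w + w + w * w) * (2 * w) =
     4 * w + 5 * (w * w) + 2 * (w * w * w) by ring.
  by move: ww www w0; clear; move: w => t; lra.
have hB : fnorm (B - 1%:M) <= 8 * w.
  apply: le_trans (near1M hOi2 hHi2) _.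
  have -> : 2 * w + 2 * w + 2 * w * (2 * w) = 4 * w + 4 * (w * w) by ring.
  by move: ww w0; clear; move: w => t; lra.
have uTi : Ti \in unitmx by rewrite unitmx_inv.
have uOi : Oi \in unitmx by rewrite unitmx_inv.
have uHi : Hi \in unitmx by rewrite unitmx_inv.
have PH : P *m H = P by rewrite /H mulmxBr mulmx1 mulmxA PY mul0mx subr0.
have PHi : P *m Hi = P by exact: lastD_inv.
have POi : P *m Oi = P by exact: lastD_inv.
have hBD : B *m D = D *m (B *m D).
  by apply: firstD_inv; rewrite mulmxA POi PHi.
have hHiD : Hi *m D = D *m (Hi *m D) by exact: firstD_inv.
have hTD : (T0 + dT) *m D = Th *m D.
  by rewrite !mulmxDl hT0 mul1mx -mulmxA firstD_idem.
have hSD : (S0 + dS) *m D = Th *m Z.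
  by rewrite mulmxDl hS0 /Z mulmxA mulmxV // mul1mx.
have TiTh : Ti *m Th = 1%:M by rewrite mulVmx.
have OOi : Oo *m Oi = 1%:M by rewrite mulmxV.
have HHi : H *m Hi = 1%:M by rewrite mulmxV.
have hE1 : A *m (T0 + dT) *m B *m D = D.
  have eO : Oo *m (D *m (Oi *m D)) = D by rewrite -(firstD_inv POi) mulmxA OOi mul1mx.
  have hV : D = D *m D by rewrite firstD_idem.
  have hX2 : X *m Oo *m D *m Oi *m D = D *m H *m D.
    rewrite -(mulmxA _ Oi) -(mulmxA _ D) -(mulmxA X) eO -hXD -(mulmxA X) firstD_idem.
    by [].
  by rewrite -[RHS]firstD_idem; exact: conj_firstD hTD hV TiTh hBD hHiD HHi hX2.
have hE2 : A *m (S0 + dS) *m B *m D = N.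
  have hZD : Z = Z *m D.
    by rewrite /Z -(mulmxA Ti) mulmxDl -(mulmxA dS) firstD_idem (bshift_firstD R k d0).
  have hSD' : (S0 + dS) *m D = Th *m Z by exact: hSD.
  have hX2 : X *m Oo *m Z *m Oi *m D = N *m H *m D.
    rewrite -(mulmxA X) hOZ (mulmxA X) -(mulmxA _ Oo) OOi mulmx1 hXN.
    by rewrite -hXN -(mulmxA _ D) firstD_idem.
  rewrite -[RHS](bshift_firstD R k d0).
  exact: conj_firstD hSD hZD TiTh hBD hHiD HHi hX2.
have t4 : 8 * w <= 4.
  have -> : 8 * w = 4 * (w * 2) by ring.
  by rewrite ler_piMr // -ler_pdivlMr.
(* [12 * 8 * 20 = 1920], and one more unit absorbs the additional [e]. *)
have final : 12 * b * nu * (8 * w) + e <= 1921 * b * nu ^+ 13 * e.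
  have h1 : e <= b * nu ^+ 13 * e.
    by rewrite ler_peMl // mulr_ege1 // exprn_ege1.
  have -> : 1921 * b * nu ^+ 13 * e = 1920 * b * nu ^+ 13 * e + b * nu ^+ 13 * e by ring.
  apply: lerD h1; rewrite le_eqVlt; apply/orP; left; apply/eqP; rewrite /w; ring.
have eb : e <= b.
  by apply: le_trans e1 _; apply: le_trans hw _; apply: le_trans b1; rewrite mul1r invf_le1 // ler1n.
exists A, B; split.
- by rewrite /A !unitmx_mul uX uO uTi.
- by rewrite /B unitmx_mul uOi uHi.
- by split; [exact: hE2|exact: hE1].
- apply: le_trans final; exact: (equivalence_near hA hB t4 bS b1 hdS eb nu1 (erefl _)).
- apply: le_trans final; exact: (equivalence_near hA hB t4 bT b1 hdT eb nu1 (erefl _)).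
Qed.

End PencilRestoration.

Section PencilBlocks.
Variable R : realType.
Local Notation C := R[i].
Variables d k : nat.
Hypotheses (d0 : (0 < d)%N) (k0 : (0 < k)%N).
Local Notation n := (d * k)%N.
Local Notation bshift := (bshift R d k).
Local Notation N := (bshift 1).
Local Notation D := (firstD R d k).
Local Notation P := (lastD R d k).

Lemma n_gt0 : (0 < d * k)%N. Proof. by rewrite muln_gt0 d0. Qed.

(** Position [r] inside block [i]. For [i < d] the index [i * k + r] is in range; the default merely
    makes the function total. *)
Definition bidx (i : nat) (r : 'I_k) : 'I_n := insubd (Ordinal n_gt0) (i * k + r)%N.

Lemma bidxE i r : (i < d)%N -> bidx i r = (i * k + r)%N :> nat.
Proof.
move=> hi; rewrite /bidx val_insubd; case: ifP => // /negP[].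
have : (i.+1 * k <= n)%N by rewrite leq_mul2r hi orbT.
by rewrite mulSnr; apply: leq_trans; rewrite ltn_add2l.
Qed.

Lemma bidx_div i r : (i < d)%N -> (bidx i r %/ k)%N = i.
Proof. by move=> hi; rewrite bidxE // divnMDl // divn_small ?addn0. Qed.

Lemma bidx_inner i r : (i < d)%N -> inner (bidx i r) = r.
Proof. by move=> hi; apply: val_inj; rewrite /= bidxE // modnMDl modn_small. Qed.

Lemma div_lt_d (a : 'I_n) : (a %/ k < d)%N.
Proof. by rewrite ltn_divLR. Qed.

Lemma bidx_eta (a : 'I_n) : bidx (a %/ k) (inner a) = a.
Proof. by apply: val_inj; rewrite /= bidxE ?div_lt_d //= -divn_eq. Qed.

Lemma bidx_last r : (d.-1 * k <= bidx d.-1 r)%N.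
Proof. by rewrite bidxE ?leq_addr // prednK. Qed.

Lemma bidx_eta_last (b : 'I_n) : (d.-1 * k <= b)%N -> bidx d.-1 (inner b) = b.
Proof.
move=> hb; rewrite -[RHS]bidx_eta; congr (bidx _ _).
have h1 : (d.-1 <= b %/ k)%N by rewrite leq_divRL.
by have := div_lt_d b; lia.
Qed.

Lemma sum_bidx (F : 'I_n -> R) : \sum_a F a = \sum_(i < d) \sum_(r < k) F (bidx i r).
Proof.
rewrite pair_bigA /=; apply: (reindex (fun p : 'I_d * 'I_k => bidx p.1 p.2)).
exists (fun a => (Ordinal (div_lt_d a), inner a)) => [[i r] _|a _] /=.
  by congr pair; [apply: val_inj; rewrite /= bidx_div|rewrite bidx_inner].
exact: bidx_eta.
Qed.

Lemma fnorm2_last_block (X : 'M[C]_n) :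
  \sum_(i < d) fnorm2 (\matrix_(r < k, c < k) X (bidx i r) (bidx d.-1 c)) <= fnorm2 X.
Proof.
rewrite [leRHS]/fnorm2 sum_bidx; apply: ler_sum => i _; apply: ler_sum => r _.
have hd : (d.-1 < d)%N by rewrite prednK.
rewrite sum_bidx (bigD1 (Ordinal hd)) //= -[leLHS]addr0; apply: lerD.
  by apply: ler_sum => c _; rewrite mxE.
by apply: sumr_ge0 => j _; apply: sumr_ge0 => c _; rewrite sqr_ge0.
Qed.

Lemma fnorm2_lastD (G : nat -> 'M[C]_k) :
  fnorm2 (\matrix_(a < n, b < n) if (b < d.-1 * k)%N then 0 else G (a %/ k)%N (inner a) (inner b))
  = \sum_(i < d) fnorm2 (G i).
Proof.
rewrite /fnorm2 sum_bidx; apply: eq_bigr => i _; apply: eq_bigr => r _.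
have hd : (d.-1 < d)%N by rewrite prednK.
rewrite sum_bidx (bigD1 (Ordinal hd)) //= [X in _ + X]big1 ?addr0 => [|j hj].
  apply: eq_bigr => c _; rewrite mxE ltnNge bidx_last /= bidx_div // !bidx_inner //.
rewrite big1 // => c _; rewrite mxE ifT ?normc0 ?expr0n // bidxE //.
have hjd : (j < d.-1)%N by have := ltn_ord j; rewrite -val_eqE /= in hj; lia.
have : (j.+1 * k <= d.-1 * k)%N by rewrite leq_mul2r hjd orbT.
by rewrite mulSnr; apply: leq_trans; rewrite ltn_add2l.
Qed.

Lemma pencilS_firstD M : pencilS d M *m D = N.
Proof.
apply/matrixP => a b; rewrite mulmx_firstD !mxE mul1n; case: ltnP => // hb.
by case: eqP => // E; have := ltn_ord a; have := last_start k d0; rewrite E; lia.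
Qed.

Lemma pencilT_firstD N' : pencilT d N' *m D = D.
Proof.
apply/matrixP => a b; rewrite mulmx_firstD !mxE; case: ltnP => // hb; rewrite ?andbT //.
by rewrite andbF.
Qed.

Lemma pencilS_of (X : 'M[C]_n) : X *m D = N ->
  X = pencilS d (fun i => \matrix_(r, c) - X (bidx i r) (bidx d.-1 c)).
Proof.
move=> hX; apply/matrixP => a b; rewrite [RHS]mxE; case: ltnP => hb.
  by have /matrixP/(_ a b) := hX; rewrite mulmx_firstD hb mxE mul1n.
by rewrite mxE opprK bidx_eta bidx_eta_last.
Qed.

Lemma pencilT_of (X : 'M[C]_n) : X *m D = D ->
  X = pencilT d (fun i => \matrix_(r, c) X (bidx i.-1 r) (bidx d.-1 c)).
Proof.
move=> hX; apply/matrixP => a b; rewrite [RHS]mxE; case: ltnP => hb.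
  by have /matrixP/(_ a b) := hX; rewrite mulmx_firstD hb mxE hb andbT.
by rewrite mxE /= bidx_eta bidx_eta_last.
Qed.

Lemma pencilS_entry (M : nat -> 'M[C]_k) i (r c : 'I_k) : (i < d)%N ->
  pencilS d M (bidx i r) (bidx d.-1 c) = - M i r c.
Proof.
move=> hi; rewrite mxE ltnNge bidx_last /= bidx_div // !bidx_inner // prednK //.
Qed.

Lemma pencilT_entry (N' : nat -> 'M[C]_k) i (r c : 'I_k) : (i < d)%N ->
  pencilT d N' (bidx i r) (bidx d.-1 c) = N' i.+1 r c.
Proof.
move=> hi; rewrite mxE ltnNge bidx_last /= bidx_div // !bidx_inner // prednK //.
Qed.

Lemma pencilS_diff (M M' : nat -> 'M[C]_k) : \sum_(i < d) fnorm2 (M' i - M i) <= fnorm2 (pencilS d M' - pencilS d M).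
Proof.
apply: le_trans (fnorm2_last_block _); apply: ler_sum => i _.
rewrite le_eqVlt; apply/orP; left; apply/eqP; apply: eq_bigr => r _; apply: eq_bigr => c _.
rewrite [in RHS]mxE !addmxE !oppmxE !pencilS_entry //.
by rewrite normcB opprK [X in _ = normc X ^+ 2]addrC.
Qed.

Lemma pencilT_diff (N1 N2 : nat -> 'M[C]_k) :
  \sum_(i < d) fnorm2 (N2 i.+1 - N1 i.+1) <= fnorm2 (pencilT d N2 - pencilT d N1).
Proof.
apply: le_trans (fnorm2_last_block _); apply: ler_sum => i _.
rewrite le_eqVlt; apply/orP; left; apply/eqP; apply: eq_bigr => r _; apply: eq_bigr => c _.
by rewrite [in RHS]mxE !addmxE !oppmxE !pencilT_entry.
Qed.

Lemma pencilS_le (M : nat -> 'M[C]_k) (b : R) : 0 <= b -> \sum_(i < d) fnorm2 (M i) <= b ^+ 2 ->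
  fnorm (pencilS d M) <= n%:R + b.
Proof.
move=> b0 hb; have -> : pencilS d M = N + (\matrix_(a < n, b < n)
   if (b < d.-1 * k)%N then 0 else (- M (a %/ k)%N) (inner a) (inner b)).
  apply/matrixP => a c; rewrite addmxE !mxE mul1n; case: ltnP => hc; first by rewrite addr0.
  case: eqP => [E|_]; last by rewrite add0r.
  by have := ltn_ord a; have := last_start k d0; rewrite E; lia.
apply: le_trans (fnormD _ _) _; apply: lerD; first exact: bshift_le.
apply: fnorm_le b0 _; rewrite (fnorm2_lastD (fun i => - M i)).
by under eq_bigr do rewrite -fnorm_sqr fnormN fnorm_sqr.
Qed.

Lemma pencilT_le (N' : nat -> 'M[C]_k) (b : R) : 0 <= b -> \sum_(i < d) fnorm2 (N' i.+1) <= b ^+ 2 ->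
  fnorm (pencilT d N') <= n%:R + b.
Proof.
move=> b0 hb; have -> : pencilT d N' = D + (\matrix_(a < n, b < n)
   if (b < d.-1 * k)%N then 0 else N' (a %/ k)%N.+1 (inner a) (inner b)).
  apply/matrixP => a c; rewrite addmxE !mxE; case: ltnP => hc; first by rewrite andbT addr0.
  by rewrite andbF add0r.
apply: le_trans (fnormD _ _) _; apply: lerD; first exact: firstD_le.
by apply: fnorm_le b0 _; rewrite (fnorm2_lastD (fun i => N' i.+1)).
Qed.

End PencilBlocks.

(** * Determinants and eigenvalues *)

Section PencilDeterminant.
Variable R : realType.
Local Notation C := R[i].
Variables d k : nat.
Hypotheses (d0 : (0 < d)%N) (k0 : (0 < k)%N).
Local Notation n := (d * k)%N.
Local Notation bshift := (bshift R d k).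
Local Notation N := (bshift 1).
Local Notation D := (firstD R d k).
Local Notation P := (lastD R d k).
Implicit Types z : C.

(** The inverse of [1 - z N^T], a finite geometric series because [N] is nilpotent. *)
Definition resolvent z : 'M[C]_n := \sum_(j < d) z ^+ j *: (bshift j)^T.

Lemma resolventK z : (1%:M - z *: N^T) *m resolvent z = 1%:M.
Proof.
pose f j := - (z ^+ j *: (bshift j)^T).
have E (j : nat) : (1%:M - z *: N^T) *m (z ^+ j *: (bshift j)^T) = f j.+1 - f j.
  rewrite mulmxBl mul1mx /f opprK [RHS]addrC; congr (_ - _).
  by rewrite -scalemxAl -scalemxAr bshift_trM scalerA exprS.
rewrite /resolvent mulmx_sumr; under eq_bigr do rewrite E.
rewrite -(big_mkord xpredT (fun j => f j.+1 - f j)) telescope_sumr // /f.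
by rewrite bshift_ge // trmx0 scaler0 oppr0 add0r opprK bshift0 trmx1 scale1r.
Qed.

Lemma det_1_shift z : \det (1%:M - z *: N^T) = 1.
Proof.
rewrite -det_tr linearB /= linearZ /= trmx1 trmxK det_trig.
  rewrite big1 // => a _; rewrite !mxE eqxx.
  have -> : (a == (a + 1 * k)%N :> nat) = false by apply/eqP; lia.
  by rewrite mulr0 subr0.
apply/is_trig_mxP => a b hab; rewrite !mxE.
have -> : (a == b) = false by apply/eqP => E; rewrite E ltnn in hab.
have -> : (a == (b + 1 * k)%N :> nat) = false by apply/eqP; lia.
by rewrite mulr0 subr0.
Qed.

(** On the first block columns the pencil is [N - z D], which equals [(1 - z N^T) N] because
    [N^T N = D]. Extracting this factor of determinant 1 leaves [N] plus a matrix supported in the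
    last block column. *)
Lemma shift_pencil z (X T : 'M[C]_n) : X *m D = N -> T *m D = D ->
  X - z *: T = (1%:M - z *: N^T) *m (N + resolvent z *m ((X - z *: T) *m P)).
Proof.
move=> hX hT; rewrite mulmxDr (mulmxA _ (resolvent z)) resolventK mul1mx mulmxBl mul1mx -scalemxAl.
rewrite (bshift_tr_bshift R k d0) -[LHS]mulmx1 -(first_last R d k) mulmxDr.
by rewrite [(X - _) *m D]mulmxBl hX -scalemxAl hT.
Qed.

(** Right multiplication by this permutation brings the last block column to the front and moves the
    others one block to the right. *)
Definition colrot : 'M[C]_n := \matrix_(a, b) (a == (b + d.-1 * k) %% n :> nat)%N%:R.

Lemma colrot_unit : colrot \in unitmx.
Proof.
suff h : colrot^T *m colrot = 1%:M by have [] := mulmx1_unit h.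
have -> : colrot^T = \matrix_(a, b) (b == (a + d.-1 * k) %% n :> nat)%N%:R.
  by apply/matrixP => a b; rewrite !mxE.
apply/matrixP => a b; rewrite boolmx_mul => [|c c' /andP[/eqP h _] /andP[/eqP h' _]]; last first.
  by apply: val_inj; rewrite /= h h'.
rewrite mxE; congr (nat_of_bool _)%:R; apply/existsP/eqP => [[c /andP[/eqP -> /eqP E]]|->].
  apply: val_inj => /=; move/eqP: E; rewrite eqn_modDr => /eqP.
  by rewrite !modn_small.
have hb : ((b + d.-1 * k) %% n < n)%N by rewrite ltn_mod n_gt0.
by exists (Ordinal hb); rewrite /= eqxx.
Qed.

End PencilDeterminant.

Lemma det_first_block (R : realType) (d k : nat) (K : 'M[R[i]]_(d.+1 * k)) :
  (0 < k)%N ->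
  (forall a (b : 'I_(d.+1 * k)), (k <= b)%N -> K a b = (a == b)%:R) ->
  \det K = \det (\matrix_(r < k, c < k) K (lshift (d * k) r) (lshift (d * k) c)).
Proof.
move=> k0 hK; rewrite -[K in LHS](@submxK _ k (d * k) k (d * k)).
have -> : @ursubmx _ k (d * k) k (d * k) K = 0.
  apply/matrixP => a b; rewrite !mxE hK /= ?leq_addr //.
  case: eqP => // /(congr1 val) /= E; have := ltn_ord a; rewrite E; lia.
have -> : @drsubmx _ k (d * k) k (d * k) K = 1%:M.
  apply/matrixP => a b; rewrite !mxE hK /= ?leq_addr // -val_eqE /= eqn_add2l.
  by [].
rewrite (@det_lblock _ k (d * k)) det1 mulr1; congr (\det _).
by apply/matrixP => a b; rewrite !mxE.
Qed.

Section PencilDeterminant2.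
Variable R : realType.
Local Notation C := R[i].
Variable d : nat.
Variable k : nat.
Hypothesis k0 : (0 < k)%N.
Local Notation n := (d.+1 * k)%N.

(** After extracting [1 - z N^T] and rotating the columns, all but the first [k] columns are those
    of the identity. The remaining corner is the first block row of [resolvent z] times the last
    block column, that is [- Q z]; hence the sign [(-1) ^ k] in the constant. *)
Lemma det_shift_pencil (X T : 'M[C]_n) (Q : C -> 'M[C]_k) :
  X *m firstD R d.+1 k = bshift R d.+1 k 1 -> T *m firstD R d.+1 k = firstD R d.+1 k ->
  (forall z r c, Q z r c = - \sum_(j < d.+1) z ^+ j *
     (X - z *: T) (bidx (ltn0Sn d) k0 j r) (bidx (ltn0Sn d) k0 d c)) ->
  exists2 s : C, s != 0 & forall z, \det (X - z *: T) = s * \det (Q z).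
Proof.
move=> hX hT hQ; pose U := colrot R d.+1 k.
have uU : \det U != 0 by rewrite -unitfE; exact: colrot_unit.
exists ((-1) ^+ k * (\det U)^-1) => [|z]; first by rewrite mulf_neq0 ?invr_eq0 ?signr_eq0.
rewrite [in LHS](shift_pencil (ltn0Sn d) z hX hT) det_mulmx det_1_shift // mul1r.
set K := _ *m (_ *m _).
apply: (mulIf uU); rewrite -det_mulmx mulrAC divfK //.
have UE m (Y : 'M[C]_(m, n)) a (b c : 'I_n) : c = ((b + d * k) %% n)%N :> nat -> (Y *m U) a b = Y a c.
  move=> hc; rewrite mxE (bigD1 c) //= mxE hc eqxx mulr1 big1 ?addr0 // => l hl.
  rewrite mxE; case: eqP => [E|_]; last by rewrite mulr0.
  by case/eqP: hl; apply: val_inj; rewrite /= E hc.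
have KP : K = K *m lastD R d.+1 k.
  rewrite /K -!mulmxA; congr (_ *m (_ *m _)).
  by rewrite -[LHS]mulmx1 -(first_last R d.+1 k) mulmxDr lastD_firstD add0r.
have nE : n = (k + d * k)%N by [].
rewrite (det_first_block k0) => [|a b hb]; last first.
  have hb2 : (b - k < n)%N by have := ltn_ord b; lia.
  rewrite (UE _ _ _ _ (Ordinal hb2)); last first.
    have -> : (b + d * k)%N = (b - k + n)%N by have := nE; lia.
    by rewrite modnDr modn_small.
  rewrite addmxE KP mulmx_lastD /=; case: leqP => [h|_].
    by have := ltn_ord b; have := nE; lia.
  by rewrite addr0 mxE /= mul1n subnK.
rewrite -detZ; congr (\det _); apply/matrixP => r c; rewrite [LHS]mxE [RHS]mxE hQ mulN1r opprK.
have hd : (d < d.+1)%N by [].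
rewrite (UE _ _ _ _ (bidx (ltn0Sn d) k0 d c)); last first.
  by rewrite bidxE //= modn_small ?[(c + _)%N]addnC //; have := ltn_ord c; have := nE; lia.
rewrite addmxE mxE [X in X + _](_ : _ = 0) ?add0r; last first.
  case: eqP => // E; have := ltn_ord r; rewrite /= in E; rewrite E bidxE //; lia.
rewrite /K /resolvent mulmx_suml summxE; apply: eq_bigr => j _.
rewrite -scalemxAl mxE; congr (_ * _).
rewrite mxE (bigD1 (bidx (ltn0Sn d) k0 j r)) //= [X in _ + X]big1 ?addr0 => [|l hl]; last first.
  rewrite !mxE /=; case: eqP => [E|_]; last by rewrite mul0r.
  by case/eqP: hl; apply: val_inj; rewrite /= E bidxE // addnC.
rewrite mulmx_lastD [X in (_ <= X)%N]bidxE //= leq_addr.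
have -> : (bshift R d.+1 k j)^T (lshift (d * k) r) (bidx (ltn0Sn d) k0 j r) = 1.
  by rewrite !mxE bidxE //= addnC eqxx.
by rewrite mul1r.
Qed.

End PencilDeterminant2.

Section Eigenvalues.
Variable R : realType.
Local Notation C := R[i].

Lemma scalemxE m n (a : C) (A : 'M[C]_(m, n)) i j : (a *: A) i j = a * A i j.
Proof. by rewrite mxE. Qed.

Lemma splitting_coef d k (P M N : nat -> 'M[C]_k) i : (0 < d)%N -> splitting d P M N ->
  (i < d.+1)%N ->
  P i = (if (i < d)%N then M i else 0) + (if (0 < i)%N then N i else 0).
Proof.
move=> d0 [h0 hd hm]; rewrite ltnS leq_eqVlt => /orP[/eqP ->|hi].
  by rewrite ltnn d0 hd add0r.
by case: i hi => [|i] hi; rewrite hi ?h0 ?addr0 //= hm.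
Qed.

Lemma sum_splitting d k (P M N : nat -> 'M[C]_k) z : (0 < d)%N -> splitting d P M N ->
  \sum_(i < d.+1) z ^+ i *: P i = \sum_(j < d) z ^+ j *: (M j + z *: N j.+1).
Proof.
move=> d0 hs; have E i := splitting_coef d0 hs (i := i).
under eq_bigr => i _ do rewrite E // scalerDr.
rewrite big_split /= big_ord_recr /= ltnn scaler0 addr0.
rewrite [X in _ + X]big_ord_recl /= scaler0 add0r -big_split /=.
apply: eq_bigr => j _; rewrite ltn_ord scalerDr; congr (_ + _).
by rewrite scalerA /bump /= add1n exprSr.
Qed.

Lemma det_pencil d k (P M N : nat -> 'M[C]_k) : (0 < d)%N -> (0 < k)%N ->
  splitting d P M N ->
  exists2 s : C, s != 0 & forall z,
    \det (pencilS d M - z *: pencilT d N) = s * \det (\sum_(i < d.+1) z ^+ i *: P i).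
Proof.
case: d => // d _ k0 hs.
apply: (@det_shift_pencil R d k k0 (pencilS d.+1 M) (pencilT d.+1 N)
  (fun z => \sum_(i < d.+2) z ^+ i *: P i)).
- exact: pencilS_firstD.
- exact: pencilT_firstD.
move=> z r c; rewrite (sum_splitting z (ltn0Sn d) hs) summxE -sumrN; apply: eq_bigr => j _.
rewrite addmxE oppmxE !scalemxE addmxE scalemxE pencilS_entry // pencilT_entry //.
by rewrite -opprD mulrN opprK.
Qed.

Lemma poly_horner_inj (p q : {poly C}) : (forall x, p.[x] = q.[x]) -> p = q.
Proof.
move=> h; apply/eqP; rewrite -subr_eq0; apply/eqP; set r := p - q.
apply: (@roots_geq_poly_eq0 _ r [seq (i%:R : C) | i <- iota 0 (size r)]).
- by apply/allP => x _; rewrite /root /r hornerD hornerN h subrr.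
- rewrite map_inj_uniq ?iota_uniq // => i j /eqP; rewrite eqr_nat => /eqP //.
- by rewrite size_map size_iota.
Qed.

Lemma horner_det_polymx d k (P : nat -> 'M[C]_k) z :
  (\det (polymx d P)).[z] = \det (\sum_(i < d.+1) z ^+ i *: P i).
Proof.
rewrite -[LHS]/(horner_eval z _) -det_map_mx; congr (\det _).
apply/matrixP => r c; rewrite [LHS]mxE [RHS]summxE /polymx summxE rmorph_sum /=.
by apply: eq_bigr => i _; rewrite !mxE /horner_eval hornerM hornerXn hornerC.
Qed.

Lemma mup_prod (I : eqType) (r : seq I) (p : I -> {poly C}) z :
  (forall i, i \in r -> p i != 0) ->
  \prod_(i <- r) p i != 0 /\ mup z (\prod_(i <- r) p i) = (\sum_(i <- r) mup z (p i))%N.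
Proof.
elim: r => [|i r IH] h.
  rewrite !big_nil oner_eq0; split=> //; apply: mupNroot.
  by rewrite /root hornerC oner_eq0.
have [h1 h2] : \prod_(i <- r) p i != 0 /\ mup z (\prod_(i <- r) p i) = (\sum_(i <- r) mup z (p i))%N.
  by apply: IH => j hj; apply: h; rewrite inE hj orbT.
have hi : p i != 0 by apply: h; rewrite inE eqxx.
by rewrite !big_cons mulf_neq0 // mupM // h2.
Qed.

Lemma mup_linear (a b z : C) : (b != 0) || (a != 0) ->
  (a%:P - b *: 'X != 0) /\ mup z (a%:P - b *: 'X) = (b != 0) && (z == a / b) :> nat.
Proof.
have [->|b0] := eqVneq b 0 => /= h.
  rewrite scale0r subr0 polyC_eq0 h; split=> //; apply: mupNroot.
  by rewrite /root hornerC.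
have E : a%:P - b *: 'X = (- b)%:P * ('X - (a / b)%:P).
  have h' : - b * (a / b) = - a by rewrite mulNr mulrC divfK.
  by rewrite mulrBr -polyCM h' !polyCN opprK mulNr mul_polyC addrC.
rewrite E; split; first by rewrite mulf_neq0 ?polyXsubC_eq0 // polyC_eq0 oppr_eq0.
rewrite mupMr; last by rewrite /root hornerC oppr_eq0.
by rewrite -['X - _]expr1 mup_XsubCX eq_sym; case: eqP.
Qed.

Lemma count_nth (T : eqType) (x0 v : T) (s : seq T) :
  count_mem v s = (\sum_(j < size s) (nth x0 s j == v))%N.
Proof.
rewrite -sum1_count (big_nth x0) big_mkord [LHS]big_mkcond; apply: eq_bigr => i _ /=.
by case: eqP.
Qed.

(** Finite eigenvalues are counted in the linear factors [sv j - z * tv j]. The reversed determinant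
    is the product of the [z * sv j - tv j] up to the same constant, and such a factor vanishes at 0
    exactly when [tv j = 0]. *)
Lemma eigenvalues_of_factored d k (P : nat -> 'M[C]_k) evs (sv tv : nat -> C) (s0 : C) :
  s0 != 0 ->
  (forall z, \det (\sum_(i < d.+1) z ^+ i *: P i) = s0 * \prod_(j < d * k) (sv j - z * tv j)) ->
  size evs = (d * k)%N ->
  (forall j, (j < d * k)%N -> match nth None evs j with
     | Some z => tv j != 0 /\ z = sv j / tv j
     | None => tv j = 0 /\ sv j != 0 end) ->
  eigenvalues_of d P evs.
Proof.
move=> s00 hdet hsz hev.
have nz j : (j < d * k)%N -> (tv j != 0) || (sv j != 0).
  by move=> hj; have := hev j hj; case: (nth _ _ _) => [z [-> //]|[_ ->]]; rewrite orbT.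
pose p (j : 'I_(d * k)) := (sv j)%:P - tv j *: 'X.
pose p' (j : 'I_(d * k)) := (- tv j)%:P - (- sv j) *: 'X.
have E : \det (polymx d P) = s0%:P * \prod_j p j.
  apply: poly_horner_inj => z; rewrite horner_det_polymx hdet hornerM hornerC horner_prod.
  by congr (_ * _); apply: eq_bigr => j _; rewrite /p !hornerE mulrC.
have E' : \det (polymx d (fun i => P (d - i)%N)) = s0%:P * \prod_j p' j.
  have X0 : 'X != 0 :> {poly C} by rewrite polyX_eq0.
  (* Reversal uses [z^-1]. Comparing the polynomials after multiplication by ['X] makes the point
     [z = 0] trivial. *)
  apply: (mulfI X0); apply: poly_horner_inj => z; rewrite !hornerM hornerX.
  have [->|z0] := eqVneq z 0; first by rewrite !mul0r.
  congr (_ * _); rewrite horner_det_polymx hornerC horner_prod.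
  have -> : \sum_(i < d.+1) z ^+ i *: P (d - i)%N = z ^+ d *: \sum_(i < d.+1) (z^-1) ^+ i *: P i.
    rewrite scaler_sumr (reindex_inj rev_ord_inj) /=; apply: eq_bigr => i _.
    rewrite subSS subKn -1?ltnS // scalerA; congr (_ *: _).
    by rewrite exprVn expfB_cond // (negbTE z0) add0n -ltnS.
  rewrite detZ hdet mulrCA; congr (_ * _).
  rewrite -exprM -[X in z ^+ X](card_ord (d * k)) -prodr_const -big_split /=.
  apply: eq_bigr => j _; rewrite /p' !hornerE mulrBr mulrA mulfV // mul1r.
  by rewrite mulNr opprK addrC mulrC.
have np j : p j != 0 by have [] := @mup_linear (sv j) (tv j) 0 (nz j (ltn_ord j)).
have np' j : p' j != 0.
  by have [] := @mup_linear (- tv j) (- sv j) 0; rewrite ?oppr_eq0 1?orbC ?nz.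
have cs z : ~~ root s0%:P z by rewrite /root hornerC.
split.
- rewrite E mulf_neq0 ?polyC_eq0 //.
  by have [] := @mup_prod _ (index_enum 'I_(d * k)) p 0 (fun j _ => np j).
- move=> z; rewrite E mupMr //.
  have [_ ->] := @mup_prod _ (index_enum 'I_(d * k)) p z (fun j _ => np j).
  rewrite (count_nth None) hsz; apply: eq_bigr => j _.
  have [_ ->] := @mup_linear (sv j) (tv j) z (nz j (ltn_ord j)).
  have := hev j (ltn_ord j); case: (nth _ _ _) => [w [-> ->]|[-> _]]; last by rewrite eqxx.
  by rewrite /= eq_sym; congr nat_of_bool; apply/eqP/eqP => [[->]|->].
- rewrite E' mupMr //.
  have [_ ->] := @mup_prod _ (index_enum 'I_(d * k)) p' 0 (fun j _ => np' j).
  rewrite (count_nth None) hsz; apply: eq_bigr => j _.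
  have hj : (- sv j != 0) || (- tv j != 0) by rewrite !oppr_eq0 orbC nz.
  have [_ ->] := @mup_linear (- tv j) (- sv j) 0 hj.
  have := hev j (ltn_ord j); case: (nth _ _ _) => [w [t0 _]|[-> s1]].
    by rewrite (eq_sym 0) mulf_eq0 invr_eq0 !oppr_eq0 (negbTE t0) /=; case: (sv j == 0).
  by rewrite oppr_eq0 s1 oppr0 mul0r !eqxx.
Qed.

End Eigenvalues.

(** * The initial factorizations *)

Section InitialProducts.
Variable R : realType.
Local Notation C := R[i].

Lemma spikemx_mul n p l (c : 'I_n) (v : 'cV[C]_n) (X : 'M[C]_(n, p)) a b : c = l :> nat ->
  (spikemx l v *m X) a b = v a 0 * X c b + (if a == c then 0 else X a b).
Proof.
move=> <-; rewrite mxE (bigD1 c) //= !mxE eqxx; congr (_ + _).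
have [->|ac] := eqVneq a c.
  rewrite big1 // => x lc; rewrite mxE (negbTE (lc : x != c :> nat)) eq_sym (negbTE lc).
  by rewrite mul0r.
rewrite (bigD1 a) //= mxE (negbTE (ac : a != c :> nat)) eqxx mul1r big1 ?addr0 //.
move=> x /andP[lc la]; rewrite mxE (negbTE (lc : x != c :> nat)) eq_sym (negbTE la).
by rewrite mul0r.
Qed.

(** The leading factor has the rightmost spike, in column [c]. By triangularity, row [c] of the
    product of the remaining factors is that of the identity, so the spike only fills column [c]:
    the product is formed without arithmetic. *)
Lemma lprod_spikes n (T : 'M[C]_n) (cs : seq 'I_n) :
  sorted (fun c c' : 'I_n => (c' < c)%N) cs ->
  (forall (a c : 'I_n), c \in cs -> (c < a)%N -> T a c = 0) ->
  lprod [seq spikemx c (col c T) | c : 'I_n <- cs] =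
  \matrix_(a, b) if b \in cs then T a b else (a == b)%:R.
Proof.
have tr : transitive (fun c c' : 'I_n => (c' < c)%N).
  by move=> x y z h1 h2; exact: ltn_trans h2 h1.
elim: cs => [|c cs IH] hs hT /=; first by apply/matrixP => a b; rewrite !mxE.
have hc : all (fun c' : 'I_n => (c' < c)%N) cs by exact: order_path_min tr hs.
rewrite IH; [|exact: path_sorted hs|by move=> a c' h; apply: hT; rewrite inE h orbT].
apply/matrixP => a b; rewrite (spikemx_mul _ _ _ _ (erefl (nat_of_ord c))) !mxE inE.
have [->|bc] := eqVneq b c.
  have -> : c \in cs = false by apply/negP => /(allP hc); rewrite ltnn.
  by rewrite /= mulr1; case: (a == c); rewrite addr0.
rewrite /=; case: ifPn => [hb|hb].
  have -> : T c b = 0 by apply: hT; rewrite ?inE ?hb ?orbT //; exact: (allP hc).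
  rewrite mulr0 add0r; case: eqP => // ->.
  by rewrite hT ?inE ?hb ?orbT //; exact: (allP hc).
by rewrite mulr0 add0r; case: eqP => // ->; rewrite eq_sym (negbTE bc).
Qed.

Lemma fnorm_patch n (T : 'M[C]_n) (f : pred 'I_n) t : fnorm T <= t ->
  fnorm (\matrix_(a, b) if f b then T a b else (a == b)%:R) <= n%:R + n%:R * t.
Proof.
move=> ht; pose E : 'M[C]_n := \matrix_(a, b) ((a == b) && ~~ f b)%:R.
pose G : 'M[C]_n := \matrix_(a, b) ((a == b) && f b)%:R.
have -> : (\matrix_(a, b) if f b then T a b else (a == b)%:R) = E + T *m G.
  apply/matrixP => a b; rewrite addmxE !mxE (bigD1 b) //= big1 => [|c cb].
    by rewrite !mxE eqxx addr0; case: (f b); rewrite ?andbF ?andbT ?add0r ?mulr1 ?mulr0 ?addr0.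
  by rewrite mxE (negbTE cb) mulr0.
apply: le_trans (fnormD _ _) _; apply: lerD.
  by apply: fnorm_boolmx => x y b /andP[/eqP -> _] /andP[/eqP -> _].
apply: le_trans (fnormM _ _) _; rewrite mulrC; apply: ler_pM; rewrite ?fnorm_ge0 //.
by apply: fnorm_boolmx => x y b /andP[/eqP -> _] /andP[/eqP -> _].
Qed.

Lemma subproducts_map n (T : Type) (f : T -> 'M[C]_n) cs b :
  (forall x y z, cs = x ++ y ++ z -> fnorm (lprod (map f y)) <= b) ->
  subproducts_le b (map f cs).
Proof.
move=> h l1 l2 l3 E.
have h1 : map f (take (size l1) cs) = l1 by rewrite map_take E take_size_cat.
have h2 : map f (drop (size l1) cs) = l2 ++ l3 by rewrite map_drop E drop_size_cat.
have h3 : map f (take (size l2) (drop (size l1) cs)) = l2 by rewrite map_take h2 take_size_cat.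
rewrite -h3; apply: (h (take (size l1) cs) _ (drop (size l2) (drop (size l1) cs))).
by rewrite !cat_take_drop.
Qed.

Lemma subproducts_unitary_cons n (U : 'M[C]_n) l b : U \is unitarymx ->
  subproducts_le b l -> subproducts_le b (U :: l).
Proof.
move=> hU hl [|A l1] [|B l2] l3 /= E.
- exact: (hl [::] [::] l).
- case: E => <- E; rewrite (fnorm_unitaryl _ hU); exact: (hl [::] l2 l3).
- exact: (hl [::] [::] l).
- case: E => _ E; exact: (hl l1 (B :: l2) l3).
Qed.

Lemma subproducts_spikes n (T : 'M[C]_n) (cs : seq 'I_n) t :
  sorted (fun c c' : 'I_n => (c' < c)%N) cs ->
  (forall (a c : 'I_n), c \in cs -> (c < a)%N -> T a c = 0) ->
  fnorm T <= t ->
  subproducts_le (n%:R + n%:R * t) [seq spikemx c (col c T) | c : 'I_n <- cs].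
Proof.
move=> hs hT ht; apply: subproducts_map => x y z E.
have hy : sorted (fun c c' : 'I_n => (c' < c)%N) y.
  by move: hs; rewrite E => /cat_sorted2[_ /cat_sorted2[]].
rewrite lprod_spikes //; first exact: (fnorm_patch (fun b => b \in y) ht).
by move=> a c hc; apply: hT; rewrite E !mem_cat hc orbT.
Qed.

Lemma downshift_unitary n : downshift R n \is unitarymx.
Proof.
case: n => [|n]; first by apply/unitarymxP; apply/matrixP => -[].
apply/unitarymxP; apply/matrixP => a b; rewrite !mxE.
pose c := Ordinal (ltn_pmod (a + n) (ltn0Sn n)).
have hc (l : 'I_n.+1) : (a == l.+1 %% n.+1 :> nat)%N = (l == c).
  rewrite -val_eqE /=; have := ltn_ord a; have := ltn_ord l => hl ha.
  have [E|E] := eqVneq (l : nat) n.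
    rewrite E modnn; have [->|a0] := posnP a; first by rewrite add0n modn_small // !eqxx.
    rewrite addnC -(ltn_predK a0) -addSnnS modnDl modn_small; last by lia.
    by lia.
  rewrite modn_small; last by lia.
  have [->|a0] := posnP a; first by rewrite add0n modn_small //; lia.
  rewrite addnC -(ltn_predK a0) -addSnnS modnDl modn_small; last by lia.
  by lia.
rewrite (bigD1 c) //= big1 => [|l lc]; last by rewrite !mxE hc (negbTE lc) mul0r.
rewrite addr0 !mxE hc eqxx mul1r.
have -> : (b == c.+1 %% n.+1 :> nat)%N = (a == b).
  have /eqP <- : (a == c.+1 %% n.+1 :> nat)%N by rewrite hc.
  by rewrite eq_sym.
by rewrite rmorph_nat.
Qed.

Lemma downshift_trM n : (downshift R n)^T *m downshift R n = 1%:M.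
Proof.
rewrite -[RHS](unitary_adj_mul (downshift_unitary n)); congr (_ *m _).
by apply/matrixP => a b; rewrite !mxE rmorph_nat.
Qed.

Lemma downshift_tr_expr n m (X : 'M[C]_n) (a a' b : 'I_n) :
  a' = ((a + m) %% n)%N :> nat -> (((downshift R n)^T ^+ m) *m X) a b = X a' b.
Proof.
elim: m a => [|m IH] a ha.
  rewrite expr0 mul1mx; congr (X _ _); apply: val_inj.
  by rewrite /= ha addn0 modn_small.
have hn : (0 < n)%N by exact: leq_ltn_trans (ltn_ord a).
pose c := Ordinal (ltn_pmod a.+1 hn).
rewrite exprS -mulmxA mxE (bigD1 c) //= big1 => [|l lc]; last first.
  by rewrite !mxE (negbTE (lc : l != (a.+1 %% n)%N :> nat)) mul0r.
rewrite addr0 [X in X * _]mxE [X in X * _]mxE eqxx mul1r; apply: IH.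
by rewrite ha /= modnDml addnS addSn.
Qed.

End InitialProducts.

(** * The spike factorizations of the block companion pencil *)

Section LastColumns.
Variable R : realType.
Local Notation C := R[i].

Lemma mem_lastcols d k (c : 'I_(d * k)) : (c \in lastcols d k) = (d.-1 * k <= c)%N.
Proof. by rewrite mem_filter mem_enum andbT. Qed.

Lemma val_lastcols d k : (0 < d)%N ->
  [seq val c | c <- lastcols d k] = iota (d.-1 * k) k.
Proof.
move=> d0; rewrite /lastcols.
rewrite -(filter_map val (fun c => (d.-1 * k <= c)%N)) val_enum_ord.
have -> : (d * k = d.-1 * k + k)%N by rewrite -mulSnr prednK.
rewrite iotaD filter_cat add0n.
rewrite (eq_in_filter (a2 := pred0)) => [|c]; last first.
  by rewrite mem_iota add0n => /andP[_ h]; rewrite leqNgt h.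
rewrite filter_pred0 (eq_in_filter (a2 := predT)) ?filter_predT // => c.
by rewrite mem_iota => /andP[].
Qed.

Lemma size_lastcols d k : (0 < d)%N -> size (lastcols d k) = k.
Proof. by move=> d0; rewrite -(size_map val) val_lastcols // size_iota. Qed.

Lemma sorted_rev_lastcols d k : (0 < d)%N ->
  sorted (fun c c' : 'I_(d * k) => (c' < c)%N) (rev (lastcols d k)).
Proof.
move=> d0; rewrite rev_sorted.
rewrite -(@sorted_map _ _ val (fun x y => (x < y)%N)) val_lastcols //.
exact: iota_ltn_sorted.
Qed.

Lemma word_downshift n : word_mx n (downshift_word R n) = downshift R n.
Proof.
(* The first [t] flips multiply to the cyclic downshift of the first [t + 1] coordinates. *)
have Hc t : (t <= n.-1)%N -> forall a b : 'I_n,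
    word_mx n [seq Core i (flip R) | i <- iota 0 t] a b =
    (a == (if (b < t)%N then b.+1 else if b == t :> nat then 0%N else b) :> nat)%:R.
  elim: t => [|t IH] ht a b.
    by rewrite /word_mx /= mxE -val_eqE /=; case: (eqVneq (b : nat) 0%N) => [->|].
  have t0 : (t < n)%N by lia.
  have t1 : (t.+1 < n)%N by lia.
  rewrite /word_mx -[t.+1]addn1 iotaD map_cat map_cat lprod_cat /= mulmx1 add0n.
  have hI := IH (ltnW ht).
  have [E|bt] := eqVneq (b : nat) t.
    rewrite (mul_core_in _ _ _ (b0 := Ordinal t0) (b1 := Ordinal t1) (s := 0)) ?addn0 //.
    rewrite !mxE /= mulr0 mulr1 add0r hI /= E.
    have -> : (t.+1 < t)%N = false by lia.
    have -> : (t.+1 == t) = false by lia.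
    by rewrite addn1 ltnSn.
  have [E|bt1] := eqVneq (b : nat) t.+1.
    rewrite (mul_core_in _ _ _ (b0 := Ordinal t0) (b1 := Ordinal t1) (s := 1)) ?addn1 //.
    by rewrite !mxE /= mulr0 mulr1 addr0 hI /= E ?addn1 !ltnn !eqxx.
  rewrite mul_core_out // hI addn1 (negbTE bt) (negbTE bt1); congr (nat_of_bool (_ == _))%:R.
  by rewrite ltnS (leq_eqVlt b) (negbTE bt).
apply/matrixP => a b; rewrite Hc // mxE; congr (nat_of_bool (_ == _))%:R.
have hb := ltn_ord b; case: ifP => h; first by rewrite modn_small //; lia.
have E : b = n.-1 :> nat by lia.
by rewrite E eqxx prednK ?modnn //; lia.
Qed.

Variables d k : nat.
Hypotheses (d0 : (0 < d)%N) (k0 : (0 < k)%N).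
Local Notation n := (d * k)%N.
Local Notation c0 := (d.-1 * k)%N.
Local Notation Q := (downshift R n).
Variables (M N : nat -> 'M[C]_k).
Local Notation S := (pencilS d M).
Local Notation T := (pencilT d N).

Lemma n_split : n = (c0 + k)%N. Proof. by rewrite -mulSnr prednK. Qed.

Lemma pencil_upperT (a b : 'I_n) : is_trig_mx (N d)^T -> (c0 <= b)%N -> (b < a)%N -> T a b = 0.
Proof.
move=> /is_trig_mxP hN hb ab; rewrite mxE ltnNge hb /=.
have ha := ltn_ord a; have E := n_split.
have -> : (a %/ k).+1 = d.
  by have := div_lt_d k0 a; have : (d.-1 <= a %/ k)%N by [rewrite leq_divRL //; lia]; lia.
have := hN (inner b) (inner a); rewrite mxE; apply; rewrite /=.
have -> : nat_of_ord b = (d.-1 * k + (b - c0))%N by lia.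
have -> : nat_of_ord a = (d.-1 * k + (a - c0))%N by lia.
by rewrite !modnMDl !modn_small; lia.
Qed.

Lemma lprod_spikesT : is_trig_mx (N d)^T ->
  lprod [seq spikemx lv.1 lv.2 | lv <- spikesT T] = T.
Proof.
move=> hN; rewrite /spikesT -map_comp.
rewrite (lprod_spikes (T := T) (sorted_rev_lastcols k d0)); last first.
  by move=> a c; rewrite mem_rev mem_lastcols; exact: pencil_upperT.
apply/matrixP => a b; rewrite !mxE mem_rev mem_lastcols.
by case: (leqP c0 b).
Qed.

Lemma subproducts_spikesT t : is_trig_mx (N d)^T -> fnorm T <= t ->
  subproducts_le (n%:R + n%:R * t) [seq spikemx lv.1 lv.2 | lv <- spikesT T].
Proof.
move=> hN ht; rewrite /spikesT -map_comp.
apply: (subproducts_spikes (sorted_rev_lastcols k d0)) ht => a c.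
by rewrite mem_rev mem_lastcols; exact: pencil_upperT.
Qed.

Lemma pencilS_first (r : 'I_n) (b : 'I_n) : (r < k)%N -> (c0 <= b)%N ->
  S r b = - M 0%N (inner r) (inner b).
Proof. by move=> hr hb; rewrite mxE ltnNge hb /= divn_small. Qed.

Lemma pencil_upperG (a b : 'I_n) : is_trig_mx (M 0%N)^T -> (c0 <= b)%N -> (b < a)%N ->
  ((Q^T ^+ k) *m S) a b = 0.
Proof.
move=> /is_trig_mxP hM hb ab; have E := n_split; have ha := ltn_ord a.
have hr : (a - c0 < n)%N by lia.
have Er : (a + k = 1 * n + (a - c0))%N by lia.
rewrite (@downshift_tr_expr R _ _ _ _ (Ordinal hr)); last by rewrite Er modnMDl modn_small.
rewrite pencilS_first //=; last by lia.
have := hM (inner b) (inner (Ordinal hr)); rewrite mxE => ->; first by rewrite oppr0.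
rewrite /=; have -> : nat_of_ord b = (d.-1 * k + (b - c0))%N by lia.
by rewrite modnMDl !modn_small; lia.
Qed.

Lemma lprod_spikesG : is_trig_mx (M 0%N)^T ->
  lprod [seq spikemx lv.1 lv.2 | lv <- spikesG S] = (Q^T ^+ k) *m S.
Proof.
move=> hM; rewrite /spikesG /spikesT -map_comp.
rewrite (lprod_spikes (sorted_rev_lastcols k d0)); last first.
  by move=> a c; rewrite mem_rev mem_lastcols; exact: pencil_upperG.
apply/matrixP => a b; rewrite mxE mem_rev mem_lastcols; case: (leqP c0 b) => // hb.
have hr : ((a + k) %% n < n)%N by rewrite ltn_mod n_gt0.
rewrite (@downshift_tr_expr R _ _ _ _ (Ordinal hr)) // mxE hb /=; congr (nat_of_bool _)%:R.
have E := n_split; have ha := ltn_ord a; rewrite -val_eqE /=.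
have [h|h] := ltnP (a + k)%N n; first by rewrite modn_small // eqn_add2r.
have -> : (a + k = 1 * n + (a - c0))%N by lia.
by rewrite modnMDl modn_small; lia.
Qed.

Lemma subproducts_spikesG t : is_trig_mx (M 0%N)^T -> fnorm ((Q^T ^+ k) *m S) <= t ->
  subproducts_le (n%:R + n%:R * t) [seq spikemx lv.1 lv.2 | lv <- spikesG S].
Proof.
move=> hM ht; rewrite /spikesG /spikesT -map_comp.
apply: (subproducts_spikes (sorted_rev_lastcols k d0)) ht => a c.
by rewrite mem_rev mem_lastcols; exact: pencil_upperG.
Qed.

Local Notation W p := ((Q^T ^+ (p - c0)) *m S).

Lemma pencil_lowerF p (a b : 'I_n) : is_trig_mx (M 0%N) -> (c0 <= p)%N -> (p < b)%N ->
  a = n.-1 :> nat -> W p.+1 a b = 0.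
Proof.
move=> /is_trig_mxP hM hp pb Ea; have E := n_split; have hb := ltn_ord b.
have hr : (p - c0 < n)%N by lia.
have Er : (a + (p.+1 - c0) = 1 * n + (p - c0))%N by lia.
rewrite (@downshift_tr_expr R _ _ _ _ (Ordinal hr)); last by rewrite Er modnMDl modn_small.
rewrite pencilS_first //=; [|lia|lia].
rewrite hM ?oppr0 //=; have -> : nat_of_ord b = (d.-1 * k + (b - c0))%N by lia.
by rewrite modnMDl !modn_small; lia.
Qed.

(** Right multiplication keeps the columns [p, ..., p + L - 1] only and places them in the last [L]
    positions. *)
Definition frob_select p L : 'M[C]_n :=
  \matrix_(c, b) ((n <= b + L)%N && (c == (b + p + L - n)%N :> nat))%:R.

Lemma frob_selectE (X : 'M[C]_n) p L (a b c : 'I_n) : (n <= b + L)%N ->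
  c = (b + p + L - n)%N :> nat -> (X *m frob_select p L) a b = X a c.
Proof.
move=> h hc; rewrite mxE (bigD1 c) //= mxE h hc eqxx mulr1 big1 ?addr0 // => l lc.
by rewrite mxE h -hc (negbTE (lc : l != c :> nat)) mulr0.
Qed.

Lemma frob_select0 (X : 'M[C]_n) p L (a b : 'I_n) : (b + L < n)%N ->
  (X *m frob_select p L) a b = 0.
Proof.
by move=> h; rewrite mxE big1 // => l _; rewrite mxE leqNgt h mulr0.
Qed.

(** The companion factor [Q R_i] for [i = c - c0 + 1]: its spike is column [c] of [S] rotated
    upwards [i] times. *)
Definition frob_factor (c : 'I_n) : 'M[C]_n := Q *m spikemx n.-1 (col c (W c.+1)).

(* The last entries of the rotated columns vanish because M_0 is lower
   triangular, so that a factor leaves the columns to its right unchanged. *)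
Lemma frob_chain (cs : seq 'I_n) p : is_trig_mx (M 0%N) -> (c0 <= p)%N ->
  (p + size cs <= n)%N -> [seq val c | c <- cs] = iota p (size cs) ->
  lprod [seq frob_factor c | c <- cs] =
  (\matrix_(a, b) (a == (b + size cs)%N :> nat)%:R) + W p *m frob_select p (size cs).
Proof.
move=> hM; elim: cs p => [|c cs IH] p hp hn /=.
  move=> _; apply/matrixP => a b; rewrite addmxE frob_select0 ?addn0 ?addr0 //.
  by rewrite !mxE addn0.
case=> hc hcs; have hn1 : (p.+1 + size cs <= n)%N by rewrite addSnnS.
rewrite (IH p.+1) //; last by lia.
have QQ := downshift_trM R n; have QQ' : Q *m Q^T = 1%:M by exact: mulmx1C.
have -> : W p = Q *m W p.+1 by rewrite subSn // exprS -mulmxA (mulmxA Q) QQ' mul1mx.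
have -> : (\matrix_(a, b) (a == (b + (size cs).+1)%N :> nat)%:R : 'M[C]_n) =
    Q *m (Q^T *m \matrix_(a, b) (a == (b + (size cs).+1)%N :> nat)%:R).
  by rewrite mulmxA QQ' mul1mx.
rewrite /frob_factor hc; set X := W p.+1.
have hX (x y : 'I_n) : (p < y)%N -> x = n.-1 :> nat -> X x y = 0 by exact: pencil_lowerF.
clearbody X.
rewrite -(mulmxA Q X) -mulmxA -mulmxDr; congr (_ *m _).
set L := size cs; have n0 := n_gt0 d0 k0; have hl : (n.-1 < n)%N by rewrite prednK.
pose l := Ordinal hl; apply/matrixP => a b.
rewrite (spikemx_mul _ _ _ _ (erefl n.-1 : nat_of_ord l = n.-1)) !addmxE [col _ _ _ _]mxE.
have EQ : (Q^T *m \matrix_(a, b) (a == (b + L.+1)%N :> nat)%:R) a b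
    = (a.+1 %% n == b + L.+1)%N%:R :> C.
  have h1 : (a.+1 %% n < n)%N by rewrite ltn_mod.
  have -> : Q^T = Q^T ^+ 1 by [].
  by rewrite (@downshift_tr_expr R _ _ _ _ (Ordinal h1)) ?addn1 // mxE.
rewrite EQ; have ha := ltn_ord a; have hb := ltn_ord b.
have la : (a == l) = (a == n.-1 :> nat) by [].
(* Three kinds of columns: shifted unit vectors; columns already produced by the remaining factors,
   whose last entry vanishes so that the new spike does not act on them; and, at equality, the unit
   vector that picks up the new spike. *)
have [h|h|h] := ltngtP (b + L.+1)%N n.
- rewrite !frob_select0 ?addr0; [|lia ..].
  rewrite !mxE /= la; have -> : (n.-1 == b + L)%N = false by lia.
  rewrite mulr0 add0r; have [E|E] := eqVneq (a : nat) n.-1.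
    by rewrite E prednK // modnn addnS.
  by rewrite modn_small ?addnS //; lia.
- have hs : (b + p + L.+1 - n < n)%N by lia.
  pose s := Ordinal hs.
  rewrite !(@frob_selectE _ _ _ _ _ s) //=; [|lia ..].
  rewrite !mxE.
  have -> : (n.-1 == b + L)%N = false by lia.
  have -> : (nat_of_ord a == b + L)%N = false by lia.
  have -> : (a.+1 %% n == b + L.+1)%N = false.
    by apply/negbTE; rewrite neq_ltn (leq_trans _ (ltnW h)) // ltn_mod.
  have ps : (p < s)%N by rewrite /=; lia.
  rewrite !add0r (hX l) // mulr0 add0r la.
  by case: eqP => // E; rewrite hX.
- rewrite !(@frob_select0 X p.+1 L) ?addr0; [|lia ..].
  have hs : (b + p + L.+1 - n = c)%N by rewrite hc; move: h; clear; lia.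
  rewrite (@frob_selectE _ _ _ _ _ c) ?hs //; last by rewrite h.
  rewrite !mxE.
  have -> : (n.-1 == b + L)%N by apply/eqP; lia.
  have -> : (a.+1 %% n == b + L.+1)%N = false by rewrite h ltn_eqF // ltn_mod.
  rewrite mulr1 add0r la; have -> : (nat_of_ord a == b + L)%N = (a == n.-1 :> nat) by lia.
  by case: eqP; rewrite ?addr0.
Qed.

End LastColumns.

Section InitialStates.
Variable R : realType.
Local Notation C := R[i].

Lemma fnorm_col m n (X : 'M[C]_(m, n)) c : fnorm (col c X) <= fnorm X.
Proof. by rewrite colE; apply: le_trans (fnormM _ _) _; rewrite fnorm_delta mulr1. Qed.

Lemma unitary_expr n (U : 'M[C]_n) m : U \is unitarymx -> U ^+ m \is unitarymx.
Proof.
move=> hU; elim: m => [|m IH]; first by rewrite expr0; exact: unitary1.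
by rewrite exprS; exact: mul_unitarymx hU IH.
Qed.

Lemma near_gauge n g (l l' : seq 'M[C]_n) : near g l l' -> gauge g 1%:M l l' 1%:M.
Proof.
elim: l l' => [|A l IH] [|A' l'] //= [hA hl]; exists 1%:M.
by split; [exact: unitary1|rewrite mul1mx mulmx1|exact: IH].
Qed.

Lemma gauge_cons_unitary n g (U : 'M[C]_n) l l' : 0 <= g ->
  gauge g 1%:M l l' 1%:M -> gauge g 1%:M (U :: l) (U :: l') 1%:M.
Proof.
by move=> g0 h; exists 1%:M; split; [exact: unitary1|rewrite mul1mx mulmx1 subrr fnorm0|].
Qed.

Lemma flip_unitary : flip R \is unitarymx.
Proof.
apply/unitarymxP/matrixP => a b; rewrite mxE !big_ord_recl big_ord0 !mxE !rmorph_nat.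
case: a => [[|[|a]] ha] //; case: b => [[|[|b]] hb] //=.
all: by rewrite ?mulr0 ?mul0r ?mulr1 ?addr0 ?add0r.
Qed.

Lemma downshift_word_ok n r : word_ok n r (downshift_word R n).
Proof.
rewrite /downshift_word; have : all (fun i => i.+1 < n)%N (iota 0 n.-1).
  by apply/allP => i; rewrite mem_iota; lia.
elim: (iota _ _) => [|i s IH] //= /andP[hi /IH hs]; split; last exact: hs.
by split; [exact: hi|exact: flip_unitary].
Qed.

Lemma downshifts_ok n r m : word_ok n r (flatten (nseq m (downshift_word R n))).
Proof.
elim: m => [|m IH] //=; apply/word_ok_cat; split; [exact: downshift_word_ok|exact: IH].
Qed.

Lemma downshift_exprM n m : downshift R n ^+ m *m (downshift R n)^T ^+ m = 1%:M.
Proof.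
have QQ : downshift R n *m (downshift R n)^T = 1%:M by apply: mulmx1C; exact: downshift_trM.
elim: m => [|m IH]; first by rewrite !expr0 mulmx1.
by rewrite exprSr exprS -mulmxA (mulmxA (downshift R n)) QQ mul1mx.
Qed.

Lemma blocks_cores n (s : seq nat) (g : nat -> 'M[C]_2) w :
  blocks n ([seq Core i (g i) | i <- s] ++ w) =
  (word_mx n [seq Core i (g i) | i <- s] *m (blocks n w).1, (blocks n w).2).
Proof.
elim: s => [|i s IH] /=; first by rewrite /word_mx /= mul1mx; case: (blocks n w).
by rewrite IH /= /word_mx /= mulmxA.
Qed.

Lemma blocks_downshift n w :
  blocks n (downshift_word R n ++ w) = (downshift R n *m (blocks n w).1, (blocks n w).2).
Proof. by rewrite /downshift_word (blocks_cores n _ (fun=> flip R)) word_downshift. Qed.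

Lemma blocks_downshifts n m w :
  blocks n (flatten (nseq m (downshift_word R n)) ++ w) =
  (downshift R n ^+ m *m (blocks n w).1, (blocks n w).2).
Proof.
elim: m => [|m IH] /=; first by rewrite expr0 mul1mx; case: (blocks n w).
by rewrite -catA blocks_downshift IH /= exprS mulmxA.
Qed.

Lemma blocks_tri n (Fs : seq (factor R)) :
  blocks n [seq Tri A | A <- Fs] = (1%:M, [seq factor_mx n A | A <- Fs]).
Proof. by elim: Fs => [|A Fs IH] //=; rewrite IH /= mulmx1. Qed.

Lemma stored_factors n e b (L : seq (nat * 'cV[C]_n)) Fs :
  List.Forall2 (fl_stores e) L Fs -> 1 <= b -> 0 <= e -> 2 * b * (n%:R * e) <= 1 ->
  {in L, forall lv, fnorm lv.2 + 1 <= b} ->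
  near (32 * n%:R * e * b ^+ 2) [seq spikemx lv.1 lv.2 | lv <- L]
    [seq factor_mx n A | A <- Fs] /\
  word_ok n (2 * b)^-1 [seq Tri A | A <- Fs].
Proof.
move=> h b1 e0 hs; elim: h => [|[l v] F L' Fs' hF _ IH] //= hL.
have hv : fnorm v + 1 <= b by apply: (hL (l, v)); rewrite inE eqxx.
have [uF rF nF] := fl_stores_near hF b1 e0 hv hs.
have [|h1 h2] := IH; first by move=> lv h; apply: hL; rewrite inE h orbT.
by split; [split; [exact: nF|exact: h1]|split; [split; [exact: uF|exact: rF]|exact: h2]].
Qed.

Variables d k : nat.
Hypotheses (d0 : (0 < d)%N) (k0 : (0 < k)%N).
Local Notation n := (d * k)%N.
Local Notation c0 := (d.-1 * k)%N.
Local Notation Q := (downshift R n).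

Lemma fnorm_bool_sum (X E G : 'M[C]_n) (f h : 'I_n -> 'I_n -> bool) t : fnorm X <= t ->
  (forall a a' b, f a b -> f a' b -> a = a') -> (forall a a' b, h a b -> h a' b -> a = a') ->
  E = \matrix_(a, b) (f a b)%:R -> G = \matrix_(a, b) (h a b)%:R ->
  fnorm (E + X *m G) <= n%:R + n%:R * t.
Proof.
move=> ht hf hh -> ->; apply: le_trans (fnormD _ _) _; apply: lerD; first exact: fnorm_boolmx.
apply: le_trans (fnormM _ _) _; rewrite mulrC; apply: ler_pM; rewrite ?fnorm_ge0 //.
exact: fnorm_boolmx.
Qed.

Section FrobeniusFactors.
Variable M : nat -> 'M[C]_k.
Hypothesis hM : is_trig_mx (M 0%N).
Local Notation S := (pencilS d M).

Lemma lprod_frob : lprod [seq frob_factor M c | c <- lastcols d k] = S.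
Proof.
rewrite (frob_chain d0 k0 hM (leqnn c0)) ?size_lastcols ?val_lastcols //; last by rewrite -n_split.
rewrite subnn expr0 mul1mx; apply/matrixP => a b; rewrite addmxE mxE.
have E := n_split k d0; have hb := ltn_ord b.
case: (ltnP b c0) => h; first by rewrite frob_select0 ?addr0 ?mxE ?h //; lia.
rewrite (@frob_selectE _ _ _ _ _ _ _ _ b); [|lia|lia].
have -> : (nat_of_ord a == b + k)%N = false by have := ltn_ord a; lia.
by rewrite add0r.
Qed.

Lemma subproducts_frob t : fnorm S <= t ->
  subproducts_le (n%:R + n%:R * t) [seq frob_factor M c | c <- lastcols d k].
Proof.
move=> ht; apply: subproducts_map => x y z Ec.
have hv := val_lastcols k d0; rewrite Ec !map_cat in hv.
have sz : k = (size x + (size y + size z))%N.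
  by have := size_lastcols k d0; rewrite Ec !size_cat.
have En := n_split k d0.
have hy : [seq val c | c <- y] = iota (c0 + size x) (size y).
  have hk : iota c0 k = iota c0 (size x) ++ iota (c0 + size x) (size y) ++
      iota (c0 + size x + size y) (size z) by rewrite -!iotaD -sz.
  move: hv; rewrite hk => /eqP; rewrite eqseq_cat ?size_map ?size_iota // => /andP[_].
  by rewrite eqseq_cat ?size_map ?size_iota // => /andP[/eqP].
rewrite (frob_chain d0 k0 hM (leq_addr _ _) _ hy); last by lia.
apply: fnorm_bool_sum; last 2 first.
- by [].
- by [].
- have uQ : (Q^T ^+ (c0 + size x - c0)) \is unitarymx.
    by apply: unitary_expr; rewrite trmx_unitary; exact: downshift_unitary.
  by rewrite (fnorm_unitaryl _ uQ).
- by move=> a a' b /eqP h /eqP h'; apply: val_inj; rewrite /= h h'.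
- by move=> a a' b /andP[_ /eqP h] /andP[_ /eqP h']; apply: val_inj; rewrite /= h h'.
Qed.

(** Cutting before the triangular factors yields blocks [R_i Q], whereas the factors with explicit
    products are [Q R_i]. Using the downshift as gauge aligns the two groupings. *)
Lemma gauge_frob g (cs : seq 'I_n) Fs r :
  near g [seq spikemx n.-1 (col c ((Q^T ^+ (c - c0).+1) *m S)) | c : 'I_n <- cs]
    [seq factor_mx n A | A <- Fs] ->
  (forall c, c \in cs -> (c0 <= c)%N) ->
  word_ok n r [seq Tri A | A <- Fs] ->
  let w := flatten [seq rcons (downshift_word R n) (Tri F) | F <- Fs] in
  word_ok n r w /\
  gauge g (blocks n w).1 [seq frob_factor M c | c <- cs] (blocks n w).2 1%:M.
Proof.
elim: cs Fs => [|c cs IH] [|F Fs] //= [hF hcs] hc [hFok hok].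
have [|h1 h2] := IH _ hcs _ hok; first by move=> c' h; apply: hc; rewrite inE h orbT.
rewrite cat_rcons blocks_downshift /=; split.
  apply/word_ok_cat; split; first exact: downshift_word_ok.
  by split; [exact: hFok|exact: h1].
have uh := blocks_unitary h1; exists (blocks n (flatten
  [seq rcons (downshift_word R n) (Tri F) | F <- Fs])).1.
split; [exact: uh| |exact: h2]; rewrite mulmx1 mulmxA -mulmxBl (fnorm_unitaryr _ uh).
rewrite /frob_factor -mulmxBr (fnorm_unitaryl _ (downshift_unitary _ _)).
by rewrite subSn ?hc ?inE ?eqxx.
Qed.

End FrobeniusFactors.

(** [ES] has [k + 1] members because a word has a head block before its first triangular factor: the
    identity in the Frobenius case, where the leading [Q] is taken up by the gauge, and [Q ^ k] in
    the Gaussian case. *)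
Lemma initial_factors e t (M N : nat -> 'M[C]_k) s :
  initial_state d e M N s -> is_trig_mx (N d)^T ->
  fnorm (pencilS d M) <= t -> fnorm (pencilT d N) <= t -> 0 <= e ->
  2 * (t + 1) * (n%:R * e) <= 1 ->
  let b := n%:R + n%:R * t in
  let g := 32 * n%:R * e * (t + 1) ^+ 2 in
  state_ok n (2 * (t + 1))^-1 s /\
  exists ES ET : seq 'M[C]_n,
  [/\ [/\ lprod ES = pencilS d M, subproducts_le b ES, size ES = k.+1 &
          gauge g 1%:M ES (blockseq n s.1) 1%:M] &
      [/\ lprod ET = pencilT d N, subproducts_le b ET, size ET = k &
          gauge g 1%:M ET [seq factor_mx n A | A <- s.2] 1%:M]].
Proof.
move=> [hT hS] hN tS tT e0 hsm b g.
have t0 : 0 <= t by exact: le_trans (fnorm_ge0 _) tS.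
have t1 : 1 <= t + 1 by rewrite lerDr.
have g0 : 0 <= g by rewrite !mulr_ge0 ?exprn_ge0 // addr_ge0.
have uQ := downshift_unitary R n.
have uQt : Q^T \is unitarymx by rewrite trmx_unitary.
have hcol (X : 'M[C]_n) (cs : seq 'I_n) : fnorm X <= t ->
    {in [seq (nat_of_ord c, col c X) | c : 'I_n <- cs], forall lv, fnorm lv.2 + 1 <= t + 1}.
  by move=> hX lv /mapP[c _ ->]; rewrite lerD2r; exact: le_trans (fnorm_col _ _) hX.
have [nT okT] := stored_factors hT t1 e0 hsm (hcol _ _ tT).
have gT : exists ET : seq 'M[C]_n, [/\ lprod ET = pencilT d N, subproducts_le b ET, size ET = k &
          gauge g 1%:M ET [seq factor_mx n A | A <- s.2] 1%:M].
  exists [seq spikemx lv.1 lv.2 | lv <- spikesT (pencilT d N)]; split.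
  - exact: lprod_spikesT.
  - exact: subproducts_spikesT.
  - by rewrite !size_map size_rev size_lastcols.
  - exact: near_gauge.
case: hS => [[hM [Rs hRs Es]]|[hM [Rs hRs Es]]].
- have hW : {in spikesF (pencilS d M), forall lv, fnorm lv.2 + 1 <= t + 1}.
    move=> lv /mapP[c _ ->]; rewrite lerD2r; apply: le_trans (fnorm_col _ _) _.
    by rewrite (fnorm_unitaryl _ (unitary_expr _ uQt)).
  have [nS okS] := stored_factors hRs t1 e0 hsm hW.
  rewrite /spikesF -map_comp in nS.
  have [|h1 h2] := gauge_frob nS _ okS; first by move=> c; rewrite mem_lastcols.
  split; first by split; [rewrite Es; exact: h1|exact: okT].
  have [ET hET] := gT.
  exists (1%:M :: [seq frob_factor M c | c <- lastcols d k]), ET; split; last exact: hET.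
  split.
  + by rewrite /= mul1mx lprod_frob.
  + by apply: subproducts_unitary_cons; [exact: unitary1|exact: subproducts_frob].
  + by rewrite /= size_map size_lastcols.
  + rewrite /blockseq Es; exists (blocks n (flatten
      [seq rcons (downshift_word R n) (Tri F) | F <- Rs])).1.
    split; [exact: blocks_unitary h1|by rewrite !mul1mx subrr fnorm0|exact: h2].
- have tW : fnorm ((Q^T ^+ k) *m pencilS d M) <= t.
    by rewrite (fnorm_unitaryl _ (unitary_expr _ uQt)).
  have [nS okS] := stored_factors hRs t1 e0 hsm (hcol _ _ tW).
  split.
    split; [rewrite Es; apply/word_ok_cat; split; [|exact: okS]|exact: okT].
    exact: downshifts_ok.
  have [ET hET] := gT.
  exists (Q ^+ k :: [seq spikemx lv.1 lv.2 | lv <- spikesG (pencilS d M)]), ET.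
  split; last exact: hET; split.
  + rewrite /= lprod_spikesG // mulmxA.
    by rewrite downshift_exprM mul1mx.
  + by apply: subproducts_unitary_cons; [exact: unitary_expr|exact: subproducts_spikesG].
  + by rewrite /= !size_map size_rev size_lastcols.
  + rewrite /blockseq Es blocks_downshifts blocks_tri /= mulmx1.
    exact: gauge_cons_unitary (near_gauge nS).
Qed.

End InitialStates.

(** * Computed eigenvalues *)

Section ComputedDiagonals.
Variable R : realType.
Local Notation C := R[i].
Variable n : nat.

Definition upper_triangular (A : 'M[C]_n) := forall a b : 'I_n, (b < a)%N -> A a b = 0.

Lemma upper_triangularM A B : upper_triangular A -> upper_triangular B ->
  upper_triangular (A *m B) /\ forall a, (A *m B) a a = A a a * B a a.
Proof.
move=> hA hB; split=> [a b ab|a]; rewrite mxE.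
  by rewrite big1 // => c _; case: (ltnP c a) => h; [rewrite hA ?mul0r|rewrite hB ?mulr0 //; lia].
rewrite (bigD1 a) //= big1 ?addr0 // => c; rewrite neq_ltn => /orP[h|h].
  by rewrite hA ?mul0r.
by rewrite hB ?mulr0.
Qed.

Definition letter_diag (j : nat) (l : letter R) : C :=
  match l with
  | Core i G => if (j == i) || (j == i.+1) then G (inord (j - i)) (inord (j - i)) else 1
  | Tri A => coreB A j 1 0 / coreC A j 1 0
  end.

Definition triangular_letter (l : letter R) : Prop :=
  match l with
  | Core i G => is_diag_mx G
  | Tri A => unitary_factor n A /\ rho n A != 0
  end.

Fixpoint triangular_word (w : seq (letter R)) : Prop :=
  if w is l :: w' then triangular_letter l /\ triangular_word w' else True.

Lemma letter_triangular l : triangular_letter l ->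
  upper_triangular (letter_mx n l) /\ forall a, letter_mx n l a a = letter_diag a l.
Proof.
case: l => [i G /is_diag_mxP hG|A [uA hA]] /=; split=> [a b ab|a].
- rewrite mxE -val_eqE gtn_eqF //; case: ifP => // h; apply: hG; rewrite !inordK; lia.
- have -> : (nat_of_ord a == i) || (nat_of_ord a == i.+1) = (i <= a <= i.+1)%N by lia.
  by rewrite mxE andbb eqxx.
- by rewrite factor_triangular 1?ltnW // -val_eqE gtn_eqF.
- by rewrite factor_triangular // eqxx.
Qed.

Lemma word_triangular w : triangular_word w ->
  upper_triangular (word_mx n w) /\
  forall a : 'I_n, word_mx n w a a = \prod_(l <- w) letter_diag a l.
Proof.
rewrite /word_mx; elim: w => [|l w IH] /= => [_|[/letter_triangular[h1 h2] /IH[h3 h4]]].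
  by split=> [a b ab|a]; rewrite mxE ?big_nil ?eqxx // -val_eqE gtn_eqF.
have [h5 h6] := upper_triangularM h1 h3; split=> [//|a].
by rewrite h6 h2 h4 big_cons.
Qed.

Lemma relative_step (m e : R) (a b : C) : 0 <= e -> m + 2 * e <= 1 ->
  normc a <= m -> normc b <= e ->
  exists2 c, (1 + a) * (1 + b) = 1 + c & normc c <= m + 2 * e.
Proof.
move=> e0 hm ha hb; exists (a + b + a * b); first by ring.
apply: le_trans (le_normcD _ _) _; apply: le_trans (lerD (le_normcD _ _) (lexx _)) _.
rewrite normcM; have h := ler_pM (normc_ge0 a) (normc_ge0 b) ha hb.
have m1 : m <= 1 by apply: le_trans hm; rewrite lerDl mulr_ge0.
move: h ha hb m1 e0; move: (normc a) (normc b) (normc a * normc b).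
by move=> x y z; clear -R; move=> *; nra.
Qed.

(** Every letter brings two relative errors, one for its diagonal entry and one for the
    multiplication; by [relative_step] each costs at most [2 e]. *)
Lemma diag_prod_near e j w y : 0 <= e -> 4 * (size w)%:R * e <= 1 ->
  fl_diag_prod e j w y ->
  exists2 c, y = (\prod_(l <- w) letter_diag j l) * (1 + c) &
             normc c <= 4 * (size w)%:R * e.
Proof.
move=> e0; elim: w y => [|l w IH] y /=.
  by move=> _ ->; exists 0; rewrite ?big_nil ?addr0 ?mulr1 ?normc0 ?mulr0 ?mul0r.
rewrite -natr1 => hs [x [z [hx hz [b hb ->]]]].
have hs' : 4 * (size w)%:R * e + 2 * e + 2 * e <= 1.
  by apply: le_trans hs; rewrite le_eqVlt; apply/orP; left; apply/eqP; ring.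
have [|c -> hc] := IH _ _ hz.
  by apply: le_trans hs'; rewrite -addrA lerDl addr_ge0 ?mulr_ge0.
have [a -> ha] : exists2 a, x = letter_diag j l * (1 + a) & normc a <= e.
  case: l hx => [i G|A] /= => [->|[a ha ->]].
    by exists 0; rewrite ?addr0 ?mulr1 ?normc0.
  have e1 : ord_max = 1 :> 'I_2 by apply: val_inj.
  by exists a; [rewrite e1|exact: ha].
have [|c1 E1 h1] := relative_step e0 _ hc ha.
  by apply: le_trans hs'; rewrite lerDl mulr_ge0.
have [c2 E2 h2] := relative_step e0 hs' h1 hb.
exists c2; last by apply: le_trans h2 _; rewrite le_eqVlt; apply/orP; left; apply/eqP; ring.
by rewrite big_cons -E2 -E1; ring.
Qed.

Lemma fnorm_set_diag (A : 'M[C]_n) (h : 'I_n -> C) m : 0 <= m ->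
  (forall a, normc (h a) <= m) ->
  fnorm ((\matrix_(a, b) if a == b then A a a * (1 + h a) else A a b) - A) <= m * fnorm A.
Proof.
move=> m0 hm; apply: fnorm_le; first by rewrite mulr_ge0 ?fnorm_ge0.
rewrite exprMn fnorm_sqr /fnorm2 mulr_sumr; apply: ler_sum => a _.
rewrite mulr_sumr; apply: ler_sum => b _; rewrite addmxE oppmxE mxE.
case: eqP => [<-|_]; last by rewrite subrr normc0 expr0n mulr_ge0 ?sqr_ge0.
have -> : A a a * (1 + h a) - A a a = h a * A a a by ring.
rewrite normcM exprMn; apply: ler_wpM2r; first exact: sqr_ge0.
by rewrite ler_pXn2r ?nnegrE ?normc_ge0.
Qed.

Lemma det_upper_pencil (A B : 'M[C]_n) z : upper_triangular A -> upper_triangular B ->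
  \det (A - z *: B) = \prod_a (A a a - z * B a a).
Proof.
move=> hA hB; rewrite -det_tr det_trig.
  by apply: eq_bigr => a _; rewrite mxE addmxE oppmxE scalemxE.
apply/is_trig_mxP => a b ab; rewrite mxE addmxE oppmxE scalemxE hA // hB //.
by rewrite mulr0 subr0.
Qed.

(* The relative errors of a computed eigenvalue are moved into the diagonal
   entries of the two triangular matrices. *)
Lemma computed_diagonals e w v (evs : seq (option C)) : 0 <= e ->
  triangular_word w -> triangular_word v ->
  (size w <= 2 * n)%N -> (size v <= 2 * n)%N -> 16 * n%:R * e <= 1 ->
  (forall j, (j < n)%N -> exists sj tj : C,
     [/\ fl_diag_prod e j w sj, fl_diag_prod e j v tj &
        match nth None evs j with
        | Some z => tj != 0 /\ fl e (sj / tj) z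
        | None => tj = 0 /\ sj != 0
        end]) ->
  exists (S T : 'M[C]_n) (sv tv : nat -> C),
  [/\ fnorm (S - word_mx n w) <= 16 * n%:R * e * fnorm (word_mx n w),
      fnorm (T - word_mx n v) <= 16 * n%:R * e * fnorm (word_mx n v),
      forall z, \det (S - z *: T) = \prod_(j < n) (sv j - z * tv j) &
      forall j, (j < n)%N -> match nth None evs j with
       | Some z => tv j != 0 /\ z = sv j / tv j
       | None => tv j = 0 /\ sv j != 0 end].
Proof.
move=> e0 hw hv sw sv hs hev.
have [tw dw] := word_triangular hw; have [tv dv] := word_triangular hv.
(* A product of at most [2 n] letters costs [8 n e], and the final division [2 e]; both fit into
   [16 n e] as soon as [n >= 1]. *)
have szb (l : nat) : (l <= 2 * n)%N -> 4 * l%:R * e + 2 * e <= 16 * n%:R * e \/ n = 0%N.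
  move=> hl; have [n0|n0] := posnP n; [by right|left].
  have h1 : l%:R <= 2 * n%:R :> R by rewrite -natrM ler_nat.
  have h2 : 1 <= n%:R :> R by rewrite ler1n.
  by move: h1 h2 e0; move: (l%:R) (n%:R) => x y; clear -R; move=> *; nra.
have ex (j : 'I_n) : exists p : C * C, [/\ normc p.1 <= 16 * n%:R * e,
    normc p.2 <= 16 * n%:R * e &
    let s' := word_mx n w j j * (1 + p.1) in let t' := word_mx n v j j * (1 + p.2) in
    match nth None evs j with
       | Some z => t' != 0 /\ z = s' / t'
       | None => t' = 0 /\ s' != 0 end].
  have n0 : n <> 0%N by apply/eqP; rewrite -lt0n; exact: leq_ltn_trans (ltn_ord j).
  have [sj [tj [hsj htj hm]]] := hev j (ltn_ord j).
  have [hw'|//] := szb _ sw; have [hv'|//] := szb _ sv.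
  have hw1 := le_trans hw' hs; have e2 : 0 <= 2 * e by rewrite mulr_ge0.
  have [|a Ea ha] := diag_prod_near e0 _ hsj.
    by apply: le_trans hw1; rewrite lerDl.
  have [|b Eb hb] := diag_prod_near e0 _ htj.
    by apply: le_trans (le_trans hv' hs); rewrite lerDl.
  rewrite -dw in Ea; rewrite -dv in Eb.
  have hb' : normc b <= 16 * n%:R * e.
    by apply: le_trans hb _; apply: le_trans hv'; rewrite lerDl.
  case: (nth None evs j) hm => [z [t0 [x hx ->]]|[t0 s0]].
    have [c Ec hc] := relative_step e0 hw1 ha hx.
    exists (c, b); split; [exact: le_trans hc hw'|exact: hb'|].
    by rewrite /= -Ec -Eb; split; [exact: t0|rewrite Ea; ring].
  exists (a, b); split; [|exact: hb'|by rewrite /= -Ea -Eb].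
  by apply: le_trans ha _; apply: le_trans hw'; rewrite lerDl.
have [p hp] := fin_all_exists ex.
pose S := \matrix_(a, b) if a == b then word_mx n w a a * (1 + (p a).1) else word_mx n w a b.
pose T := \matrix_(a, b) if a == b then word_mx n v a a * (1 + (p a).2) else word_mx n v a b.
pose val_at (A : 'M[C]_n) j := if insub j is Some a then A a a else 0.
have val_atE (A : 'M[C]_n) (a : 'I_n) : val_at A a = A a a by rewrite /val_at valK.
have b0 : 0 <= 16 * n%:R * e by rewrite !mulr_ge0.
exists S, T, (val_at S), (val_at T); split.
- by apply: fnorm_set_diag => // a; have [] := hp a.
- by apply: fnorm_set_diag => // a; have [] := hp a.
- move=> z; rewrite det_upper_pencil; first by apply: eq_bigr => a _; rewrite !val_atE.
    by move=> a b ab; rewrite mxE -val_eqE gtn_eqF // tw.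
  by move=> a b ab; rewrite mxE -val_eqE gtn_eqF // tv.
- move=> j hj; have := hp (Ordinal hj); case=> _ _.
  by rewrite -[j]/(nat_of_ord (Ordinal hj)) !val_atE !mxE eqxx.
Qed.

End ComputedDiagonals.

(** * The backward error *)

Section PowerBounds.
Variables (R : realType) (y : R).
Hypothesis y100 : 100 <= y.

(* All constants of the analysis are absorbed into powers of a single large
   parameter [y]. *)
Definition bounded (p : nat) (v x : R) := 0 <= x <= y ^+ p * v.

Lemma y_ge1 : 1 <= y. Proof. by apply: le_trans y100; rewrite ler1n. Qed.

Lemma y_ge0 : 0 <= y. Proof. exact: le_trans y_ge1. Qed.

Lemma bounded_le p v x : bounded p v x -> x <= y ^+ p * v. Proof. by case/andP. Qed.
Lemma bounded_ge p v x : bounded p v x -> 0 <= x. Proof. by case/andP. Qed.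

Lemma boundedM p q v a b : bounded p 1 a -> bounded q v b -> bounded (p + q) v (a * b).
Proof.
rewrite /bounded mulr1 => /andP[a0 ha] /andP[b0 hb]; rewrite mulr_ge0 //= exprD -mulrA.
exact: ler_pM.
Qed.

Lemma boundedX p a m : bounded p 1 a -> bounded (p * m) 1 (a ^+ m).
Proof.
move=> h; elim: m => [|m IH]; first by rewrite muln0 expr0 /bounded expr0 mulr1 ler01 lexx.
by rewrite mulnS exprS; exact: boundedM h IH.
Qed.

Lemma boundedW p q v a : 0 <= v -> (p <= q)%N -> bounded p v a -> bounded q v a.
Proof.
move=> v0 pq /andP[a0 ha]; rewrite /bounded a0 /=; apply: le_trans ha _.
by rewrite ler_wpM2r // ler_weXn2l // y_ge1.
Qed.

Lemma boundedD p v a b : 0 <= v -> bounded p v a -> bounded p v b -> bounded p.+1 v (a + b).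
Proof.
move=> v0 /andP[a0 ha] /andP[b0 hb]; rewrite /bounded addr_ge0 //=.
apply: le_trans (lerD ha hb) _; rewrite -mulr2n -mulr_natl exprS -mulrA.
have y0 := y_ge0; rewrite ler_wpM2r ?mulr_ge0 ?exprn_ge0 //.
by apply: le_trans y100; rewrite ler_nat.
Qed.

Lemma bounded_trans p v a b : a <= b -> 0 <= a -> bounded p v b -> bounded p v a.
Proof. by move=> ab a0 /andP[_ hb]; rewrite /bounded a0 (le_trans ab). Qed.

Lemma bounded_nat m : (m <= 100)%N -> bounded 1 1 m%:R.
Proof.
by move=> h; rewrite /bounded ler0n expr1 mulr1; apply: le_trans y100; rewrite ler_nat.
Qed.

Lemma bounded_powr p v : 0 <= v -> bounded p v (y ^+ p * v).
Proof. by move=> v0; apply/andP; split=> //; rewrite mulr_ge0 ?exprn_ge0 ?y_ge0. Qed.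

Lemma bounded_pow p : bounded p 1 (y ^+ p).
Proof. by rewrite -[y ^+ p]mulr1; exact: bounded_powr. Qed.

Lemma bounded_small p q u x : (p <= q)%N -> 0 <= u -> y ^+ q * u <= 1 -> bounded p u x -> x <= 1.
Proof. by move=> pq u0 h /(boundedW u0 pq)/bounded_le hx; exact: le_trans hx h. Qed.

End PowerBounds.

Section StructuredBackwardError.
Variables (R : realType) (d k : nat) (y u e e' : R).
Local Notation C := R[i].
Local Notation n := (d * k)%N.
Hypotheses (d0 : (0 < d)%N) (k0 : (0 < k)%N).
Hypotheses (y100 : 100 <= y) (yn : n.+1%:R <= y) (u0 : 0 <= u) (uy : y ^+ 40 * u <= 1)
  (he : 0 <= e <= y * u) (he' : 0 <= e' <= y * u).

Let bn : bounded y 1 1 (n%:R : R).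
Proof. by rewrite /bounded ler0n expr1 mulr1; apply: le_trans yn; rewrite ler_nat. Qed.

Let be : bounded y 1 u e. Proof. by rewrite /bounded expr1. Qed.
Let be' : bounded y 1 u e'. Proof. by rewrite /bounded expr1. Qed.

Let pow_small p : (p <= 40)%N -> y ^+ p * u <= 1.
Proof.
move=> hp; apply: le_trans uy; rewrite ler_wpM2r // ler_weXn2l //; exact: y_ge1.
Qed.

Lemma chased_factors (M N : nat -> 'M[C]_k) s0 s1 s2 m m' :
  fnorm (pencilS d M) <= y ^+ 2 -> fnorm (pencilT d N) <= y ^+ 2 ->
  is_trig_mx (N d)^T -> initial_state d e' M N s0 ->
  nsteps (op n e) m s0 s1 -> qr_iteration n e m' s1 s2 -> (m + m')%:R <= y ->
  [/\ exists2 r : R, 0 < r & state_ok n r s2,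
      size (blockseq n s2.1) = k.+1, size s2.2 = k &
      exists Z Z' : 'M[C]_n, [/\ Z \is unitarymx /\ Z' \is unitarymx,
        fnorm (Z *m word_mx n s2.1 *m adj Z' - pencilS d M) <= y ^+ 23 * u &
        fnorm (Z *m word_mx n [seq Tri A | A <- s2.2] *m adj Z' - pencilT d N) <= y ^+ 23 * u]].
Proof.
move=> hS hT hN hi h01 h12 hm.
have y0 := y_ge0 y100; have y1 := y_ge1 y100.
have y_gt0 : 0 < y by exact: lt_le_trans y1.
have e0 := bounded_ge be; have e0' := bounded_ge be'.
have bt : bounded y 3 1 (y ^+ 2 + 1).
  apply: boundedD => //; first exact: bounded_pow.
  by apply: (boundedW y100 _ (leq0n 2)) (bounded_pow y100 0).
have b2 : bounded y 1 1 (2 : R) by apply: bounded_nat.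
have hsm : 2 * (y ^+ 2 + 1) * (n%:R * e') <= 1.
  exact: (bounded_small y100 _ u0 uy (boundedM (boundedM b2 bt) (boundedM bn be'))).
have [ok0 [ES [ET [[pS sS zS gS] [pT sT zT gT]]]]] := initial_factors d0 k0 hi hN hS hT e0' hsm.
set g0 := 32 * n%:R * e' * (y ^+ 2 + 1) ^+ 2 in gS gT.
set b := n%:R + n%:R * y ^+ 2 in sS sT.
have bg0 : bounded y 12 u g0.
  rewrite /g0 mulrC; apply: (boundedW y100 u0) (_ : (3 * 2 + (1 + 1 + 1) <= 12)%N) _ => //.
  apply: boundedM; first exact: boundedX.
  by apply: boundedM be'; apply: boundedM bn; apply: bounded_nat.
have bb : bounded y 4 1 b.
  apply: boundedD => //; first exact: (boundedW y100 ler01 _ bn).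
  by apply: boundedM bn _; exact: bounded_pow.
(* The initial bound [1 / (2 (y^2 + 1))] for [rho] is at least [2 y^-4], and all operations together
   lose at most [y^2 u <= y^-4]; so [y^-4] is never undershot. *)
pose r := (y ^+ 4)^-1; have r0 : 0 < r by rewrite invr_gt0 exprn_gt0.
have r1 : 0 < r <= 1 by rewrite r0 invf_le1 ?exprn_gt0 // exprn_ege1.
(* The pass-through bound [8 e / r^2], with [e <= y u] and [1 / r^2 = y^8], dictates the
   exponent. *)
pose g := y ^+ 10 * u.
have bg : bounded y 10 u g by exact: bounded_powr.
have eg : e <= g by exact: (bounded_le (boundedW y100 u0 _ be)).
have br : bounded y 4 1 r^-1 by rewrite invrK; exact: bounded_pow.
have hgA : (n.+1%:R + r^-1) * e <= g.
  apply: bounded_le; apply: (boundedW y100 u0) (_ : (5 + 1 <= 10)%N) _ => //.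
  apply: boundedM be; apply: boundedD => //.
  rewrite -natr1; apply: (boundedW y100 ler01) (_ : (2 <= 4)%N) _ => //.
  apply: boundedD => //; exact: (@bounded_nat _ _ y100 1%N).
have hgP : 8 * e / r ^+ 2 <= g.
  rewrite mulrC -exprVn; apply: (@bounded_le _ _ (4 * 2 + (1 + 1)) u).
  apply: (boundedM (boundedX 2 br)); apply: boundedM be.
  by apply: bounded_nat.
have run := algorithm_run_ok r1 e0 eg hgA hgP h01 h12.
have hq : r + (m + m')%:R * e <= (2 * (y ^+ 2 + 1))^-1.
  apply: (@le_trans _ _ (2 * r)).
    rewrite [leRHS]mulr_natl mulr2n lerD2l /r -[leRHS]mul1r ler_pdivlMr ?exprn_gt0 //.
    apply: (bounded_small y100 (_ : (1 + 1 + 4 <= 40)%N) u0 uy) => //.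
    rewrite mulrC addnC; apply: (@boundedM _ _ 4); first exact: bounded_pow.
    by apply: boundedM be; rewrite /bounded ler0n expr1 mulr1.
  have t_gt0 : 0 < 2 * (y ^+ 2 + 1) by rewrite mulr_gt0 // ltr_wpDl // exprn_ge0.
  rewrite -[leRHS]mul1r ler_pdivlMr // mulrAC ler_pdivrMr ?exprn_gt0 // mul1r mulrA -natrM.
  rewrite -[leRHS]mulr1; apply: (@bounded_le _ _ (1 + 3)); apply: boundedM bt.
  exact: bounded_nat.
have [ok2 [Z [Z' [uZ lS lT]]]] := run _ hq ok0.
have fS := gauge_trans (unitary1 R n) gS lS; have fT := gauge_trans (unitary1 R n) gT lT.
rewrite !mul1mx in fS fT.
have bG : bounded y 13 u (g0 + (m + m')%:R * g).
  apply: boundedD => //; apply: (boundedW y100 u0) (_ : (1 + 10 <= 12)%N) _ => //.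
  by apply: boundedM bg; rewrite /bounded ler0n expr1 mulr1.
set G := g0 + _ in fS fT bG; have G0 := bounded_ge bG.
have uZ' := gauge_unitary fS uZ.
(* In [2 * size E * b^2 * G] one has [b <= y^4] and [G <= y^13 u], hence the exponent
   [1 + 1 + 8 + 13 = 23]. *)
have fin (E l : seq 'M[C]_n) (X : 'M[C]_n) : lprod E = X -> subproducts_le b E ->
    (size E <= k.+1)%N -> gauge G Z E l Z' -> fnorm (Z *m lprod l *m adj Z' - X) <= y ^+ 23 * u.
  move=> <- sE zE gE; have [l2 nl <-] := gauge_prod gE uZ.
  have bz : bounded y 1 1 ((size E)%:R : R).
    rewrite /bounded ler0n expr1 mulr1; apply: le_trans yn; rewrite ler_nat.
    by apply: leq_trans zE _; rewrite ltnS leq_pmull.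
  have h1 : 2 * (size E)%:R * b * G <= 1.
    exact: (bounded_small y100 _ u0 uy (boundedM (boundedM (boundedM b2 bz) bb) bG)).
  apply: le_trans (near_lprod G0 sE nl h1) _.
  exact: (bounded_le (boundedM (boundedM (boundedM b2 bz) (boundedX 2 bb)) bG)).
split.
- exists r; first exact: r0.
  split; [apply: word_ok_le ok2.1|apply: word_ok_le ok2.2]; by rewrite lerBrDr.
- by rewrite (gauge_size fS).
- by have := gauge_size fT; rewrite size_map zT.
exists Z, Z'; split; first by split; [exact: uZ|exact: uZ'].
  by rewrite -lprod_blockseq; apply: fin fS; rewrite ?zS.
rewrite /word_mx -map_comp; apply: fin fT => //; by rewrite zT.
Qed.

Lemma triangular_word_cat (x w : seq (letter R)) :
  triangular_word n x -> triangular_word n w -> triangular_word n (x ++ w).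
Proof. by elim: x => //= l x IH [hl /IH hx] /hx. Qed.

Lemma triangular_factors r (Fs : seq (factor R)) : 0 < r ->
  word_ok n r [seq Tri A | A <- Fs] -> triangular_word n [seq Tri A | A <- Fs].
Proof.
move=> r0; elim: Fs => //= A Fs IH [[uA hA] /IH hFs]; split=> //; split; first exact: uA.
by apply/eqP => E; move: hA; rewrite E normc0 leNgt r0.
Qed.

Lemma triangular_hess_word (g : nat -> 'M[C]_2) (Rs : seq (factor R)) r : 0 < r ->
  (forall i, (i < n.-1)%N -> is_diag_mx (g i)) -> word_ok n r (hess_word n g Rs) ->
  triangular_word n (hess_word n g Rs).
Proof.
move=> r0 hg /word_ok_cat[_ hR]; apply: triangular_word_cat; last exact: triangular_factors hR.
have : all (fun i => i < n.-1)%N (iota 0 n.-1) by apply/allP => i; rewrite mem_iota.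
by elim: (iota _ _) => //= i s IH /andP[hi /IH hs]; split=> //; exact: hg.
Qed.

Lemma perturbed_core (Z Z' W X S0 : 'M[C]_n) : Z \is unitarymx -> Z' \is unitarymx ->
  fnorm S0 <= y ^+ 2 -> fnorm (Z *m W *m adj Z' - S0) <= y ^+ 23 * u ->
  fnorm (X - W) <= 16 * n%:R * e * fnorm W ->
  fnorm (Z *m X *m adj Z' - S0) <= y ^+ 24 * u.
Proof.
move=> uZ uZ' hS hW hX.
have uZa : adj Z' \is unitarymx by rewrite adj_unitary; exact: uZ'.
have iso (V : 'M[C]_n) : fnorm (Z *m V *m adj Z') = fnorm V.
  by rewrite (fnorm_unitaryr _ uZa) (fnorm_unitaryl _ uZ).
have nW : bounded y 3 1 (fnorm W).
  rewrite -iso -[_ *m adj Z'](subrK S0).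
  apply: (@bounded_trans _ _ _ _ _ (fnorm (Z *m W *m adj Z' - S0) + fnorm S0)).
  - exact: fnormD.
  - exact: fnorm_ge0.
  apply: boundedD => //.
    apply: (boundedW y100 ler01 (leq0n 2)); apply/andP; split; first exact: fnorm_ge0.
    by rewrite expr0 mulr1; apply: le_trans hW _; exact: pow_small.
  by apply/andP; split; [exact: fnorm_ge0|rewrite mulr1].
have -> : Z *m X *m adj Z' - S0 = Z *m (X - W) *m adj Z' + (Z *m W *m adj Z' - S0).
  by rewrite mulmxBr mulmxBl addrA subrK.
apply: le_trans (fnormD _ _) _; rewrite iso; apply: bounded_le; apply: boundedD => //.
- apply: (bounded_trans hX); first exact: fnorm_ge0.
  rewrite mulrC; apply: (boundedW y100 u0) (_ : (3 + (1 + 1 + 1) <= 23)%N) _ => //.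
  by apply: boundedM nW _; apply: boundedM be; apply: boundedM bn; exact: bounded_nat.
- by apply/andP; split; [exact: fnorm_ge0|exact: hW].
Qed.

Lemma structured_backward_error (M N : nat -> 'M[C]_k) s0 s1 s2 m m' evs :
  fnorm (pencilS d M) <= y ^+ 2 -> fnorm (pencilT d N) <= y ^+ 2 ->
  is_trig_mx (N d)^T -> initial_state d e' M N s0 ->
  nsteps (op n e) m s0 s1 -> qr_iteration n e m' s1 s2 -> (m + m')%:R <= y ->
  triangular n s2 -> (forall j, (j < n)%N -> fl_eigenvalue e j s2 (nth None evs j)) ->
  exists (M' N' : nat -> 'M[C]_k) (sv tv : nat -> C) (c : C),
  [/\ c != 0 /\ (forall z, \det (pencilS d M' - z *: pencilT d N') =
                          c * \prod_(j < n) (sv j - z * tv j)),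
      forall j, (j < n)%N -> match nth None evs j with
       | Some z => tv j != 0 /\ z = sv j / tv j
       | None => tv j = 0 /\ sv j != 0 end,
      fnorm (pencilS d M' - pencilS d M) <= y ^+ 41 * u &
      fnorm (pencilT d N' - pencilT d N) <= y ^+ 41 * u].
Proof.
move=> hS hT hN hi h01 h12 hm [g [Rs [Es hg]]] hev.
have [[r r0 [okS okT]] zS zT [Z [Z' [[uZ uZ'] nS nT]]]] := chased_factors hS hT hN hi h01 h12 hm.
have kn : (k <= n)%N by rewrite leq_pmull.
(* Gauges preserve the number of blocks, so the final word still has [k] triangular factors, and at
   most [2 n] letters in all. *)
have zR : size Rs = k.
  by move: zS; rewrite Es /blockseq /hess_word blocks_cores blocks_tri /= size_map => -[].
have e0 := bounded_ge be.
have [|||||S3 [T3 [sv [tv [dS dT hdet hsv]]]]] :=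
  @computed_diagonals R n e s2.1 [seq Tri A | A <- s2.2] evs e0 _ _ _ _ _ hev.
- by rewrite Es in okS *; exact: triangular_hess_word okS.
- exact: triangular_factors okT.
- rewrite Es /hess_word size_cat !size_map size_iota zR mul2n -addnn.
  exact: leq_add (leq_pred _) kn.
- by rewrite size_map zT mul2n -addnn; exact: leq_trans kn (leq_addr _ _).
- apply: (bounded_small y100 (_ : (1 + 1 + 1 <= 40)%N) u0 uy) => //.
  by apply: boundedM be; apply: boundedM bn; exact: bounded_nat.
have pS := perturbed_core uZ uZ' hS nS dS; have pT := perturbed_core uZ uZ' hT nT dT.
have y2 : 1 <= y ^+ 2 by apply: exprn_ege1; exact: y_ge1 y100.
have bE : bounded y 24 u (y ^+ 24 * u) by exact: bounded_powr.
have [|A [B [uA uB [AS AT] eS eT]]] := pencil_restore d0 k0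
  (pencilS_firstD d0 k0 M) (pencilT_firstD d N) hS hT y2 pS pT.
  apply: (bounded_small y100 (_ : (1 + 1 * 12 + 24 <= 40)%N) u0 uy) => //.
  apply: boundedM bE; apply: boundedM (boundedX 12 bn); exact: bounded_nat.
rewrite (addrC (pencilS d M)) subrK in AS eS.
rewrite (addrC (pencilT d N)) subrK in AT eT.
(* [1921 <= y^2], so the exponents add up to [2 + 2 + 13 + 24 = 41]. *)
have hb : 1921 * y ^+ 2 * n%:R ^+ 13 * (y ^+ 24 * u) <= y ^+ 41 * u.
  apply: (@bounded_le _ _ (2 + 2 + 1 * 13 + 24)); apply: boundedM bE.
  apply: boundedM (boundedX 13 bn); apply: boundedM (bounded_pow y100 2).
  apply/andP; split; first exact: ler0n.
  apply: (@le_trans _ _ (100 * 100)); first by rewrite -natrM ler_nat.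
  by rewrite mulr1 expr2; apply: ler_pM.
have nzd (X : 'M[C]_n) : X \in unitmx -> \det X != 0 by rewrite unitmxE unitfE.
(* The coefficients are read off the last block columns of the restored pencil. In the second family
   the index is lowered by one, since the coefficients of [T] are numbered from 1. *)
exists (fun i => \matrix_(r, c) - (A *m (Z *m S3 *m adj Z') *m B) (bidx d0 k0 i r) (bidx d0 k0 d.-1 c)).
exists (fun i => \matrix_(r, c) (A *m (Z *m T3 *m adj Z') *m B) (bidx d0 k0 i.-1 r) (bidx d0 k0 d.-1 c)).
exists sv, tv, (\det A * \det Z * (\det (adj Z') * \det B)).
rewrite -(pencilS_of d0 k0 AS) -(pencilT_of d0 k0 AT); split.
- split.
    have uZa : adj Z' \is unitarymx by rewrite adj_unitary; exact: uZ'.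
    exact: mulf_neq0 (mulf_neq0 (nzd _ uA) (nzd _ (unitarymx_unit uZ)))
                     (mulf_neq0 (nzd _ (unitarymx_unit uZa)) (nzd _ uB)).
  move=> z; rewrite -hdet.
  have -> : A *m (Z *m S3 *m adj Z') *m B - z *: (A *m (Z *m T3 *m adj Z') *m B) =
      A *m Z *m (S3 - z *: T3) *m (adj Z' *m B).
    by rewrite mulmxBr mulmxBl -scalemxAr -scalemxAl !mulmxA.
  by rewrite !det_mulmx; ring.
- exact: hsv.
- exact: le_trans eS hb.
- exact: le_trans eT hb.
Qed.

End StructuredBackwardError.

(** * Undoing the scaling and the preprocessing *)

Section Scaling.
Variable R : realType.
Local Notation C := R[i].

Lemma fl_matrix m n e (A B : 'M[C]_(m, n)) : 0 <= e -> (forall a b, fl e (A a b) (B a b)) ->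
  fnorm (B - A) <= e * fnorm A.
Proof.
move=> e0 h; apply: fnorm_le; first by rewrite mulr_ge0 ?fnorm_ge0.
rewrite exprMn fnorm_sqr /fnorm2 mulr_sumr; apply: ler_sum => a _.
rewrite mulr_sumr; apply: ler_sum => b _; rewrite addmxE oppmxE.
have [x hx ->] := h a b; have -> : A a b * (1 + x) - A a b = x * A a b by ring.
rewrite normcM exprMn; apply: ler_wpM2r; first exact: sqr_ge0.
by rewrite ler_pXn2r ?nnegrE ?normc_ge0.
Qed.

Variables (k : nat) (e e' alpha : R) (U V : 'M[C]_k).
Hypotheses (he : 0 <= e <= 1) (he' : 0 <= e' <= 1) (a0 : 0 < alpha)
  (uU : U \is unitarymx) (uV : V \is unitarymx).

Let normc_inv : normc (alpha^-1)%:C = alpha^-1.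
Proof. by rewrite normc_real gtr0_norm ?invr_gt0. Qed.

Lemma scaled_coefficient (X X1 X2 : 'M[C]_k) :
  (forall a b, fl e ((alpha^-1)%:C * X a b) (X1 a b)) ->
  fnorm (X2 - adj U *m X1 *m V) <= e' * fnorm X1 ->
  fnorm X2 <= 4 * (alpha^-1 * fnorm X) /\
  fnorm (X2 - adj U *m ((alpha^-1)%:C *: X) *m V) <= (2 * e' + e) * (alpha^-1 * fnorm X).
Proof.
move=> h1 h2; have /andP[e0 e1] := he; have /andP[e0' e1'] := he'.
set A := (alpha^-1)%:C *: X; set x := alpha^-1 * fnorm X.
have nA : fnorm A = x by rewrite fnormZ normc_inv.
have hA : fnorm (X1 - A) <= e * x.
  by rewrite -nA; apply: fl_matrix => // a b; rewrite scalemxE.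
have uUa : adj U \is unitarymx by rewrite adj_unitary; exact: uU.
have iso (Y : 'M[C]_k) : fnorm (adj U *m Y *m V) = fnorm Y.
  by rewrite (fnorm_unitaryr _ uV) (fnorm_unitaryl _ uUa).
have n1 : fnorm X1 <= (1 + e) * x.
  have h := fnormD (X1 - A) A; rewrite subrK nA in h; apply: le_trans h _.
  by rewrite mulrDl mul1r addrC lerD2l.
have x0 : 0 <= x by rewrite -nA fnorm_ge0.
have n2 : fnorm X1 <= 2 * x by apply: le_trans n1 _; rewrite ler_wpM2r // mulr2n lerD2l.
split.
  rewrite -(subrK (adj U *m X1 *m V) X2); apply: le_trans (fnormD _ _) _; rewrite iso.
  have h3 : e' * fnorm X1 <= fnorm X1 by rewrite ler_piMl ?fnorm_ge0.
  apply: le_trans (lerD (le_trans h2 h3) (lexx _)) _.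
  have -> : 4 * x = 2 * x + 2 * x by ring.
  exact: lerD.
have -> : X2 - adj U *m A *m V = (X2 - adj U *m X1 *m V) + adj U *m (X1 - A) *m V.
  by rewrite mulmxBr mulmxBl addrA subrK.
apply: le_trans (fnormD _ _) _; rewrite iso mulrDl; apply: lerD => //.
by apply: le_trans h2 _; rewrite mulrAC mulrC ler_wpM2r // mulrC.
Qed.

(** Carrying a coefficient back to the original polynomial multiplies its error by [alpha] only, the
    equivalence by [U] and [V] being unitary. *)
Lemma unscaled_difference (X Y : 'M[C]_k) :
  fnorm (alpha%:C *: (U *m Y *m adj V) - X) =
  alpha * fnorm (Y - adj U *m ((alpha^-1)%:C *: X) *m V).
Proof.
have ia : alpha%:C * (alpha^-1)%:C = 1.
  by rewrite -rmorphM /= mulfV ?gt_eqF // rmorph1.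
have EX : X = alpha%:C *: (U *m (adj U *m ((alpha^-1)%:C *: X) *m V) *m adj V).
  rewrite (mulmxA U) -(mulmxA _ V (adj V)) (unitary_mul_adj uV) mulmx1.
  by rewrite mulmxA (unitary_mul_adj uU) mul1mx scalerA ia scale1r.
rewrite {1}EX -scalerBr -mulmxBl -mulmxBr fnormZ normc_real gtr0_norm //; congr (_ * _).
have uVa : adj V \is unitarymx by rewrite adj_unitary; exact: uV.
by rewrite (fnorm_unitaryr _ uVa) (fnorm_unitaryl _ uU).
Qed.

End Scaling.

Section Unscaling.
Variables (R : realType) (d k : nat).
Local Notation C := R[i].
Local Notation n := (d * k)%N.
Implicit Types (P M N : nat -> 'M[C]_k).

Lemma coef_le_splitnorm M N i :
  ((i < d)%N -> fnorm (M i) <= splitnorm d M N) /\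
  ((0 < i <= d)%N -> fnorm (N i) <= splitnorm d M N).
Proof.
have p (r : seq nat) (F : nat -> 'M[C]_k) : 0 <= \sum_(j <- r) fnorm2 (F j).
  by apply: sumr_ge0 => j _; exact: fnorm2_ge0.
split=> hi; rewrite ler_wsqrtr //.
  rewrite (bigD1_seq i) /= ?iota_uniq ?mem_index_iota //.
  by rewrite -addrA lerDl addr_ge0 ?p // sumr_ge0 // => j _; exact: fnorm2_ge0.
rewrite addrC (bigD1_seq i) /= ?iota_uniq ?mem_index_iota //.
by rewrite -addrA lerDl addr_ge0 ?p // sumr_ge0 // => j _; exact: fnorm2_ge0.
Qed.

Lemma sum_splitnorm M N :
  \sum_(i < d) fnorm2 (M i) <= splitnorm d M N ^+ 2 /\
  \sum_(i < d) fnorm2 (N i.+1) <= splitnorm d M N ^+ 2.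
Proof.
have p (r : seq nat) (F : nat -> 'M[C]_k) : 0 <= \sum_(j <- r) fnorm2 (F j).
  by apply: sumr_ge0 => j _; exact: fnorm2_ge0.
rewrite sqr_sqrtr ?addr_ge0 ?p // -(big_mkord xpredT (fun i => fnorm2 (M i))).
rewrite -(big_mkord xpredT (fun i => fnorm2 (N i.+1))).
by rewrite -[X in _ /\ X <= _](big_add1 _ _ 0 d.+1 xpredT (fun i => fnorm2 (N i))) lerDl lerDr !p.
Qed.

Lemma polynorm_le P w : 0 <= w -> (forall i, (i < d.+1)%N -> fnorm (P i) <= w) ->
  polynorm d P <= d.+1%:R * w.
Proof.
move=> w0 h; have b0 : 0 <= d.+1%:R * w by rewrite mulr_ge0.
rewrite -(ger0_norm b0) -sqrtr_sqr ler_wsqrtr // exprMn.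
apply: le_trans (ler_wpM2r (sqr_ge0 w) (sqr_natr_ge R d.+1)).
have -> : d.+1%:R * w ^+ 2 = \sum_(i < d.+1) w ^+ 2 by rewrite sumr_const card_ord mulr_natl.
by apply: ler_sum => i _; rewrite -fnorm_sqr ler_pXn2r ?nnegrE ?fnorm_ge0 // h.
Qed.

Hypotheses (d0 : (0 < d)%N) (k0 : (0 < k)%N).

Lemma pencil_coef_diff (M M' N N' : nat -> 'M[C]_k) i : (i < d)%N ->
  fnorm (M' i - M i) <= fnorm (pencilS d M' - pencilS d M) /\
  fnorm (N' i.+1 - N i.+1) <= fnorm (pencilT d N' - pencilT d N).
Proof.
move=> hi; rewrite !fnorm_leE; split.
  apply: le_trans (pencilS_diff d0 k0 M M'); rewrite (bigD1 (Ordinal hi)) //= lerDl.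
  by apply: sumr_ge0 => j _; exact: fnorm2_ge0.
apply: le_trans (pencilT_diff d0 k0 N N'); rewrite (bigD1 (Ordinal hi)) //= lerDl.
by apply: sumr_ge0 => j _; exact: fnorm2_ge0.
Qed.

Lemma pencil_norms (X Y M N : nat -> 'M[C]_k) (a c y : R) : 0 <= a ->
  (forall i, (i < d)%N -> fnorm (M i) <= 4 * (a * fnorm (X i))) ->
  (forall i, (0 < i <= d)%N -> fnorm (N i) <= 4 * (a * fnorm (Y i))) ->
  a * splitnorm d X Y <= c * c -> 100 <= y -> n.+1%:R <= y -> 0 <= c -> 100 * c <= y ->
  fnorm (pencilS d M) <= y ^+ 2 /\ fnorm (pencilT d N) <= y ^+ 2.
Proof.
move=> a0 hM hN hc y100 yn c0 hy.
have s0 : 0 <= splitnorm d X Y by exact: sqrtr_ge0.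
pose b := 4 * (a * splitnorm d X Y); have b0 : 0 <= b by rewrite !mulr_ge0.
have hb : n%:R + b <= y ^+ 2.
  have h1 : (100 * c) * (100 * c) <= y * y by apply: ler_pM; rewrite ?mulr_ge0.
  have h2 : 100 * y <= y * y by apply: ler_wpM2r => //; exact: le_trans y100.
  have h3 : n%:R <= y by apply: le_trans yn; rewrite ler_nat.
  rewrite expr2 /b; move: hc h1 h2 h3 (c0) y100.
  by move: (a * _) (n%:R) => x z; clear -R; move=> *; nra.
have [sX sY] := sum_splitnorm X Y.
have sq (F G : nat -> 'M[C]_k) : (forall i, (i < d)%N -> fnorm (F i) <= 4 * (a * fnorm (G i))) ->
    \sum_(i < d) fnorm2 (G i) <= splitnorm d X Y ^+ 2 -> \sum_(i < d) fnorm2 (F i) <= b ^+ 2.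
  move=> hFG hG; rewrite /b mulrA exprMn; apply: le_trans (ler_wpM2l (sqr_ge0 _) hG).
  rewrite mulr_sumr; apply: ler_sum => i _; rewrite -!fnorm_sqr -exprMn -mulrA.
  by rewrite ler_pXn2r ?nnegrE ?fnorm_ge0 ?mulr_ge0 ?fnorm_ge0 ?hFG.
split; apply: le_trans hb.
  by apply: (pencilS_le d0 k0 b0); exact: sq sX.
by apply: (pencilT_le d0 k0 b0); apply: (sq (fun i => N i.+1) (fun i => Y i.+1)) sY => i hi; exact: hN.
Qed.

Lemma eigenvalues_unscaled (P M N : nat -> 'M[C]_k) (a : R) (U V : 'M[C]_k)
    (sv tv : nat -> C) (c : C) evs :
  U \is unitarymx -> V \is unitarymx -> 0 < a -> splitting d P M N -> c != 0 ->
  (forall z, \det (pencilS d M - z *: pencilT d N) = c * \prod_(j < n) (sv j - z * tv j)) ->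
  size evs = n ->
  (forall j, (j < n)%N -> match nth None evs j with
     | Some z => tv j != 0 /\ z = sv j / tv j
     | None => tv j = 0 /\ sv j != 0 end) ->
  eigenvalues_of d (fun i => a%:C *: (U *m P i *m adj V)) evs.
Proof.
move=> uU uV a0 hP c0 hdet sz hev.
have [s s0 hs] := det_pencil d0 k0 hP.
have uVa : adj V \is unitarymx by rewrite adj_unitary; exact: uV.
have nz (X : 'M[C]_k) : X \is unitarymx -> \det X != 0.
  by move=> /unitarymx_unit; rewrite unitmxE unitfE.
have aC : a%:C != 0 :> C by rewrite fmorph_eq0 gt_eqF.
apply: (@eigenvalues_of_factored R d k _ evs sv tv
  (a%:C ^+ k * (\det U * \det (adj V)) * (s^-1 * c))); [|move=> z|exact: sz|exact: hev].
  have h1 := mulf_neq0 (nz _ uU) (nz _ uVa); have h2 := expf_neq0 k aC.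
  by apply: mulf_neq0; apply: mulf_neq0; rewrite ?invr_eq0.
have -> : \sum_(i < d.+1) z ^+ i *: (a%:C *: (U *m P i *m adj V)) =
    a%:C *: (U *m (\sum_(i < d.+1) z ^+ i *: P i) *m adj V).
  rewrite mulmx_sumr mulmx_suml scaler_sumr; apply: eq_bigr => i _.
  by rewrite -scalemxAr -scalemxAl !scalerA mulrC.
rewrite detZ !det_mulmx -[RHS]mulrA -(mulrA _ c) -hdet hs (mulrA s^-1) mulVf // mul1r.
by ring.
Qed.

End Unscaling.

Section Algorithm.
Variables (R : realType) (d k q : nat) (K y u alpha : R).
Local Notation C := R[i].
Local Notation n := (d * k)%N.
Local Notation c := (modest K q d k).
Hypotheses (d0 : (0 < d)%N) (k0 : (0 < k)%N) (y100 : 100 <= y) (yn : n.+1%:R <= y)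
  (c1 : 1 <= c) (yc : 100 * c <= y) (hK : 0 <= K <= c) (u_gt0 : 0 < u)
  (uy : y ^+ 40 * u <= 1) (a0 : 0 < alpha).
Variables (P M N : nat -> 'M[C]_k) (evs : seq (option C)).
Hypotheses (hspl : splitting d P M N)
  (hsn : splitnorm d M N <= c * polynorm d P)
  (ha : alpha <= c * polynorm d P) (hP : polynorm d P <= c * alpha).

Lemma computed_backward_error : computed_eigenvalues K q d u alpha M N evs ->
  exists dP : nat -> 'M[C]_k,
    eigenvalues_of d (fun i => P i + dP i) evs /\
    polynorm d dP <= y ^+ 45 * u * polynorm d P.
Proof.
move=> [M1 [N1 [M2 [N2 [m [m' [s0 [s1 [s2 [hscal hprep hinit hrun]]]]]]]]]].
have [[h01 _] [h12 htri] hm sz hev] := hrun.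
have {hscal} [scM scN] := hscal; have {hprep} [U [V [[uU uV] prM prN hN2]]] := hprep.
have c0 : 0 <= c by exact: le_trans c1.
have u0 := ltW u_gt0; have ai : 0 <= alpha^-1 by rewrite invr_ge0 ltW.
have y1 := y_ge1 y100; have y0 := y_ge0 y100.
have cy : c <= y by apply: le_trans yc; rewrite ler_peMl // ler1n.
have yu1 : y * u <= 1.
  apply: le_trans uy; apply: ler_wpM2r => //; rewrite -[leLHS]expr1; exact: ler_weXn2l.
have /andP[K0 Kc] := hK.
have he : 0 <= K * u <= y * u by rewrite mulr_ge0 //= ler_wpM2r // (le_trans Kc).
have he' : 0 <= c * u <= y * u by rewrite mulr_ge0 //= ler_wpM2r.
have he1 : 0 <= K * u <= 1 by case/andP: he => -> /= h; exact: le_trans yu1.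
have he1' : 0 <= c * u <= 1 by case/andP: he' => -> /= h; exact: le_trans yu1.
have hc2 : alpha^-1 * splitnorm d M N <= c * c.
  rewrite mulrC ler_pdivrMr // -mulrA; apply: le_trans hsn _; exact: ler_wpM2l.
have coefM i (hi : (i < d)%N) :=
  scaled_coefficient he1 he1' a0 uU uV (fun a b => scM i a b hi) (prM i hi).
have coefN i (hi : (0 < i <= d)%N) :=
  scaled_coefficient he1 he1' a0 uU uV (fun a b => scN i a b hi) (prN i hi).
have [nS nT] := pencil_norms d0 k0 ai (fun i hi => (coefM i hi).1) (fun i hi => (coefN i hi).1)
  hc2 y100 yn c0 yc.
have my : (m + m')%:R <= y by exact: le_trans cy.
have [M3 [N3 [sv [tv [x [[x0 hdet] hmatch eS eT]]]]]] :=
  structured_backward_error d0 k0 y100 yn u0 uy he he' nS nT hN2 hinit h01 h12 my htri hev.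
(* The perturbed polynomial is defined by its splitting; at [i = 0] and [i = d] only one of the two
   summands is present. *)
pose P3 i := (if (i < d)%N then M3 i else 0) + (if (0 < i)%N then N3 i else 0).
have hP3 : splitting d P3 M3 N3.
  split; rewrite /P3; first by rewrite d0 addr0.
    by rewrite ltnn d0 add0r.
  by move=> i /andP[-> ->].
pose dP i := alpha%:C *: (U *m P3 i *m adj V) - P i; exists dP; split.
  rewrite (_ : (fun i => P i + dP i) = fun i => alpha%:C *: (U *m P3 i *m adj V)).
    exact: (eigenvalues_unscaled d0 k0 uU uV a0 hP3 x0 hdet sz hmatch).
  by apply: boolp.funext => i; rewrite /dP addrC subrK.
have bc : bounded y 1 1 c by rewrite /bounded c0 expr1 mulr1.
have err (X X2 X3 : 'M[C]_k) : fnorm X <= splitnorm d M N ->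
    fnorm (X2 - adj U *m ((alpha^-1)%:C *: X) *m V) <=
      (2 * (c * u) + K * u) * (alpha^-1 * fnorm X) ->
    fnorm (X3 - X2) <= y ^+ 41 * u ->
    fnorm (alpha%:C *: (U *m X3 *m adj V) - X) <= alpha * (y ^+ 42 * u).
  move=> hX h2 h3; rewrite (unscaled_difference a0 uU uV) ler_pM2l //.
  apply: le_trans (fnormB_trans X2 _ _) _; apply: bounded_le; apply: boundedD => //.
    by apply/andP; split; [exact: fnorm_ge0|exact: h3].
  apply: (bounded_trans h2); first exact: fnorm_ge0.
  rewrite mulrC; apply: (boundedW y100 u0) (_ : (1 + 1 + 3 <= 41)%N) _ => //.
  apply: boundedM.
    apply: (bounded_trans _ _ (boundedM bc bc)); last by rewrite mulr_ge0 ?fnorm_ge0.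
    by apply: le_trans hc2; rewrite ler_wpM2l.
  have b1 : bounded y 1 u (c * u) by rewrite /bounded expr1.
  have b2 : bounded y 1 u (K * u) by rewrite /bounded expr1.
  apply: boundedD => //; last exact: (boundedW y100 u0 _ b2).
  by apply: (@boundedM _ _ 1 1) b1; exact: bounded_nat.
have [nM nN] : (forall i, (i < d)%N -> fnorm (M i) <= splitnorm d M N) /\
    (forall i, (0 < i <= d)%N -> fnorm (N i) <= splitnorm d M N).
  by split=> i; have [] := coef_le_splitnorm d M N i.
have w0 : 0 <= alpha * (y ^+ 42 * u) by rewrite !mulr_ge0 ?exprn_ge0 // ltW.
have hdP i : (i < d.+1)%N -> fnorm (dP i) <= alpha * (y ^+ 42 * u) + alpha * (y ^+ 42 * u).
  move=> hi; have -> : dP i =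
      (if (i < d)%N then alpha%:C *: (U *m M3 i *m adj V) - M i else 0) +
      (if (0 < i)%N then alpha%:C *: (U *m N3 i *m adj V) - N i else 0).
    rewrite /dP /P3 (splitting_coef d0 hspl hi) mulmxDr mulmxDl scalerDr opprD addrACA.
    by congr (_ + _); case: ifP => // _; rewrite mulmx0 mul0mx scaler0 subr0.
  apply: le_trans (fnormD _ _) _; apply: lerD.
    case: ifP => h; last by rewrite fnorm0.
    apply: (err _ _ _ (nM i h) (coefM i h).2).
    by have [h' _] := pencil_coef_diff d0 k0 M2 M3 N2 N3 h; exact: le_trans h' eS.
  case: i hi => [|i] hi /=; first by rewrite fnorm0.
  have h : (0 < i.+1 <= d)%N by [].
  apply: (err _ _ _ (nN _ h) (coefN _ h).2).
  by have [_ h'] := pencil_coef_diff d0 k0 M2 M3 N2 N3 (h : (i < d)%N); exact: le_trans h' eT.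
apply: le_trans (polynorm_le _ hdP) _; first exact: addr_ge0.
have p0 : 0 <= polynorm d P by exact: sqrtr_ge0.
have bd : bounded y 1 1 (d.+1%:R : R).
  rewrite /bounded ler0n expr1 mulr1; apply: le_trans yn; rewrite ler_nat ltnS.
  by rewrite leq_pmulr.
have b42 : bounded y 43 u (y ^+ 42 * u + y ^+ 42 * u).
  by apply: boundedD => //; exact: bounded_powr.
(* The exponent 45 consists of one power for [alpha <= c * polynorm d P], one for the factor
   [d + 1], and 43 for the sum of two errors [y^42 u]. *)
rewrite -mulrDr mulrCA; apply: (@le_trans _ _ ((c * polynorm d P) * (y ^+ (1 + 43) * u))).
  apply: ler_pM => //; first exact: ltW.
    exact: bounded_ge (boundedM bd b42).
  exact: bounded_le (boundedM bd b42).
rewrite mulrAC; apply: ler_wpM2r => //; rewrite mulrA exprS; apply: ler_wpM2r => //.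
by apply: ler_wpM2r => //; rewrite exprn_ge0.
Qed.

End Algorithm.

Theorem theorem17 (R : realType) (K : R) (q : nat) :
  exists (K' : R) (q' : nat), forall d k : nat, (0 < d)%N -> (0 < k)%N ->
  exists2 u0 : R, 0 < u0 &
  forall u : R, 0 < u <= u0 ->
  forall (P M N : nat -> 'M[R[i]]_k) (alpha : R) (evs : seq (option R[i])),
    splitting d P M N ->
    approx (modest K q d k) (splitnorm d M N) (polynorm d P) ->
    0 < alpha ->
    approx (modest K q d k) alpha (polynorm d P) ->
    computed_eigenvalues K q d u alpha M N evs ->
  exists dP : nat -> 'M[R[i]]_k,
    eigenvalues_of d (fun i => P i + dP i) evs /\
    polynorm d dP <= modest K' q' d k * u * polynorm d P.
Proof.
(* These make the final bound equal to [y ^ 45] for [y = 100 c n] with [c = modest K q d k]: the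
   factor [n] raises the degree [q] by one. *)
exists ((100 * K) ^+ 45), (45 * q.+1)%N => d k d0 k0.
set n := (d * k)%N; pose c := modest K q d k; pose y := 100 * c * n%:R.
have Ey : modest ((100 * K) ^+ 45) (45 * q.+1) d k = y ^+ 45.
  rewrite /modest -/n mulnC expnM natrX -exprMn; congr (_ ^+ 45).
  by rewrite /y /c /modest -/n expnSr natrM !mulrA.
have Y0 : 0 < 1 + `|y| by rewrite ltr_wpDr.
(* The threshold is fixed before the hypotheses that force [K], and thus [y], to be positive;
   [1 + |y|] is positive in any case and bounds [y] from above. *)
exists ((1 + `|y|) ^- 40); first by rewrite invr_gt0 exprn_gt0.
move=> u /andP[u_gt0 hu] P M N alpha evs hspl [hsn _] a0 [ha hP] hcomp; rewrite Ey.
(* alpha <= c |P| and |P| <= c alpha with alpha > 0 force c >= 1. *)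
have p0 : 0 <= polynorm d P by exact: sqrtr_ge0.
have cp : 0 < c * polynorm d P by exact: lt_le_trans a0 ha.
have p_gt0 : 0 < polynorm d P.
  by rewrite lt_neqAle p0 andbT; apply: contraTneq cp => <-; rewrite mulr0 ltxx.
have c_gt0 : 0 < c by rewrite -(pmulr_lgt0 _ p_gt0).
have c1 : 1 <= c.
  rewrite leNgt; apply/negP => c_lt1; have := le_trans hP (ler_wpM2l (ltW c_gt0) ha).
  rewrite mulrA -[leLHS]mul1r ler_pM2r // leNgt => /negP; apply.
  by rewrite mulr_ilt1 // ltW.
have n1 : 1 <= n%:R :> R by rewrite ler1n muln_gt0 d0.
have yc : 100 * c <= y by rewrite /y ler_peMr // mulr_ge0 // ltW.
have y100 : 100 <= y by apply: le_trans yc; rewrite ler_peMr.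
have y0 : 0 <= y by exact: le_trans y100.
have yn : n.+1%:R <= y.
  have h : n%:R <= c * n%:R by rewrite ler_peMl // ltW // (lt_le_trans ltr01).
  rewrite -natr1 /y -mulrA; move: h n1; move: (c * n%:R) (n%:R) => a b.
  by clear -R; move=> *; lra.
have nq : 1 <= (n ^ q)%:R :> R by rewrite ler1n expn_gt0 muln_gt0 d0 k0.
have K_gt0 : 0 < K by rewrite -(pmulr_lgt0 _ (lt_le_trans ltr01 nq)).
apply: (computed_backward_error d0 k0 y100 yn c1 yc _ u_gt0 _ a0 hspl hsn ha hP hcomp).
  by rewrite ltW //= /modest ler_peMr // ltW.
apply: (@le_trans _ _ ((1 + `|y|) ^+ 40 * u)).
  apply: ler_wpM2r; first exact: ltW.
  rewrite lerXn2r ?nnegrE //; first exact: ltW.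
  by rewrite ler_wpDl // ler_norm.
by rewrite mulrC -ler_pdivlMr ?exprn_gt0 // mul1r.
Qed.
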